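(* Let $S$ be an infinite supernatural number. The smooth Bunce-Deddens-Toeplitz algebra $A_S^\infty$ is closed under the holomorphic functional calculus: if $a\in A_S^\infty$ and $f$ is a holomorphic function on an open neighborhood of the spectrum of $a$ (in $A_S$), then $f(a)\in A_S^\infty$.
   Context: A supernatural number is a formal product $S=\prod_{p\text{ prime}}p^{\varepsilon_p}$ with $\varepsilon_p\in\{0,1,\dots,\infty\}$; it is infinite if $\sum_p\varepsilon_p=\infty$. A positive integer $l$ divides $S$ (written $l|S$) if for every prime $p$ the exponent of $p$ in $l$ is at most $\varepsilon_p$. Define $\mathbb{Z}/S\mathbb{Z}=\prod_p\mathbb{Z}/p^{\varepsilon_p}\mathbb{Z}$ with the product topology, where $\mathbb{Z}/p^\infty\mathbb{Z}$ means the $p$-adic integers $\mathbb{Z}_p$; $\mathbb{Z}$ is a dense subgroup via $k\mapsto(k\bmod p^{\varepsilon_p})_p$, so $f(k)$ makes sense for $f\in C(\mathbb{Z}/S\mathbb{Z})$ and $k\in\mathbb{Z}$. Let $H=\ell^2(\mathbb{Z})$, $H_+=\ell^2(\mathbb{Z}_{\ge0})$ with canonical bases $\{E_l\}_{l\in\mathbb{Z}}$, $\{E_k^+\}_{k\ge0}$. For $f\in C(\mathbb{Z}/S\mathbb{Z})$ let $m_fE_l=f(l)E_l$ on $H$ and $M_fE_k^+=f(k)E_k^+$ on $H_+$; let $VE_l=E_{l+1}$ and $UE_k^+=E_{k+1}^+$. Put $B_S=C^*\{V,m_f\}\subseteq B(H)$ (Bunce-Deddens algebra) and $A_S=C^*\{U,M_f\}\subseteq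 B(H_+)$ (Bunce-Deddens-Toeplitz algebra), with $f$ ranging over $C(\mathbb{Z}/S\mathbb{Z})$. RD means rapidly decaying, i.e. decaying faster than any inverse polynomial in the indices. The smooth Bunce-Deddens algebra is $$B_S^\infty=\Big\{b=\sum_{n\in\mathbb{Z}}V^nm_{f_n}: f_n\in C(\mathbb{Z}/S\mathbb{Z}),\ \{\|f_n\|_\infty\}\text{ is RD, and there is } l|S \text{ with } V^lbV^{-l}=b\Big\}\subseteq B_S.$$ Smooth compact operators: $\mathcal{K}^\infty$ is the set of operators $c=\sum_{k,s\ge0}c_{ks}P_{ks}$ on $H_+$ with $\{c_{ks}\}$ RD (i.e. $\sup_{k,s}(1+k)^M(1+s)^N|c_{ks}|<\infty$ for all $M,N\ge0$), where $P_{ks}E_r^+=\delta_{sr}E_k^+$. Toeplitz map: $T:B(H)\to B(H_+)$, $T(b)=P_{\ge0}bs$, where $s:H_+\to H$, $sE_k^+=E_k$, and $P_{\ge0}:H\to H_+$, $P_{\ge0}E_k=E_k^+$ for $k\ge0$ and $P_{\ge0}E_k=0$ for $k<0$. The smooth Bunce-Deddens-Toeplitz algebra is $A_S^\infty=\{T(b)+c: b\in B_S^\infty,\ c\in\mathcal{K}^\infty\}\subseteq A_S$; it is a $*$-subalgebra of $A_S$. *)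

(* Defs.v *)
(* Stdlib reals and Coquelicot; MathComp is used for primes, [logn] and
   ordinals only. *)
From Stdlib Require Import Reals Lra Lia ZArith List Permutation.
From Stdlib Require Import Classical ClassicalEpsilon FunctionalExtensionality
  ProofIrrelevance.
From mathcomp Require Import all_boot zify.
From Coquelicot Require Import Coquelicot.

Set Implicit Arguments.
Unset Strict Implicit.
Unset Printing Implicit Defensive.

Open Scope R_scope.

Fixpoint lsum {I : Type} {G : AbelianMonoid} (f : I -> G) (s : list I) : G :=
  match s with
  | nil => zero
  | i :: s' => plus (f i) (lsum f s')
  end.

(* The filter of finite subsets of [I] directed by inclusion; a finite subset
   is a list without repetition. *)
Definition finite_subsets (I : Type) (P : list I -> Prop) : Prop :=
  exists s0 : list I, forall s : list I, NoDup s -> incl s0 s -> P s.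

Definition is_usum {I : Type} {K : AbsRing} {V : NormedModule K}
    (f : I -> V) (l : V) : Prop :=
  filterlim (fun s => lsum f s) (@finite_subsets I) (locally l).

Lemma NoDup_extend (I : Type) (s0 : list I) :
  exists s, NoDup s /\ incl s0 s /\ incl s s0.
Proof.
elim: s0 => [|i s0 [s [Hs [H1 H2]]]].
  exists nil; split; [constructor|split; move=> x; case].
case: (classic (In i s)) => Hi.
  exists s; split=> //; split; last by move=> x Hx; right; apply: H2.
  move=> x [<-//|Hx]; exact: H1.
exists (i :: s); split; first by constructor.
by split; move=> x [<-|Hx]; [left| right; apply: H1|left|right; apply: H2].
Qed.

#[global] Instance finite_subsets_filter (I : Type) :
  ProperFilter (@finite_subsets I).
Proof.
constructor.
  move=> P [s0 H0]; case: (NoDup_extend s0) => s [Hs [H1 _]].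
  by exists s; apply: H0.
constructor.
- by exists nil.
- move=> P Q [s0 H0] [s1 H1]; exists (s0 ++ s1)%list => s Hs Hi; split.
    by apply: H0 => // x Hx; apply: Hi; apply: in_or_app; left.
  by apply: H1 => // x Hx; apply: Hi; apply: in_or_app; right.
- by move=> P Q HPQ [s0 H0]; exists s0 => s Hs Hi; apply: HPQ; apply: H0.
Qed.

Lemma is_usum_unique (I : Type) (K : AbsRing) (V : NormedModule K)
    (f : I -> V) (l l' : V) : is_usum f l -> is_usum f l' -> l = l'.
Proof.
exact: (@filterlim_locally_unique (list I) K V (@finite_subsets I) _).
Qed.

Definition usum {I : Type} {K : AbsRing} {V : CompleteNormedModule K}
    (f : I -> V) : V := iota (is_usum f).

Lemma usumE (I : Type) (K : AbsRing) (V : CompleteNormedModule K)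
    (f : I -> V) (l : V) : is_usum f l -> usum f = l.
Proof.
by move=> H; apply: iota_unique => // y Hy; apply: is_usum_unique Hy H.
Qed.

Section NonnegativeSums.
Variables (I : Type) (a : I -> R).
Hypothesis a_ge0 : forall i, 0 <= a i.

Lemma lsum_ge0 (s : list I) : 0 <= lsum a s.
Proof.
elim: s => [|i s IH] /=; first exact: Rle_refl.
by apply: Rplus_le_le_0_compat.
Qed.

Lemma lsum_incl (s t : list I) :
  NoDup s -> incl s t -> lsum a s <= lsum a t.
Proof.
elim: s t => [|i s IH] t Hs Hi /=; first exact: lsum_ge0.
inversion Hs; subst.
have [t1 [t2 Et]] : exists t1 t2, t = (t1 ++ i :: t2)%list.
  by apply: in_split; apply: Hi; left.
have -> : lsum a t = a i + lsum a (t1 ++ t2)%list.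
  rewrite Et; elim: t1 {Et} => [//|j t1 IHt] /=.
  rewrite IHt /plus /=; ring.
apply: Rplus_le_compat_l; apply: IH => // j Hj.
have := Hi j (or_intror Hj); rewrite Et => Hj'.
case: (in_app_or _ _ _ Hj') => [?|[?|?]].
- by apply: in_or_app; left.
- by subst.
- by apply: in_or_app; right.
Qed.

Lemma is_usum_partial (l : R) (s : list I) :
  is_usum a l -> NoDup s -> lsum a s <= l.
Proof.
move=> Hl Hs.
apply: (@filterlim_le (list I) (@finite_subsets I) _ (fun _ => lsum a s)
  (fun t => lsum a t) (Finite (lsum a s)) (Finite l)) => //.
- by exists s => t Ht Hi; apply: lsum_incl.
- by apply: filterlim_const.
Qed.

Lemma is_usum_lub (l : R) :
  is_lub (fun r => exists s, NoDup s /\ r = lsum a s) l -> is_usum a l.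
Proof.
move=> [Hub Hleast]; apply/filterlim_locally => eps.
have [s0 [Hs0 H0]] : exists s, NoDup s /\ l - eps < lsum a s.
  apply: NNPP => Hn; have := cond_pos eps => He.
  have : l <= l - eps; last by lra.
  apply: Hleast => r [s [Hs ->]]; apply: Rnot_lt_le => Hlt.
  by apply: Hn; exists s.
exists s0 => s Hs Hi.
have H1 : lsum a s0 <= lsum a s by apply: lsum_incl.
have H2 : lsum a s <= l by apply: Hub; exists s.
have H3 : Rabs (lsum a s - l) < eps.
  have He := cond_pos eps; apply: Rabs_def1; lra.
exact: H3.
Qed.

Lemma is_usum_bounded (M : R) :
  (forall s, NoDup s -> lsum a s <= M) -> exists l, is_usum a l /\ l <= M.
Proof.
move=> HM.
have [l Hl] : {l | is_lub (fun r => exists s, NoDup s /\ r = lsum a s) l}.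
  apply: completeness.
    by exists M => r [s [Hs ->]]; apply: HM.
  by exists (lsum a nil); exists nil; split=> //; constructor.
exists l; split; first exact: is_usum_lub.
by case: Hl => _; apply => r [s [Hs ->]]; apply: HM.
Qed.

End NonnegativeSums.

Record l2 (I : Type) := L2 {
  l2_coord :> I -> C;
  l2_summable : exists l : R, is_usum (fun i => Cmod (l2_coord i) ^ 2) l
}.

Lemma l2_ext (I : Type) (x y : l2 I) : (forall i, x i = y i) -> x = y.
Proof.
case: x y => x Hx [y Hy] /= E.
have E' : x = y by apply: functional_extensionality.
by subst; congr L2; apply: proof_irrelevance.
Qed.

Definition l2_norm (I : Type) (x : l2 I) : R :=
  sqrt (usum (fun i => Cmod (x i) ^ 2)).

Section L2Theory.
Variable I : Type.
Implicit Types x y : l2 I.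

Let sq_ge0 (x : I -> C) (i : I) : 0 <= Cmod (x i) ^ 2.
Proof. exact: pow2_ge_0. Qed.

Lemma l2_norm_ge0 x : 0 <= l2_norm x.
Proof. exact: sqrt_pos. Qed.

Lemma l2_norm_sqr x : is_usum (fun i => Cmod (x i) ^ 2) (l2_norm x ^ 2).
Proof.
case: (l2_summable x) => l Hl.
rewrite /l2_norm (usumE Hl) /= Rmult_1_r sqrt_sqrt //.
have := @is_usum_partial I _ (sq_ge0 x) l nil Hl (NoDup_nil _).
by [].
Qed.

Lemma l2_partial x (s : list I) :
  NoDup s -> lsum (fun i => Cmod (x i) ^ 2) s <= l2_norm x ^ 2.
Proof. by apply: is_usum_partial; [exact: sq_ge0|exact: l2_norm_sqr]. Qed.

Lemma l2_norm_le x (M : R) : 0 <= M ->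
  (forall s, NoDup s -> lsum (fun i => Cmod (x i) ^ 2) s <= M ^ 2) ->
  l2_norm x <= M.
Proof.
move=> HM H; case: (is_usum_bounded (sq_ge0 x) H) => l [Hl Hle].
rewrite /l2_norm (usumE Hl) -(sqrt_pow2 M) //; exact: sqrt_le_1_alt.
Qed.

Lemma l2_summable_bounded (x : I -> C) (M : R) :
  (forall s, NoDup s -> lsum (fun i => Cmod (x i) ^ 2) s <= M) ->
  exists l : R, is_usum (fun i => Cmod (x i) ^ 2) l.
Proof.
by move=> H; case: (is_usum_bounded (sq_ge0 x) H) => l [Hl _]; exists l.
Qed.

Lemma lsum_minkowski (x y : I -> C) (s : list I) :
  sqrt (lsum (fun i => Cmod (x i + y i) ^ 2) s) <=
  sqrt (lsum (fun i => Cmod (x i) ^ 2) s) +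
  sqrt (lsum (fun i => Cmod (y i) ^ 2) s).
Proof.
elim: s => [|i s IH] /=.
  rewrite /zero /= sqrt_0; lra.
set A := lsum _ s in IH *; set B := lsum _ s in IH *; set D := lsum _ s in IH *.
have HA : 0 <= A by apply: lsum_ge0 => j; apply: (sq_ge0 (fun i => x i + y i)%C).
have HB : 0 <= B by apply: lsum_ge0; apply: sq_ge0.
have HD : 0 <= D by apply: lsum_ge0; apply: sq_ge0.
have T := Cmod_triangle (Cmod (x i), sqrt B) (Cmod (y i), sqrt D).
rewrite /Cmod /= in T; rewrite -/(Cmod (x i)) -/(Cmod (y i)) in T.
rewrite -/(Cmod (x i)) -/(Cmod (y i)) !Rmult_1_r (sqrt_sqrt B) // (sqrt_sqrt D) // in T.
rewrite /plus /= !Rmult_1_r.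
apply: Rle_trans T; apply: sqrt_le_1_alt; apply: Rplus_le_compat.
  apply: Rmult_le_compat; try exact: Cmod_ge_0; exact: Cmod_triangle.
rewrite -(sqrt_sqrt A) //.
by apply: Rmult_le_compat; try exact: sqrt_pos.
Qed.

Lemma l2_norm_plus_aux x y (s : list I) : NoDup s ->
  lsum (fun i => Cmod (x i + y i) ^ 2) s <= (l2_norm x + l2_norm y) ^ 2.
Proof.
move=> Hs.
have H0 : 0 <= lsum (fun i => Cmod (x i + y i) ^ 2) s.
  by apply: lsum_ge0 => j; apply: (sq_ge0 (fun i => x i + y i)%C).
rewrite -(sqrt_sqrt _ H0) /= Rmult_1_r.
have H : sqrt (lsum (fun i => Cmod (x i + y i) ^ 2) s) <= l2_norm x + l2_norm y.
  apply: Rle_trans (lsum_minkowski x y s) _; apply: Rplus_le_compat.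
    rewrite -(sqrt_pow2 (l2_norm x)); last exact: l2_norm_ge0.
    by apply: sqrt_le_1_alt; apply: l2_partial.
  rewrite -(sqrt_pow2 (l2_norm y)); last exact: l2_norm_ge0.
  by apply: sqrt_le_1_alt; apply: l2_partial.
by apply: Rmult_le_compat; try exact: sqrt_pos.
Qed.

Lemma l2_norm_scal_aux (c : C) x (s : list I) : NoDup s ->
  lsum (fun i => Cmod (c * x i) ^ 2) s <= (Cmod c * l2_norm x) ^ 2.
Proof.
move=> Hs.
have -> : lsum (fun i => Cmod (c * x i) ^ 2) s =
          Cmod c ^ 2 * lsum (fun i => Cmod (x i) ^ 2) s.
  elim: s {Hs} => [|i s IH] /=; first by rewrite /zero /=; ring.
  rewrite IH Cmod_mult /plus /=; ring.
rewrite Rpow_mult_distr; apply: Rmult_le_compat_l; first exact: pow2_ge_0.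
exact: l2_partial.
Qed.

Definition l2_plus x y : l2 I :=
  L2 (l2_summable_bounded (@l2_norm_plus_aux x y)).

Definition l2_scal (c : C) x : l2 I :=
  L2 (l2_summable_bounded (@l2_norm_scal_aux c x)).

Lemma l2_zero_aux (s : list I) : NoDup s ->
  lsum (fun i => Cmod ((fun _ => 0%C) i) ^ 2) s <= 0.
Proof.
move=> _; elim: s => [|i s IH] /=; first by rewrite /zero /=; lra.
move: IH; rewrite /plus /= Cmod_0; lra.
Qed.

Definition l2_zero : l2 I := L2 (l2_summable_bounded l2_zero_aux).

Definition l2_opp x : l2 I := l2_scal (-(1))%C x.

Lemma l2_plus_comm x y : l2_plus x y = l2_plus y x.
Proof. by apply: l2_ext => i /=; ring. Qed.
Lemma l2_plus_assoc x y z : l2_plus x (l2_plus y z) = l2_plus (l2_plus x y) z.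
Proof. by apply: l2_ext => i /=; ring. Qed.
Lemma l2_plus_zero x : l2_plus x l2_zero = x.
Proof. by apply: l2_ext => i /=; ring. Qed.
Lemma l2_plus_opp x : l2_plus x (l2_opp x) = l2_zero.
Proof. by apply: l2_ext => i /=; ring. Qed.

Definition l2_AbelianMonoid_mixin :=
  AbelianMonoid.Mixin (l2 I) l2_plus l2_zero
    l2_plus_comm l2_plus_assoc l2_plus_zero.
Canonical l2_AbelianMonoid :=
  AbelianMonoid.Pack (l2 I) l2_AbelianMonoid_mixin (l2 I).
Definition l2_AbelianGroup_mixin :=
  AbelianGroup.Mixin l2_AbelianMonoid l2_opp l2_plus_opp.
Canonical l2_AbelianGroup :=
  AbelianGroup.Pack (l2 I)
    (AbelianGroup.Class (l2 I) l2_AbelianMonoid_mixin l2_AbelianGroup_mixin)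
    (l2 I).

Lemma l2_scal_assoc (c d : C) x : l2_scal c (l2_scal d x) = l2_scal (c * d)%C x.
Proof. by apply: l2_ext => i /=; ring. Qed.
Lemma l2_scal_one x : l2_scal 1%C x = x.
Proof. by apply: l2_ext => i /=; ring. Qed.
Lemma l2_scal_distr_l (c : C) x y :
  l2_scal c (l2_plus x y) = l2_plus (l2_scal c x) (l2_scal c y).
Proof. by apply: l2_ext => i /=; ring. Qed.
Lemma l2_scal_distr_r (c d : C) x :
  l2_scal (c + d)%C x = l2_plus (l2_scal c x) (l2_scal d x).
Proof. by apply: l2_ext => i /=; ring. Qed.

Definition l2_ModuleSpace_mixin :=
  ModuleSpace.Mixin C_Ring l2_AbelianGroup l2_scal
    l2_scal_assoc l2_scal_one l2_scal_distr_l l2_scal_distr_r.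
Canonical l2_ModuleSpace :=
  ModuleSpace.Pack C_Ring (l2 I)
    (ModuleSpace.Class C_Ring (l2 I) (AbelianGroup.class l2_AbelianGroup)
       l2_ModuleSpace_mixin) (l2 I).

Lemma l2_norm_triangle x y : l2_norm (plus x y) <= l2_norm x + l2_norm y.
Proof.
apply: l2_norm_le => [|s Hs]; last exact: l2_norm_plus_aux.
by apply: Rplus_le_le_0_compat; apply: l2_norm_ge0.
Qed.

Lemma l2_norm_scal (c : C) x : l2_norm (scal c x) <= Cmod c * l2_norm x.
Proof.
apply: l2_norm_le => [|s Hs]; last exact: l2_norm_scal_aux.
by apply: Rmult_le_pos; [exact: Cmod_ge_0|exact: l2_norm_ge0].
Qed.

Lemma l2_coord_le x (i : I) : Cmod (x i) <= l2_norm x.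
Proof.
have := @l2_partial x (i :: nil) (NoDup_cons _ (@List.in_nil _ i) (NoDup_nil _)).
rewrite [lsum _ _]/= /plus /zero /= => H.
apply: Rsqr_incr_0; rewrite /Rsqr; [lra|exact: Cmod_ge_0|exact: l2_norm_ge0].
Qed.

Lemma l2_norm_eq0 x : l2_norm x = 0 -> x = zero.
Proof.
move=> H; apply: l2_ext => i /=; apply: Cmod_eq_0.
by apply: Rle_antisym; [rewrite -H; exact: l2_coord_le|exact: Cmod_ge_0].
Qed.

End L2Theory.

Section NormedModuleOfNorm.
Variables (K : AbsRing) (V : ModuleSpace K) (N : V -> R).
Hypothesis N_triangle : forall x y, N (plus x y) <= N x + N y.
Hypothesis N_scal : forall (c : K) x, N (scal c x) <= abs c * N x.
Hypothesis N_eq0 : forall x, N x = 0 -> x = zero.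
Hypothesis N_zero : N zero = 0.

Definition norm_ball (x : V) (e : R) (y : V) : Prop := N (minus y x) < e.

Lemma norm_ball_center (x : V) (e : posreal) : norm_ball x e x.
Proof. rewrite /norm_ball minus_eq_zero N_zero; exact: cond_pos. Qed.

Lemma norm_ball_sym (x y : V) (e : R) : norm_ball x e y -> norm_ball y e x.
Proof.
rewrite /norm_ball => H; apply: Rle_lt_trans H.
rewrite -opp_minus -scal_opp_one.
apply: Rle_trans (N_scal _ _) _; rewrite abs_opp_one; lra.
Qed.

Lemma norm_ball_triangle (x y z : V) (e1 e2 : R) :
  norm_ball x e1 y -> norm_ball y e2 z -> norm_ball x (e1 + e2) z.
Proof.
rewrite /norm_ball => H1 H2; rewrite (minus_trans y z x).
by apply: Rle_lt_trans (N_triangle _ _) _; lra.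
Qed.

Definition norm_UniformSpace_mixin :=
  UniformSpace.Mixin V zero norm_ball
    norm_ball_center norm_ball_sym norm_ball_triangle.

Definition norm_NormedModuleAux :=
  NormedModuleAux.Pack K V
    (NormedModuleAux.Class K V (ModuleSpace.class K V)
       norm_UniformSpace_mixin) V.

Lemma norm_ball_compat1 (x y : norm_NormedModuleAux) (eps : R) :
  N (minus y x) < eps -> ball x eps y.
Proof. by []. Qed.

Lemma norm_ball_compat2 (x y : norm_NormedModuleAux) (eps : posreal) :
  ball x eps y -> N (minus y x) < 1 * eps.
Proof. by rewrite Rmult_1_l. Qed.

Definition norm_NormedModule_mixin :=
  NormedModule.Mixin K norm_NormedModuleAux N 1
    N_triangle N_scal norm_ball_compat1 norm_ball_compat2 N_eq0.

End NormedModuleOfNorm.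

Section L2Normed.
Variable I : Type.

Lemma l2_norm_zero : l2_norm (zero : l2 I) = 0.
Proof.
apply: Rle_antisym; last exact: l2_norm_ge0.
apply: l2_norm_le; first exact: Rle_refl.
by move=> s Hs; have := @l2_zero_aux I s Hs; rewrite /= Rmult_0_l.
Qed.

Definition l2_UniformSpace_mixin :=
  @norm_UniformSpace_mixin C_AbsRing (l2_ModuleSpace I) (@l2_norm I)
    (@l2_norm_triangle I) (@l2_norm_scal I) l2_norm_zero.
Canonical l2_UniformSpace :=
  UniformSpace.Pack (l2 I) l2_UniformSpace_mixin (l2 I).
Canonical l2_NormedModuleAux :=
  NormedModuleAux.Pack C_AbsRing (l2 I)
    (NormedModuleAux.Class C_AbsRing (l2 I)
       (ModuleSpace.class C_AbsRing (l2_ModuleSpace I))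
       l2_UniformSpace_mixin) (l2 I).
Definition l2_NormedModule_mixin :=
  @norm_NormedModule_mixin C_AbsRing (l2_ModuleSpace I) (@l2_norm I)
    (@l2_norm_triangle I) (@l2_norm_scal I) (@l2_norm_eq0 I) l2_norm_zero.
Canonical l2_NormedModule :=
  NormedModule.Pack C_AbsRing (l2 I)
    (NormedModule.Class C_AbsRing (l2 I)
       (NormedModuleAux.class C_AbsRing l2_NormedModuleAux)
       l2_NormedModule_mixin) (l2 I).

End L2Normed.

Definition inner (I : Type) (x y : l2 I) : C :=
  usum (V := C_CompleteNormedModule) (fun i => (x i * Cconj (y i))%C).

Lemma l2_basis_aux (I : Type) (i : I) (s : list I) : NoDup s ->
  lsum (fun j => Cmod (if excluded_middle_informative (j = i)
                       then 1%C else 0%C) ^ 2) s <= 1.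
Proof.
move=> Hs; set f := (fun j => _).
have f_ne (j : I) : j <> i -> f j = 0.
  rewrite /f => H; case: excluded_middle_informative => //= _.
  by rewrite Cmod_0; ring.
have f_eq (j : I) : j = i -> f j = 1.
  rewrite /f => H; case: excluded_middle_informative => //= _.
  by rewrite Cmod_1; ring.
have H0 (t : list I) : ~ In i t -> lsum f t = 0.
  elim: t => [//|j t IH] /= H; rewrite IH; last by tauto.
  rewrite f_ne; first by rewrite /plus /=; ring.
  by move=> E; apply: H; left.
elim: s Hs => [|j s IH] Hs /=; first by rewrite /zero /=; lra.
inversion Hs; subst.
case: (classic (j = i)) => E.
  by subst; rewrite H0 // f_eq // /plus /=; lra.
by rewrite f_ne // /plus /=; have := IH H3; lra.
Qed.

Definition l2_basis (I : Type) (i : I) : l2 I :=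
  L2 (l2_summable_bounded (@l2_basis_aux I i)).

Lemma l2_basis_same (I : Type) (i : I) : l2_basis i i = 1%C.
Proof. by rewrite /=; case: excluded_middle_informative. Qed.

Lemma l2_basis_diff (I : Type) (i j : I) : j <> i -> l2_basis i j = 0%C.
Proof. by move=> H; rewrite /=; case: excluded_middle_informative. Qed.

Record BL (K : AbsRing) (E F : NormedModule K) := mkBL {
  BL_fun :> E -> F;
  BL_linear : is_linear BL_fun
}.

Section BoundedOperators.
Variables (K : AbsRing) (E F : NormedModule K).
Implicit Types S T : BL E F.

Lemma BL_ext S T : (forall x, S x = T x) -> S = T.
Proof.
case: S T => S HS [T HT] /= H.
have H' : S = T by apply: functional_extensionality.
by subst; congr mkBL; apply: proof_irrelevance.
Qed.

Lemma is_linear_plus_fun (S T : E -> F) : is_linear S -> is_linear T ->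
  is_linear (fun x => plus (S x) (T x)).
Proof.
move=> [S1 S2 [M [HM S3]]] [T1 T2 [N [HN T3]]]; constructor.
- move=> x y; rewrite S1 T1 -!plus_assoc; congr plus.
  by rewrite plus_comm -plus_assoc; congr plus; rewrite plus_comm.
- by move=> k x; rewrite S2 T2 scal_distr_l.
- exists (M + N); split; first lra; move=> x.
  apply: Rle_trans (norm_triangle _ _) _; have := S3 x; have := T3 x; lra.
Qed.

Lemma is_linear_scal_fun (c : K) (T : E -> F) :
  (forall x y : K, mult x y = mult y x) -> is_linear T ->
  is_linear (fun x => scal c (T x)).
Proof.
move=> KC [T1 T2 [N [HN T3]]]; constructor.
- by move=> x y; rewrite T1 scal_distr_l.
- by move=> k x; rewrite T2 !scal_assoc KC.
- exists (abs c * N + 1); split.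
    have := Rmult_le_pos _ _ (abs_ge_0 c) (Rlt_le _ _ HN); lra.
  move=> x; apply: Rle_trans (norm_scal _ _) _.
  have H := Rmult_le_compat_l _ _ _ (abs_ge_0 c) (T3 x).
  have := norm_ge_0 x; nra.
Qed.

Definition BL_plus S T : BL E F :=
  mkBL (is_linear_plus_fun (BL_linear S) (BL_linear T)).
Definition BL_zero : BL E F := mkBL (@is_linear_zero K E F).

Definition BL_norm T : R :=
  real (Glb_Rbar (fun M => 0 <= M /\ forall x, norm (T x) <= M * norm x)).

Lemma BL_norm_glb T :
  is_glb_Rbar (fun M => 0 <= M /\ forall x, norm (T x) <= M * norm x)
    (Finite (BL_norm T)).
Proof.
rewrite /BL_norm; set A := (fun M => _).
have [M [HM H]] := linear_norm _ (BL_linear T).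
have [Hlb Hgl] := Glb_Rbar_correct A.
have H1 := Hgl (Finite 0) (fun m Hm => proj1 Hm).
have H2 := Hlb M (conj (Rlt_le _ _ HM) H).
by case: (Glb_Rbar A) Hlb Hgl H1 H2.
Qed.

Lemma BL_norm_ge0 T : 0 <= BL_norm T.
Proof. by apply: (proj2 (BL_norm_glb T) (Finite 0)) => m [Hm _]. Qed.

Lemma BL_norm_le T M :
  0 <= M -> (forall x, norm (T x) <= M * norm x) -> BL_norm T <= M.
Proof. by move=> H1 H2; apply: (proj1 (BL_norm_glb T) M). Qed.

Lemma BL_norm_apply T x : norm (T x) <= BL_norm T * norm x.
Proof.
case: (Rle_lt_or_eq_dec _ _ (norm_ge_0 x)) => Hx.
  have H : norm (T x) / norm x <= BL_norm T.
    apply: (proj2 (BL_norm_glb T) (Finite _)) => m [Hm H] /=.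
    by apply/Rle_div_l => //; exact: H.
  by move/Rle_div_l: H; apply.
have [M [HM H]] := linear_norm _ (BL_linear T).
have := H x; rewrite -Hx; lra.
Qed.

Lemma BL_norm_triangle S T : BL_norm (BL_plus S T) <= BL_norm S + BL_norm T.
Proof.
have HS := BL_norm_ge0 S; have HT := BL_norm_ge0 T.
apply: BL_norm_le => [|x /=]; first lra.
apply: Rle_trans (norm_triangle _ _) _.
have := BL_norm_apply S x; have := BL_norm_apply T x; lra.
Qed.

Lemma BL_norm_eq0 T : BL_norm T = 0 -> T = BL_zero.
Proof.
move=> H; apply: BL_ext => x /=; apply: norm_eq_zero.
by apply: Rle_antisym; [have := BL_norm_apply T x; rewrite H; lra|exact: norm_ge_0].
Qed.

Lemma BL_norm_zero : BL_norm BL_zero = 0.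
Proof.
apply: Rle_antisym; last exact: BL_norm_ge0.
by apply: BL_norm_le => [|x /=]; rewrite ?norm_zero; lra.
Qed.

Lemma BL_plus_comm S T : BL_plus S T = BL_plus T S.
Proof. by apply: BL_ext => x /=; exact: plus_comm. Qed.
Lemma BL_plus_assoc S T U :
  BL_plus S (BL_plus T U) = BL_plus (BL_plus S T) U.
Proof. by apply: BL_ext => x /=; exact: plus_assoc. Qed.
Lemma BL_plus_zero S : BL_plus S BL_zero = S.
Proof. by apply: BL_ext => x /=; exact: plus_zero_r. Qed.

Definition BL_AbelianMonoid_mixin :=
  AbelianMonoid.Mixin (BL E F) BL_plus BL_zero
    BL_plus_comm BL_plus_assoc BL_plus_zero.
Canonical BL_AbelianMonoid :=
  AbelianMonoid.Pack (BL E F) BL_AbelianMonoid_mixin (BL E F).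

Lemma is_linear_opp_fun (T : E -> F) : is_linear T ->
  is_linear (fun x => opp (T x)).
Proof.
move=> [T1 T2 [N [HN T3]]]; constructor.
- by move=> x y; rewrite T1 opp_plus.
- by move=> k x; rewrite T2 scal_opp_r.
- by exists N; split=> // x; rewrite norm_opp.
Qed.

Definition BL_opp T : BL E F := mkBL (is_linear_opp_fun (BL_linear T)).

Lemma BL_plus_opp T : BL_plus T (BL_opp T) = BL_zero.
Proof. by apply: BL_ext => x /=; exact: plus_opp_r. Qed.

Definition BL_AbelianGroup_mixin :=
  AbelianGroup.Mixin BL_AbelianMonoid BL_opp BL_plus_opp.
Canonical BL_AbelianGroup :=
  AbelianGroup.Pack (BL E F)
    (AbelianGroup.Class (BL E F) BL_AbelianMonoid_mixin BL_AbelianGroup_mixin)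
    (BL E F).

End BoundedOperators.

Section ComplexBoundedOperators.
Variables E F : NormedModule C_AbsRing.
Implicit Types S T : BL E F.

Definition BL_scal (c : C) T : BL E F :=
  mkBL (is_linear_scal_fun c Cmult_comm (BL_linear T)).

Lemma BL_scal_assoc (c d : C) T : BL_scal c (BL_scal d T) = BL_scal (c * d)%C T.
Proof. by apply: BL_ext => x /=; rewrite scal_assoc. Qed.
Lemma BL_scal_one T : BL_scal 1%C T = T.
Proof. by apply: BL_ext => x /=; exact: scal_one. Qed.
Lemma BL_scal_distr_l (c : C) S T :
  BL_scal c (BL_plus S T) = BL_plus (BL_scal c S) (BL_scal c T).
Proof. by apply: BL_ext => x /=; rewrite scal_distr_l. Qed.
Lemma BL_scal_distr_r (c d : C) T :
  BL_scal (c + d)%C T = BL_plus (BL_scal c T) (BL_scal d T).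
Proof. by apply: BL_ext => x /=; exact: (scal_distr_r (V := F) c d). Qed.

Definition BL_ModuleSpace_mixin :=
  ModuleSpace.Mixin C_Ring (BL_AbelianGroup E F) BL_scal
    BL_scal_assoc BL_scal_one BL_scal_distr_l BL_scal_distr_r.
Canonical BL_ModuleSpace :=
  ModuleSpace.Pack C_Ring (BL E F)
    (ModuleSpace.Class C_Ring (BL E F)
       (AbelianGroup.class (BL_AbelianGroup E F)) BL_ModuleSpace_mixin)
    (BL E F).

Lemma BL_norm_scal (c : C) T : BL_norm (BL_scal c T) <= Cmod c * BL_norm T.
Proof.
apply: BL_norm_le => [|x /=].
  by apply: Rmult_le_pos; [exact: Cmod_ge_0|exact: BL_norm_ge0].
apply: Rle_trans (norm_scal _ _) _; rewrite Rmult_assoc.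
by apply: Rmult_le_compat_l; [exact: Cmod_ge_0|exact: BL_norm_apply].
Qed.

Definition BL_UniformSpace_mixin :=
  @norm_UniformSpace_mixin C_AbsRing BL_ModuleSpace (@BL_norm _ E F)
    (@BL_norm_triangle _ E F) BL_norm_scal (@BL_norm_zero _ E F).
Canonical BL_UniformSpace :=
  UniformSpace.Pack (BL E F) BL_UniformSpace_mixin (BL E F).
Canonical BL_NormedModuleAux :=
  NormedModuleAux.Pack C_AbsRing (BL E F)
    (NormedModuleAux.Class C_AbsRing (BL E F)
       (ModuleSpace.class C_AbsRing BL_ModuleSpace)
       BL_UniformSpace_mixin) (BL E F).
Definition BL_NormedModule_mixin :=
  @norm_NormedModule_mixin C_AbsRing BL_ModuleSpace (@BL_norm _ E F)
    (@BL_norm_triangle _ E F) BL_norm_scal (@BL_norm_eq0 _ E F)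
    (@BL_norm_zero _ E F).
Canonical BL_NormedModule :=
  NormedModule.Pack C_AbsRing (BL E F)
    (NormedModule.Class C_AbsRing (BL E F)
       (NormedModuleAux.class C_AbsRing BL_NormedModuleAux)
       BL_NormedModule_mixin) (BL E F).

End ComplexBoundedOperators.

Definition BL_id (K : AbsRing) (E : NormedModule K) : BL E E :=
  mkBL (@is_linear_id K E).
Arguments BL_id {K E}.

Definition BL_comp (K : AbsRing) (E F G : NormedModule K)
    (S : BL F G) (T : BL E F) : BL E G :=
  mkBL (is_linear_comp _ _ (BL_linear T) (BL_linear S)).

(* For a partial injection [g] from [J] to [I] and bounded weights [w], the
   operator [(T x)_j = w_j * x_{g j}], read as [0] where [g] is undefined. *)
Section WeightedOperators.
Variables (I J : Type) (g : J -> option I) (w : J -> C).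

Definition partial_injective : Prop :=
  forall j j' i, g j = Some i -> g j' = Some i -> j = j'.

Hypothesis g_inj : partial_injective.
Hypothesis w_bounded : exists M, forall j, Cmod (w j) <= M.

Let W (x : I -> C) (j : J) : C :=
  match g j with Some i => (w j * x i)%C | None => 0%C end.

Lemma weighted_aux (M : R) (x : l2 I) (s : list J) :
  (forall j, Cmod (w j) <= M) -> NoDup s ->
  lsum (fun j => Cmod (W x j) ^ 2) s <= (M * l2_norm x) ^ 2.
Proof.
move=> HM Hs.
have [t [Ht [Hts Hle]]] : exists t, NoDup t /\
   (forall i, In i t -> exists j, In j s /\ g j = Some i) /\
   lsum (fun j => Cmod (W x j) ^ 2) s <= M ^ 2 * lsum (fun i => Cmod (x i) ^ 2) t.
  elim: s Hs => [|j s IH] Hs.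
    by exists nil; split; [constructor|split=> //=; rewrite /zero /=; lra].
  inversion Hs; subst; case: (IH H2) => t [Ht [Hts Hle]].
  rewrite [lsum _ (j :: s)]/=; case E : (g j) => [i|]; last first.
    have -> : Cmod (W x j) = 0 by rewrite /W E Cmod_0.
    exists t; split=> //; split.
      by move=> i /Hts [j' [? ?]]; exists j'; split=> //; right.
    by rewrite /plus /=; move: Hle; rewrite /= ; lra.
  exists (i :: t); split.
    constructor=> // /Hts [j' [Hj' E']].
    by apply: H1; rewrite (g_inj E E').
  split.
    move=> i' [<-|/Hts [j' [? ?]]]; first by exists j; split=> //; left.
    by exists j'; split=> //; right.
  have -> : Cmod (W x j) = Cmod (w j) * Cmod (x i).
    by rewrite /W E Cmod_mult.
  rewrite [lsum _ (i :: t)]/= /plus /=.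
  have H3 : Cmod (w j) * Cmod (w j) <= M * M.
    by apply: Rmult_le_compat; try exact: Cmod_ge_0.
  have := Rmult_le_compat_r _ _ _ (pow2_ge_0 (Cmod (x i))) H3.
  move: Hle => /=. lra.
apply: Rle_trans Hle _; rewrite Rpow_mult_distr.
by apply: Rmult_le_compat_l; [exact: pow2_ge_0|exact: l2_partial].
Qed.

Lemma weighted_summable (x : l2 I) :
  exists l : R, is_usum (fun j => Cmod (W x j) ^ 2) l.
Proof.
case: w_bounded => M HM.
by apply: (l2_summable_bounded (M := (M * l2_norm x) ^ 2)) => s; exact: weighted_aux.
Qed.

Definition weighted_fun (x : l2 I) : l2 J := L2 (weighted_summable x).

Lemma weighted_linear : is_linear (weighted_fun : l2 I -> l2 J).
Proof.
constructor.
- by move=> x y; apply: l2_ext => j /=; rewrite /W; case: (g j) => *; ring.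
- by move=> c x; apply: l2_ext => j /=; rewrite /W; case: (g j) => *; ring.
- case: w_bounded => M HM; exists (Rabs M + 1); split.
    have := Rabs_pos M; lra.
  move=> x; have Hx := l2_norm_ge0 x.
  apply: (@l2_norm_le J).
    by apply: Rmult_le_pos => //; have := Rabs_pos M; lra.
  move=> s Hs; apply: weighted_aux => // j.
  apply: Rle_trans (HM j) _; have := Rle_abs M; lra.
Qed.

Definition weighted_op : BL (l2_NormedModule I) (l2_NormedModule J) :=
  mkBL weighted_linear.

End WeightedOperators.

Lemma const_bounded (J : Type) (c : C) : exists M, forall j : J, Cmod c <= M.
Proof. by exists (Cmod c) => _; exact: Rle_refl. Qed.

Definition prime_number : Type := {p : nat | prime p}.

Definition prime_nat (p : prime_number) : nat := sval p.

(* [S p] is the exponent of [p], with [None] for infinity. *)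
Definition supernatural : Type := prime_number -> option nat.

Definition exponent_le (d : nat) (e : option nat) : Prop :=
  match e with Some m => (d <= m)%N | None => True end.

Definition sn_infinite (S : supernatural) : Prop :=
  forall N : nat, exists (s : list prime_number) (d : prime_number -> nat),
    NoDup s /\ (forall p, exponent_le (d p) (S p)) /\
    (N <= \sum_(p <- s) d p)%N.

Definition sn_divides (l : nat) (S : supernatural) : Prop :=
  (0 < l)%N /\ forall p, exponent_le (logn (prime_nat p) l) (S p).

(* [Z_p] as the inverse limit of the [Z/p^k]. *)
Definition padic (p : nat) : Type :=
  {x : forall k : nat, 'I_(p ^ k) |
    forall k, (x k.+1 %% p ^ k)%N = x k}.

Definition Zp_pow (p : nat) (e : option nat) : Type :=
  match e with Some m => 'I_(p ^ m) | None => padic p end.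

Definition Zmod_sn (S : supernatural) : Type :=
  forall p : prime_number, Zp_pow (prime_nat p) (S p).

(* The discrete topology on [Z/p^m], and on [Z_p] the one with basic
   neighbourhoods [x + p^k Z_p]; [Zmod_sn_nbhs] is the product topology. *)
Definition Zp_pow_nbhs (p : nat) (e : option nat) :
    Zp_pow p e -> (Zp_pow p e -> Prop) -> Prop :=
  match e with
  | Some m => fun x P => P x
  | None => fun x P => exists k : nat, forall y : padic p,
      sval y k = sval x k -> P y
  end.

Definition Zmod_sn_nbhs (S : supernatural) (x : Zmod_sn S)
    (P : Zmod_sn S -> Prop) : Prop :=
  exists (s : list prime_number)
         (N : forall p : prime_number, Zp_pow (prime_nat p) (S p) -> Prop),
    (forall p, In p s -> Zp_pow_nbhs (x p) (N p)) /\
    (forall y, (forall p, In p s -> N p (y p)) -> P y).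

Lemma prime_number_gt0 (p : prime_number) : (0 < prime_nat p)%N.
Proof. by case: p => p Hp; apply: prime_gt0. Qed.

Lemma residue_lt (n : nat) (k : Z) : (0 < n)%N ->
  (Z.to_nat (k mod Z.of_nat n) < n)%N.
Proof. by move=> Hn; have := Z.mod_pos_bound k (Z.of_nat n); lia. Qed.

Definition residue (n : nat) (Hn : (0 < n)%N) (k : Z) : 'I_n :=
  Ordinal (residue_lt k Hn).

Section IntegerPoints.
Variables (p : nat) (p_gt0 : (0 < p)%N).

Let pX_gt0 (k : nat) : (0 < p ^ k)%N.
Proof. by rewrite expn_gt0 p_gt0. Qed.

Lemma padic_of_Z_compat (z : Z) (k : nat) :
  (residue (pX_gt0 k.+1) z %% p ^ k)%N = residue (pX_gt0 k) z.
Proof.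
rewrite /= expnS; set q := (p ^ k)%N.
have Hq : (0 < q)%N := pX_gt0 k.
have H1 := Z.mod_pos_bound z (Z.of_nat (p * q)).
have H2 := Z.mod_pos_bound z (Z.of_nat q).
have E : (z mod Z.of_nat q = (z mod Z.of_nat (p * q)) mod Z.of_nat q)%Z.
  have Epq : Z.of_nat (p * q) = (Z.of_nat p * Z.of_nat q)%Z by lia.
  rewrite {1}(Z.div_mod z (Z.of_nat (p * q))); last by nia.
  have -> : (Z.of_nat (p * q) * (z / Z.of_nat (p * q)) + z mod Z.of_nat (p * q)
     = z mod Z.of_nat (p * q) +
       (Z.of_nat p * (z / Z.of_nat (p * q))) * Z.of_nat q)%Z.
    by rewrite {1}Epq; ring.
  by rewrite Z_mod_plus_full.
rewrite E; set r := (z mod Z.of_nat (p * q))%Z in H1 *.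
have Hr : (0 <= r)%Z by apply: (proj1 (H1 _)); nia.
apply: Nat2Z.inj; rewrite (Z2Nat.id (r mod _)); last first.
  by apply: (proj1 (Z.mod_pos_bound _ _ _)); lia.
have Hd := divn_eq (Z.to_nat r) q; have Hm := ltn_pmod (Z.to_nat r) Hq.
move: (Z.to_nat r %/ q)%N (Z.to_nat r %% q)%N Hd Hm => d m Hd Hm.
apply: (@Z.mod_unique _ _ (Z.of_nat d)); first by left; lia.
by rewrite -{1}(Z2Nat.id r Hr) Hd; lia.
Qed.

Definition padic_of_Z (z : Z) : padic p :=
  exist (fun x : forall k : nat, 'I_(p ^ k) =>
           forall k, (x k.+1 %% p ^ k)%N = x k)
    (fun k => residue (pX_gt0 k) z) (padic_of_Z_compat z).

Definition Zp_pow_of_Z (e : option nat) (z : Z) : Zp_pow p e :=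
  match e with
  | Some m => residue (pX_gt0 m) z
  | None => padic_of_Z z
  end.

End IntegerPoints.

Definition Zmod_sn_of_Z (S : supernatural) (z : Z) : Zmod_sn S :=
  fun p => Zp_pow_of_Z (prime_number_gt0 p) (S p) z.

Record CZS (S : supernatural) := mkCZS {
  CZS_fun :> Zmod_sn S -> C;
  CZS_continuous :
    forall x, filterlim CZS_fun (Zmod_sn_nbhs x) (locally (CZS_fun x))
}.

Section Compactness.
Variable S : supernatural.

(* The residue of the [p]-component modulo [p^min(k, S p)]. *)
Definition Zp_pow_residue (p : nat) (e : option nat) (k : nat) :
    Zp_pow p e -> nat :=
  match e with
  | Some m => fun x => nat_of_ord x
  | None => fun x => nat_of_ord (sval x k)
  end.

Lemma Zp_pow_residue_bounded (p : nat) (e : option nat) (k : nat) :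
  exists B, forall x : Zp_pow p e, (Zp_pow_residue k x < B)%N.
Proof.
by case: e => [m|] /=; [exists (p ^ m)%N => x|exists (p ^ k)%N => x];
  exact: ltn_ord.
Qed.

(* The [j]-th coordinate, [j] coding a pair of a prime and an exponent. *)
Definition coordinate (j : nat) (x : Zmod_sn S) : nat :=
  match unpickle j with
  | Some (p, k) =>
      match insub p with Some q => Zp_pow_residue k (x q) | None => 0%N end
  | None => 0%N
  end.

Lemma coordinateE (q : prime_number) (k : nat) (x : Zmod_sn S) :
  coordinate (pickle (sval q, k)) x = Zp_pow_residue k (x q).
Proof. by rewrite /coordinate pickleK valK. Qed.

Lemma coordinate_bounded (j : nat) :
  exists B, forall x, (coordinate j x < B)%N.
Proof.
rewrite /coordinate; case: (unpickle j) => [[p k]|]; last by exists 1%N.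
case: (insub p) => [q|]; last by exists 1%N.
have [B HB] := Zp_pow_residue_bounded (prime_nat q) (S q) k.
by exists B => x; apply: HB.
Qed.

Section Unbounded.
Variable f : Zmod_sn S -> C.

Let bounded_on (A : Zmod_sn S -> Prop) : Prop :=
  exists M : R, forall x, A x -> Cmod (f x) <= M.

Lemma split_unbounded (A : Zmod_sn S -> Prop) (c : Zmod_sn S -> nat) :
  (exists B, forall x, (c x < B)%N) -> ~ bounded_on A ->
  exists v, ~ bounded_on (fun x => A x /\ c x = v).
Proof.
move=> [B HB] HA; apply: NNPP => Hn; apply: HA.
have H v : bounded_on (fun x => A x /\ c x = v).
  by apply: NNPP => Hv; apply: Hn; exists v.
have [M HM] : bounded_on (fun x => A x /\ (c x < B)%N).
  elim: B {HB} => [|B [M HM]]; first by exists 0 => x [_]; rewrite ltn0.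
  case: (H B) => M' HM'; exists (Rmax M M') => x [Ax].
  rewrite ltnS leq_eqVlt => /orP [/eqP E|Hlt].
    by apply: Rle_trans (Rmax_r _ _); apply: HM'.
  by apply: Rle_trans (Rmax_l _ _); apply: HM.
by exists M => x Ax; apply: HM; split.
Qed.

Fixpoint branch (n : nat) : Zmod_sn S -> Prop :=
  match n with
  | 0%N => fun _ => True
  | n'.+1 => fun x => branch n' x /\ coordinate n' x =
      epsilon (inhabits 0%N)
        (fun v => ~ bounded_on (fun x => branch n' x /\ coordinate n' x = v))
  end.

Definition branch_value (n : nat) : nat :=
  epsilon (inhabits 0%N)
    (fun v => ~ bounded_on (fun x => branch n x /\ coordinate n x = v)).

Lemma branch_coordinate (n j : nat) (x : Zmod_sn S) :
  (j < n)%N -> branch n x -> coordinate j x = branch_value j.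
Proof.
elim: n => [//|n IH] Hj /= [Hx E].
move: Hj; rewrite ltnS leq_eqVlt => /orP [/eqP ->|Hj]; first exact: E.
exact: IH.
Qed.

Hypothesis f_unbounded : ~ bounded_on (fun _ => True).

Lemma branch_unbounded (n : nat) : ~ bounded_on (branch n).
Proof.
elim: n => [//|n IH].
by have := epsilon_spec (inhabits 0%N) _
  (split_unbounded (coordinate_bounded n) IH).
Qed.

Lemma branch_nonempty (n : nat) : exists x, branch n x.
Proof.
apply: NNPP => Hn; apply: (branch_unbounded (n := n)).
by exists 0 => x Hx; case: Hn; exists x.
Qed.

Lemma branch_point_p (q : prime_number) :
  exists y : Zp_pow (prime_nat q) (S q),
    forall k, Zp_pow_residue k y = branch_value (pickle (sval q, k)).
Proof.
have Hv k n : (pickle (sval q, k) < n)%N ->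
    forall x, branch n x ->
    Zp_pow_residue k (x q) = branch_value (pickle (sval q, k)).
  by move=> Hk x Hx; rewrite -coordinateE; apply: branch_coordinate Hk Hx.
have Hw : forall k k', exists z : Zp_pow (prime_nat q) (S q),
    Zp_pow_residue k z = branch_value (pickle (sval q, k)) /\
    Zp_pow_residue k' z = branch_value (pickle (sval q, k')).
  move=> k k'.
  set n := (pickle (sval q, k) + pickle (sval q, k')).+1.
  have [x Hx] := branch_nonempty n.
  by exists (x q); split; apply: (Hv _ n) => //; rewrite ltnS ?leq_addr ?leq_addl.
suff H (v : nat -> nat) : (forall k k', exists z : Zp_pow (prime_nat q) (S q),
    Zp_pow_residue k z = v k /\ Zp_pow_residue k' z = v k') ->
    exists y : Zp_pow (prime_nat q) (S q), forall k, Zp_pow_residue k y = v k.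
  exact: (H (fun k => branch_value (pickle (sval q, k)))).
clear Hv Hw; case: (S q) => [m|] /= Hw.
  have [z [Hz _]] := Hw 0%N 0%N; exists z => k.
  have [z' [Hz1 Hz2]] := Hw 0%N k.
  by rewrite -Hz2 Hz1.
have Hlt k : (v k < prime_nat q ^ k)%N.
  by have [z [<- _]] := Hw k k; exact: ltn_ord.
have Hc k : (Ordinal (Hlt k.+1) %% prime_nat q ^ k)%N = Ordinal (Hlt k).
  have [z [H1 H2]] := Hw k.+1 k; rewrite /= -H1 -H2; exact: (svalP z).
by exists (exist (fun x : forall k : nat, 'I_(prime_nat q ^ k) =>
   forall k, (x k.+1 %% prime_nat q ^ k)%N = x k) (fun k => Ordinal (Hlt k)) Hc).
Qed.

Lemma branch_point : exists y : Zmod_sn S,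
  forall n j x, (j < n)%N -> branch n x ->
  forall q k, j = pickle (sval q, k) ->
  Zp_pow_residue k (x q) = Zp_pow_residue k (y q).
Proof.
pose y (q : prime_number) := sval (constructive_indefinite_description _
  (branch_point_p q)).
exists y => n j x Hj Hx q k E.
rewrite /y; case: constructive_indefinite_description => z /= ->.
by rewrite -E -coordinateE -E; apply: branch_coordinate Hj Hx.
Qed.

End Unbounded.

Lemma Zp_pow_nbhs_residue (p : nat) (e : option nat) (x : Zp_pow p e)
    (N : Zp_pow p e -> Prop) : Zp_pow_nbhs x N ->
  exists k, forall y, Zp_pow_residue k y = Zp_pow_residue k x -> N y.
Proof.
case: e x N => [m|] x N /= H.
  by exists 0%N => y /val_inj ->.
by case: H => k Hk; exists k => y /val_inj; apply: Hk.
Qed.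

Lemma CZS_bounded (f : CZS S) : exists M : R, forall x, Cmod (f x) <= M.
Proof.
apply: NNPP => Hn.
have Hunb : ~ (exists M : R, forall x, True -> Cmod (f x) <= M).
  by move=> [M HM]; apply: Hn; exists M => x; apply: HM.
have [y Hy] := branch_point Hunb.
have Hnear : Zmod_sn_nbhs y (fun x => Cmod (f x) <= Cmod (f y) + 1).
  apply: (@CZS_continuous S f y (fun z => Cmod z <= Cmod (f y) + 1)).
  have Hs : 0 < / (1 * sqrt 2).
    apply: Rinv_0_lt_compat; have := sqrt_lt_R0 2; lra.
  exists (mkposreal _ Hs) => z Hz.
  have := @norm_compat2 C_AbsRing C_NormedModule (f y) z (mkposreal _ Hs) Hz.
  rewrite /= /norm_factor /norm /=.
  have -> : sqrt 2 * / (1 * sqrt 2) = 1.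
    field; have := sqrt_lt_R0 2; lra.
  move=> H; have E (u v : C) : v = (u + (v - u))%C by ring.
  rewrite (E (f y) z).
  by apply: Rle_trans (Cmod_triangle _ _) _; apply: Rplus_le_compat_l; apply: Rlt_le.
case: Hnear => s [N [HN HP]].
have [n Hnn] : exists n, forall x, branch f n x -> forall q, In q s -> N q (x q).
  elim: s HN {HP} => [|q s IH] HN; first by exists 0%N => x _ q [].
  case: IH => [q' Hq'|n Hnn]; first by apply: HN; right.
  have [k Hk] := Zp_pow_nbhs_residue (HN q (or_introl erefl)).
  exists (maxn n (pickle (sval q, k)).+1) => x Hx q' [<-|Hq'].
    by apply: Hk; apply: (Hy _ _ _ _ Hx _ _ erefl); rewrite leq_maxr.
  apply: Hnn => //.
  have Hmono m m' : (m <= m')%N -> branch f m' x -> branch f m x.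
    elim: m' => [|m' IH']; first by rewrite leqn0 => /eqP ->.
    by rewrite leq_eqVlt => /orP [/eqP ->//|Hlt] /= [Hb _]; apply: IH'.
  by apply: Hmono Hx; rewrite leq_maxl.
apply: (branch_unbounded Hunb (n := n)).
by exists (Cmod (f y) + 1) => x Hx; apply: HP => q Hq; apply: Hnn.
Qed.

End Compactness.

Definition sup_norm (S : supernatural) (f : CZS S) : R :=
  real (Lub_Rbar (fun r => exists x, r = Cmod (f x))).

Notation HZ := (l2_NormedModule Z).
Notation HN := (l2_NormedModule nat).

Lemma weighted_basis (I J : Type) (g : J -> option I) (w : J -> C)
    (Hg : partial_injective g) (Hw : exists M, forall j, Cmod (w j) <= M)
    (i : I) (j : J) : g j = Some i ->
  weighted_op Hg Hw (l2_basis i) = scal (w j) (l2_basis j).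
Proof.
move=> E; apply: l2_ext => j'; rewrite /= /scal /= /mult /=.
case: excluded_middle_informative => Hj /=.
  by subst; rewrite E; case: excluded_middle_informative.
case E' : (g j') => [i'|]; last by ring.
case: excluded_middle_informative => Hi /=; last by ring.
by subst; case: Hj; exact: Hg E' E.
Qed.

Lemma weighted_basis0 (I J : Type) (g : J -> option I) (w : J -> C)
    (Hg : partial_injective g) (Hw : exists M, forall j, Cmod (w j) <= M)
    (i : I) : (forall j, g j <> Some i) ->
  weighted_op Hg Hw (l2_basis i) = zero.
Proof.
move=> E; apply: l2_ext => j /=.
case E' : (g j) => [i'|] //.
case: excluded_middle_informative => Hi /=; last by ring.
by subst; case: (E j).
Qed.

Lemma shift_inj (n : Z) : partial_injective (fun l : Z => Some (l - n)%Z).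
Proof. by move=> l l' k [<-] [H]; lia. Qed.

(* [shift n] is the power [V ^ n], for [n] in [Z], of the bilateral shift
   [V = shift 1]. *)
Definition shift (n : Z) : BL HZ HZ :=
  weighted_op (@shift_inj n) (const_bounded Z 1%C).

Lemma shift_basis (n l : Z) : shift n (l2_basis l) = l2_basis (l + n)%Z.
Proof.
rewrite /shift (@weighted_basis _ _ _ _ _ _ l (l + n)%Z).
  by apply: l2_ext => j /=; ring.
by congr Some; lia.
Qed.

Lemma shift_add (m n : Z) : BL_comp (shift m) (shift n) = shift (m + n).
Proof.
apply: BL_ext => x; apply: l2_ext => l /=.
have -> : (l - m - n = l - (m + n))%Z by lia.
ring.
Qed.

Lemma shift_0 : shift 0 = BL_id.
Proof.
apply: BL_ext => x; apply: l2_ext => l /=.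
have -> : (l - 0 = l)%Z by lia.
ring.
Qed.

Lemma Some_inj (J : Type) : partial_injective (fun j : J => Some j).
Proof. by move=> j j' i [->] [->]. Qed.

Section MultiplicationOperators.
Variables (S : supernatural) (f : CZS S).

Lemma mulZ_bounded : exists M, forall l : Z, Cmod (f (Zmod_sn_of_Z S l)) <= M.
Proof. by case: (CZS_bounded f) => M HM; exists M => l. Qed.

Lemma mulN_bounded :
  exists M, forall k : nat, Cmod (f (Zmod_sn_of_Z S (Z.of_nat k))) <= M.
Proof. by case: (CZS_bounded f) => M HM; exists M => l. Qed.

(* The operators [m_f] on [l2 Z] and [M_f] on [l2 nat]. *)
Definition mulZ : BL HZ HZ := weighted_op (@Some_inj Z) mulZ_bounded.
Definition mulN : BL HN HN := weighted_op (@Some_inj nat) mulN_bounded.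

Lemma mulZ_basis (l : Z) :
  mulZ (l2_basis l) = scal (f (Zmod_sn_of_Z S l)) (l2_basis l).
Proof. exact: weighted_basis. Qed.

Lemma mulN_basis (k : nat) :
  mulN (l2_basis k) = scal (f (Zmod_sn_of_Z S (Z.of_nat k))) (l2_basis k).
Proof. exact: weighted_basis. Qed.

End MultiplicationOperators.

Lemma unilateral_shift_inj : partial_injective
  (fun k : nat => match k with 0%N => None | k'.+1 => Some k' end).
Proof. by move=> [|k] [|k'] i //= [->] [->]. Qed.

Definition unilateral_shift : BL HN HN :=
  weighted_op unilateral_shift_inj (const_bounded nat 1%C).

Lemma unilateral_shift_basis (k : nat) :
  unilateral_shift (l2_basis k) = l2_basis k.+1.
Proof.
rewrite /unilateral_shift (@weighted_basis _ _ _ _ _ _ k k.+1) //.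
by apply: l2_ext => j /=; ring.
Qed.

Lemma embed_inj : partial_injective
  (fun l : Z => if (0 <=? l)%Z then Some (Z.to_nat l) else None).
Proof.
move=> l l' i; case: Z.leb_spec => // H [<-]; case: Z.leb_spec => // H' [E].
by lia.
Qed.

(* The isometry [s : l2 nat -> l2 Z]. *)
Definition embed : BL HN HZ :=
  weighted_op embed_inj (const_bounded Z 1%C).

Lemma embed_basis (k : nat) : embed (l2_basis k) = l2_basis (Z.of_nat k).
Proof.
rewrite /embed (@weighted_basis _ _ _ _ _ _ k (Z.of_nat k)).
  by apply: l2_ext => j /=; ring.
by case: Z.leb_spec => H; [congr Some; lia|lia].
Qed.

Lemma compress_inj : partial_injective (fun k : nat => Some (Z.of_nat k)).
Proof. by move=> k k' l [<-] [H]; lia. Qed.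

(* The coisometry [P_{>=0} : l2 Z -> l2 nat]. *)
Definition compress : BL HZ HN :=
  weighted_op compress_inj (const_bounded nat 1%C).

Lemma compress_basis (k : nat) : compress (l2_basis (Z.of_nat k)) = l2_basis k.
Proof.
rewrite /compress (@weighted_basis _ _ _ _ _ _ (Z.of_nat k) k) //.
by apply: l2_ext => j /=; ring.
Qed.

Lemma compress_basis_neg (l : Z) : (l < 0)%Z -> compress (l2_basis l) = zero.
Proof. by move=> H; apply: weighted_basis0 => k [E]; lia. Qed.

Lemma matrix_unit_inj (k s : nat) :
  partial_injective (fun j : nat => if j == k then Some s else None).
Proof. by move=> j j' i; case: eqP => // -> _; case: eqP => // ->. Qed.

Definition matrix_unit (k s : nat) : BL HN HN :=
  weighted_op (@matrix_unit_inj k s) (const_bounded nat 1%C).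

Lemma matrix_unit_basis (k s r : nat) :
  matrix_unit k s (l2_basis r) = if s == r then l2_basis k else zero.
Proof.
case: eqP => [<-|H].
  rewrite /matrix_unit (@weighted_basis _ _ _ _ _ _ s k) ?eqxx //.
  by apply: l2_ext => j /=; ring.
by apply: weighted_basis0 => j; case: eqP => // _ [].
Qed.

Definition toeplitz (b : BL HZ HZ) : BL HN HN :=
  BL_comp compress (BL_comp b embed).

Section CstarAlgebras.
Variable I : Type.
Notation H := (l2_NormedModule I).

Definition is_adjoint (T T' : BL H H) : Prop :=
  forall x y : H, inner (T x) y = inner x (T' y).

Definition Cstar_subalgebra (A : BL H H -> Prop) : Prop :=
  A zero /\
  (forall S T, A S -> A T -> A (plus S T)) /\
  (forall (c : C) T, A T -> A (scal c T)) /\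
  (forall S T, A S -> A T -> A (BL_comp S T)) /\
  (forall T T', A T -> is_adjoint T T' -> A T') /\
  closed A.

Definition Cstar_generated (G : BL H H -> Prop) (T : BL H H) : Prop :=
  forall A : BL H H -> Prop,
    Cstar_subalgebra A -> (forall g, G g -> A g) -> A T.

End CstarAlgebras.

(* The Bunce-Deddens-Toeplitz algebra [A_S]. *)
Definition BDT (S : supernatural) : BL HN HN -> Prop :=
  Cstar_generated (fun T =>
    T = unilateral_shift \/ exists f : CZS S, T = mulN f).

Definition rapidly_decaying (u : Z -> R) : Prop :=
  forall N : nat, exists M : R,
    forall n : Z, (1 + IZR (Z.abs n)) ^ N * Rabs (u n) <= M.

(* The smooth Bunce-Deddens algebra [B_S^oo]. *)
Definition BD_smooth (S : supernatural) (b : BL HZ HZ) : Prop :=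
  exists f : Z -> CZS S,
    rapidly_decaying (fun n => sup_norm (f n)) /\
    is_usum (fun n => BL_comp (shift n) (mulZ (f n))) b /\
    exists l : nat, sn_divides l S /\
      BL_comp (BL_comp (shift (Z.of_nat l)) b) (shift (- Z.of_nat l)) = b.

(* The smooth compact operators [K^oo]. *)
Definition compact_smooth (c : BL HN HN) : Prop :=
  exists u : nat -> nat -> C,
    (forall M N : nat, exists B : R, forall k s : nat,
       (1 + INR k) ^ M * (1 + INR s) ^ N * Cmod (u k s) <= B) /\
    is_usum (fun ks : nat * nat =>
      scal (u ks.1 ks.2) (matrix_unit ks.1 ks.2)) c.

(* The smooth Bunce-Deddens-Toeplitz algebra [A_S^oo]. *)
Definition BDT_smooth (S : supernatural) (a : BL HN HN) : Prop :=
  exists (b : BL HZ HZ) (c : BL HN HN),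
    BD_smooth S b /\ compact_smooth c /\ a = plus (toeplitz b) c.

(* Coquelicot integrates functions into real normed modules only. *)
Section RestrictScalars.
Variable V : NormedModule C_AbsRing.

Let rscal (r : R) (v : V) : V := scal (RtoC r) v.

Lemma rscal_assoc (r s : R) (v : V) : rscal r (rscal s v) = rscal (r * s) v.
Proof. by rewrite /rscal scal_assoc RtoC_mult. Qed.
Lemma rscal_one (v : V) : rscal 1 v = v.
Proof. exact: scal_one. Qed.
Lemma rscal_distr_l (r : R) (u v : V) :
  rscal r (plus u v) = plus (rscal r u) (rscal r v).
Proof. exact: scal_distr_l. Qed.
Lemma rscal_distr_r (r s : R) (v : V) :
  rscal (r + s) v = plus (rscal r v) (rscal s v).
Proof. by rewrite /rscal RtoC_plus; exact: (scal_distr_r (V := V)). Qed.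

Definition real_ModuleSpace : ModuleSpace R_Ring :=
  ModuleSpace.Pack R_Ring V
    (ModuleSpace.Class R_Ring V (AbelianGroup.class V)
      (ModuleSpace.Mixin R_Ring V rscal
         rscal_assoc rscal_one rscal_distr_l rscal_distr_r)) V.

Definition real_NormedModuleAux : NormedModuleAux R_AbsRing :=
  NormedModuleAux.Pack R_AbsRing V
    (NormedModuleAux.Class R_AbsRing V
       (ModuleSpace.class R_Ring real_ModuleSpace) (UniformSpace.class V)) V.

Lemma rscal_norm (r : R) (v : V) : norm (rscal r v) <= Rabs r * norm v.
Proof. rewrite -(Cmod_R r); exact: (norm_scal (V := V)). Qed.

Definition real_NormedModule : NormedModule R_AbsRing :=
  NormedModule.Pack R_AbsRing V
    (NormedModule.Class R_AbsRing V
       (NormedModuleAux.class R_AbsRing real_NormedModuleAux)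
       (NormedModule.Mixin R_AbsRing real_NormedModuleAux
          (norm (V := V)) (norm_factor (V := V))
          norm_triangle rscal_norm
          (norm_compat1 (V := V)) (norm_compat2 (V := V))
          norm_eq_zero)) V.

End RestrictScalars.

(* A C^1 arc on [0,1]; since a C^1 map on [0,1] with one-sided derivatives at
   the ends extends to a C^1 map on a neighbourhood, asking for two-sided
   derivatives there is no restriction. *)
Record arc := mkArc {
  arc_point :> R -> C;
  arc_speed : R -> C;
  arc_derive : forall t, 0 <= t <= 1 ->
    is_derive (K := R_AbsRing) (V := C_R_NormedModule)
      arc_point t (arc_speed t);
  arc_speed_continuous : forall t, 0 <= t <= 1 -> continuous arc_speed t
}.

(* A chain of arcs is a cycle, i.e. a formal sum of closed piecewise C^1
   paths, when each point begins as many arcs as it ends. *)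
Definition is_cycle (Gamma : list arc) : Prop :=
  Permutation (map (fun g : arc => g 0) Gamma) (map (fun g : arc => g 1) Gamma).

Definition on_chain (Gamma : list arc) (z : C) : Prop :=
  exists (g : arc) (t : R), In g Gamma /\ 0 <= t <= 1 /\ z = g t.

Definition is_contour_integral {V : NormedModule C_AbsRing}
    (Gamma : list arc) (F : C -> V) (J : V) : Prop :=
  exists Jg : arc -> V,
    (forall g, In g Gamma ->
       is_RInt (V := real_NormedModule V)
         (fun t => scal (arc_speed g t) (F (g t))) 0 1 (Jg g)) /\
    J = lsum Jg Gamma.

Definition is_winding_number (Gamma : list arc) (z w : C) : Prop :=
  is_contour_integral (V := C_NormedModule) Gamma
    (fun zeta => / (zeta - z))%C (2 * PI * Ci * w)%C.

(* [Gamma] is a contour that surrounds [K] in [Omega]. *)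
Definition surrounds (Gamma : list arc) (K Omega : C -> Prop) : Prop :=
  is_cycle Gamma /\
  (forall z, on_chain Gamma z -> Omega z /\ ~ K z) /\
  (forall z, K z -> is_winding_number Gamma z 1%C) /\
  (forall z, ~ Omega z -> is_winding_number Gamma z 0%C).

Section FunctionalCalculus.
Variable E : NormedModule C_AbsRing.
Variable A : BL E E -> Prop.

Definition is_resolvent (a : BL E E) (z : C) (r : BL E E) : Prop :=
  A r /\
  BL_comp r (minus (scal z BL_id) a) = BL_id /\
  BL_comp (minus (scal z BL_id) a) r = BL_id.

Definition spectrum (a : BL E E) (z : C) : Prop :=
  ~ exists r, is_resolvent a z r.

(* [fa] is the norm convergent integral
   [1/(2 pi i) \int_Gamma f(zeta) (zeta - a)^-1 dzeta]. *)
Definition is_functional_calculus (a : BL E E) (f : C -> C)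
    (Gamma : list arc) (fa : BL E E) : Prop :=
  exists (res : C -> BL E E) (J : BL E E),
    (forall z, on_chain Gamma z -> is_resolvent a z (res z)) /\
    is_contour_integral Gamma (fun zeta => scal (f zeta) (res zeta)) J /\
    fa = scal (/ (2 * PI * Ci))%C J.

End FunctionalCalculus.

(* Main.v *)
From Stdlib Require Import Reals Lra Lia ZArith List Permutation.
From Stdlib Require Import Classical ClassicalEpsilon FunctionalExtensionality
  PropExtensionality ProofIrrelevance.
From mathcomp Require Import all_boot zify.
From Coquelicot Require Import Coquelicot.
Require Import Defs.

Set Implicit Arguments.
Unset Strict Implicit.
Unset Printing Implicit Defensive.

Open Scope R_scope.

(** The integral [1/(2 pi i) \int f(z) (z - a)^-1 dz] only involves resolvents
    of [a] at points of a compact curve, so it suffices that [A_S^oo] contains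
    these resolvents with estimates that are uniform along the curve, and that
    it is described by estimates which survive integration.

    The description is in terms of matrix entries.  An operator [a] belongs to
    [A_S^oo] if and only if, for some [l] dividing [S], its entries decay
    rapidly away from the diagonal and the differences
    [a_(j+l,k+l) - a_(j,k)] decay rapidly in [j] and [k] jointly
    ([BDT_smooth_decay] and [decay_BDT_smooth]).  For the converse, the
    differences are summable along each diagonal, so that
    [beta_(j,k) = lim_n a_(j+nl,k+nl)] exists; it is [l]-periodic along the
    diagonals, hence the matrix of an element [b] of [B_S^oo], and the tail
    [a - T(b)] of the telescoping sum decays jointly.

    Both conditions pass to inverses.  With [L] the weight [1 + j] cut off at
    [m], decay away from the diagonal says that all iterated commutators with
    [L] are bounded uniformly in [m], by Schur's bound [BL_norm_le_offdiag].
    Since [[L, R] = - R [L, A] R] when [R] inverts [A], a bounded inverse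
    satisfies the same estimates ([smooth_inverse]).  Joint decay says that all
    [L^M X L^N] are bounded uniformly in [m]; such operators form an ideal
    ([smoothing_comp_smooth], [smooth_comp_smoothing]), and compressing
    [R A = 1] by the shift [U^l] shows that the shift difference of [R] lies in
    this ideal when that of [A] does ([smoothing_inverse_shift]).  Every bound
    depends on [z] only through bounds on [|z|] and on the norm of the
    resolvent, which are continuous, hence bounded, along the curve.

    Finally each estimate bounds a set of continuous linear functionals, and
    such bounds are preserved by integrals
    ([functionals_bounded_integral]). *)

(** * Unordered sums *)

Section UnorderedSums.
Variables (I : Type) (K : AbsRing).

Lemma lsum_norm_le (V : NormedModule K) (f : I -> V) (a : I -> R) (s : list I) :
  (forall i, norm (f i) <= a i) -> norm (lsum f s) <= lsum a s.
Proof.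
move=> H; elim: s => [|i s IH] /=; first by rewrite norm_zero; exact: Rle_refl.
by apply: Rle_trans (norm_triangle _ _) _; apply: Rplus_le_compat.
Qed.

Lemma lsum_cat (G : AbelianMonoid) (f : I -> G) (s t : list I) :
  lsum f (s ++ t)%list = plus (lsum f s) (lsum f t).
Proof.
elim: s => [|i s IH] /=; first by rewrite plus_zero_l.
by rewrite IH plus_assoc.
Qed.

Lemma lsum_Permutation (G : AbelianMonoid) (f : I -> G) (s t : list I) :
  Permutation s t -> lsum f s = lsum f t.
Proof.
elim=> //=.
- by move=> x l l' _ ->.
- by move=> x y l; rewrite !plus_assoc (plus_comm (f y)).
- by move=> l l' l'' _ -> _ ->.
Qed.

Lemma NoDup_incl_Permutation (s s0 : list I) :
  NoDup s -> NoDup s0 -> incl s0 s -> exists t, Permutation s (s0 ++ t)%list.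
Proof.
elim: s0 s => [|i s0 IH] s Hs Hs0 Hi; first by exists s.
have [s1 [s2 Es]] := in_split _ _ (Hi i (or_introl erefl)); subst.
inversion Hs0; subst.
case: (IH (s1 ++ s2)%list) => //.
- exact: NoDup_remove_1 Hs.
- move=> j Hj; have Hj' := Hi j (or_intror Hj).
  apply: in_or_app; case: (in_app_or _ _ _ Hj') => [|[E|]]; auto.
  by subst.
- move=> t Ht; exists t; apply: Permutation_trans (Permutation_cons _ Ht) => //.
  by apply: Permutation_sym; apply: Permutation_middle.
Qed.

Lemma lsum_eq (G : AbelianMonoid) (f g : I -> G) (s : list I) :
  (forall i, f i = g i) -> lsum f s = lsum g s.
Proof. by move=> H; elim: s => [//|i s IH] /=; rewrite IH H. Qed.

Lemma lsum_zero (G : AbelianMonoid) (f : I -> G) (s : list I) :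
  (forall i, In i s -> f i = zero) -> lsum f s = zero.
Proof.
elim: s => [//|i s IH] H /=; rewrite H ?plus_zero_l; last by left.
by apply: IH => j Hj; apply: H; right.
Qed.

Lemma lsum_additive (G G' : AbelianMonoid) (phi : G -> G') (f : I -> G) s :
  phi zero = zero -> (forall x y, phi (plus x y) = plus (phi x) (phi y)) ->
  phi (lsum f s) = lsum (fun i => phi (f i)) s.
Proof. by move=> H0 H; elim: s => [//|i s IH] /=; rewrite H IH. Qed.

Lemma is_usum_single (V : NormedModule K) (f : I -> V) (i : I) :
  (forall j, j <> i -> f j = zero) -> is_usum f (f i).
Proof.
move=> H; apply: (filterlim_ext_loc (fun _ => f i)); last exact: filterlim_const.
exists (i :: nil) => s Hs Hi.
have [s1 [s2 Es]] := in_split _ _ (Hi i (or_introl erefl)).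
rewrite Es in Hs *; have Hn := NoDup_remove_2 _ _ _ Hs.
rewrite lsum_cat /= lsum_zero ?plus_zero_l ?lsum_zero ?plus_zero_r // => j Hj;
  apply: H => E; subst; apply: Hn; apply: in_or_app; [by right|by left].
Qed.

Lemma is_usum_linear (V W : NormedModule K) (phi : V -> W) (f : I -> V) (l : V) :
  is_linear phi -> is_usum f l -> is_usum (fun i => phi (f i)) (phi l).
Proof.
move=> Hphi Hl.
have Hc := linear_cont phi l Hphi.
apply: (filterlim_ext (fun s => phi (lsum f s))).
  move=> s; apply: lsum_additive; last exact: linear_plus.
  have E : forall x, scal zero x = zero :> V by move=> x; exact: scal_zero_l.
  by rewrite -(E zero) (linear_scal _ Hphi) scal_zero_l.
exact: filterlim_comp Hl Hc.
Qed.

Lemma is_usum_norm_le (V : NormedModule K) (f : I -> V) (a : I -> R) (l : V) M :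
  (forall i, norm (f i) <= a i) -> (forall s, NoDup s -> lsum a s <= M) ->
  is_usum f l -> norm l <= M.
Proof.
move=> Ha HM Hl.
apply: (@filterlim_le (list I) (@finite_subsets I) _ (fun s => norm (lsum f s))
  (fun _ => M) (Finite (norm l)) (Finite M)).
- exists nil => s Hs _; apply: Rle_trans (HM _ Hs); exact: lsum_norm_le.
- exact: filterlim_comp Hl (filterlim_norm _).
- exact: filterlim_const.
Qed.

(** The family dominated by a summable [a] satisfies the Cauchy criterion:
    beyond a finite set where the sum of [a] is within [eps] of its supremum,
    any further finite set of indices contributes less than [eps]. *)
Lemma is_usum_dominated (V : CompleteNormedModule K) (f : I -> V)
    (a : I -> R) (M : R) :
  (forall i, norm (f i) <= a i) -> (forall s, NoDup s -> lsum a s <= M) ->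
  exists l : V, is_usum f l /\ norm l <= M.
Proof.
move=> Ha HM.
have a_ge0 i : 0 <= a i by apply: Rle_trans (norm_ge_0 (f i)) (Ha i).
have [A [HA _]] := is_usum_bounded a_ge0 HM.
suff [l Hl] : exists l : V, is_usum f l.
  by exists l; split=> //; apply: is_usum_norm_le Ha HM Hl.
apply/(filterlim_locally_cauchy (U := V)) => eps.
have He : 0 < eps / 2 by have := cond_pos eps; lra.
have [s0 [Hs0 HA0]] : exists s0, NoDup s0 /\ A - eps / 2 < lsum a s0.
  have H0 := proj1 (filterlim_locally _ _) HA (mkposreal _ He).
  case: H0 => s1 H1; case: (NoDup_extend s1) => s0 [Hs [Hi _]].
  exists s0; split=> //.
  have H2 : Rabs (lsum a s0 - A) < eps / 2 := H1 s0 Hs Hi.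
  by have := Rabs_def2 _ _ H2; lra.
have key s : NoDup s -> incl s0 s -> norm (minus (lsum f s) (lsum f s0)) < eps / 2.
  move=> Hs Hi.
  have [t Ht] := NoDup_incl_Permutation Hs Hs0 Hi.
  have perm (G : AbelianMonoid) (g : I -> G) : lsum g s = lsum g (s0 ++ t)%list.
    exact: lsum_Permutation.
  have -> : minus (lsum f s) (lsum f s0) = lsum f t.
    by rewrite perm lsum_cat /minus (plus_comm (lsum f s0)) -plus_assoc plus_opp_r
      plus_zero_r.
  apply: Rle_lt_trans (lsum_norm_le t Ha) _.
  have Hp := is_usum_partial a_ge0 HA Hs.
  have Ep : lsum a s = lsum a s0 + lsum a t by rewrite perm lsum_cat.
  have Ht' : lsum a t < eps / 2 by rewrite Ep in Hp; lra.
  exact: Ht'.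
exists (fun s => NoDup s /\ incl s0 s); split; first by exists s0.
move=> u v [Hu Hiu] [Hv Hiv]; apply: (norm_compat1 (V := V)).
rewrite (minus_trans (lsum f s0)).
apply: Rle_lt_trans (norm_triangle _ _) _.
rewrite -(opp_minus (lsum f u)) norm_opp.
have -> : pos eps = eps / 2 + eps / 2 by lra.
exact: Rplus_lt_compat (key v Hv Hiv) (key u Hu Hiu).
Qed.

End UnorderedSums.

Lemma lsum_map (I J : Type) (g : I -> J) (G : AbelianMonoid) (f : J -> G) s :
  lsum (fun i => f (g i)) s = lsum f (map g s).
Proof. by elim: s => [//|i s IH] /=; rewrite IH. Qed.

(** Comparison with the telescoping sum of [2 (1/(n+1) - 1/(n+2))]. *)
Lemma lsum_inv_sqr_nat (s : list nat) : NoDup s ->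
  lsum (fun n => / (1 + INR n) ^ 2) s <= 2.
Proof.
move=> Hs.
have pos n : 0 < 1 + INR n by have := pos_INR n; lra.
have H0 n : 0 <= / (1 + INR n) ^ 2.
  by apply: Rlt_le; apply: Rinv_0_lt_compat; apply: pow_lt.
have key n : lsum (fun n => / (1 + INR n) ^ 2) (List.seq 0 n) <=
    2 - 2 * / (1 + INR n).
  elim: n => [|n IH]; first by rewrite /= /zero /=; lra.
  rewrite seq_S lsum_cat [plus _ _]/= plus_zero_r S_INR.
  move: IH; set A := lsum _ _ => IH.
  suff : / (1 + INR n) ^ 2 <= 2 * / (1 + INR n) - 2 * / (1 + (INR n + 1)).
    rewrite /plus /=; lra.
  have Hn := pos n; apply: (Rmult_le_reg_r ((1 + INR n) ^ 2 * (1 + (INR n + 1)))).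
    by apply: Rmult_lt_0_compat; [exact: pow_lt|lra].
  have -> : / (1 + INR n) ^ 2 * ((1 + INR n) ^ 2 * (1 + (INR n + 1))) =
     1 + (INR n + 1) by field; lra.
  have -> : (2 * / (1 + INR n) - 2 * / (1 + (INR n + 1))) *
     ((1 + INR n) ^ 2 * (1 + (INR n + 1))) = 2 * (1 + INR n) by field; lra.
  by have := pos_INR n; lra.
pose n := (list_max s).+1.
apply: Rle_trans (lsum_incl (t := List.seq 0 n) H0 Hs _) _.
  move=> k Hk; apply/in_seq; split; first by apply: Nat.le_0_l.
  have := proj1 (list_max_le s (list_max s)) (le_n _).
  move/Forall_forall => /(_ k Hk); rewrite /n; lia.
have := key n; have := Rinv_0_lt_compat _ (pos n); lra.
Qed.

(** Index [n >= 0] by [2n] and [n < 0] by [-2n - 1] to reduce to [nat]. *)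
Lemma lsum_inv_sqr_Z (s : list Z) : NoDup s ->
  lsum (fun n => / (1 + IZR (Z.abs n)) ^ 2) s <= 8.
Proof.
move=> Hs.
pose g (n : Z) := Z.to_nat (if (0 <=? n)%Z then 2 * n else - 2 * n - 1)%Z.
have g_inj x y : g x = g y -> x = y.
  rewrite /g; case: Z.leb_spec => Hx; case: Z.leb_spec => Hy; lia.
have Hle n : / (1 + IZR (Z.abs n)) ^ 2 <= 4 * / (1 + INR (g n)) ^ 2.
  have Hg : 1 + INR (g n) <= 2 * (1 + IZR (Z.abs n)).
    rewrite INR_IZR_INZ -!plus_IZR -mult_IZR; apply: IZR_le.
    rewrite /g; case: Z.leb_spec => Hx; lia.
  have H1 : 0 < 1 + INR (g n) by have := pos_INR (g n); lra.
  have H2 := pow_incr _ _ 2 (conj (Rlt_le _ _ H1) Hg).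
  have -> : / (1 + IZR (Z.abs n)) ^ 2 = 4 * / (2 * (1 + IZR (Z.abs n))) ^ 2.
    field; lra.
  by apply: Rmult_le_compat_l; [lra|apply: Rinv_le_contravar => //; apply: pow_lt].
have H8 : lsum (fun n => / (1 + IZR (Z.abs n)) ^ 2) s <=
    4 * lsum (fun n => / (1 + INR (g n)) ^ 2) s.
  elim: s {Hs} => [|n s IH] /=; first by rewrite /zero /=; lra.
  by have := Hle n; move: IH; rewrite /plus /=; lra.
apply: Rle_trans H8 _.
rewrite (lsum_map g (fun n => / (1 + INR n) ^ 2)).
have : NoDup (map g s) by apply: FinFun.Injective_map_NoDup.
move/lsum_inv_sqr_nat; lra.
Qed.

Lemma lsum_inv_sqr_nat2 (s : list (nat * nat)) : NoDup s ->
  lsum (fun ks => / (1 + INR ks.1) ^ 2 * / (1 + INR ks.2) ^ 2) s <= 4.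
Proof.
move=> Hs; set w := fun n : nat => / (1 + INR n) ^ 2.
have w0 n : 0 <= w n.
  apply: Rlt_le; apply: Rinv_0_lt_compat; apply: pow_lt.
  by have := pos_INR n; lra.
pose n := (list_max (map fst s ++ map snd s)%list).+1.
have Hn k : In k (map fst s ++ map snd s)%list -> In k (List.seq 0 n).
  move=> Hk; apply/in_seq; split; first by apply: Nat.le_0_l.
  have := proj1 (list_max_le _ _) (le_n (list_max (map fst s ++ map snd s)%list)).
  move/Forall_forall => /(_ k Hk); rewrite /n; lia.
have Hp t u : lsum (fun ks => w ks.1 * w ks.2) (list_prod t u) =
    lsum w t * lsum w u.
  elim: t => [|k t IH] /=; first by rewrite /zero /=; ring.
  rewrite lsum_cat IH -lsum_map /=.
  have -> : lsum (fun i => w k * w i) u = w k * lsum w u.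
    elim: u {IH} => [|j u IH] /=; first by rewrite /zero /=; ring.
    by rewrite IH /plus /=; ring.
  by rewrite /plus /=; ring.
apply: Rle_trans (lsum_incl (t := list_prod (List.seq 0 n) (List.seq 0 n)) _ Hs _) _.
- by move=> ks; apply: Rmult_le_pos; apply: w0.
- move=> [k j] Hk; apply/in_prod_iff; split; apply: Hn; apply: in_or_app.
    by left; apply: (in_map fst _ _ Hk).
  by right; apply: (in_map snd _ _ Hk).
rewrite (Hp (List.seq 0 n) (List.seq 0 n)).
have H2 := lsum_inv_sqr_nat (seq_NoDup n 0).
have H0 := lsum_ge0 w0 (List.seq 0 n).
by have := Rmult_le_compat _ _ _ _ H0 H0 H2 H2; lra.
Qed.

(** * Completeness of the spaces of operators *)

Lemma filter_le_antisym (T : Type) (F G : (T -> Prop) -> Prop) :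
  filter_le F G -> filter_le G F -> F = G.
Proof.
move=> H1 H2; apply: functional_extensionality => P.
by apply: propositional_extensionality; split; [exact: H2|exact: H1].
Qed.

(** The limit of a filter is chosen by [epsilon]; on filters that are not Cauchy
    its value is arbitrary, and equivalent filters have the same limit because
    they are equal. *)
Section CompleteSpaceOfLimits.
Variables (T : UniformSpace) (t0 : T).
Hypothesis cauchy_converges : forall F : (T -> Prop) -> Prop,
  ProperFilter F -> cauchy F -> exists x, forall eps : posreal, F (ball x eps).

Let limit (F : (T -> Prop) -> Prop) : T :=
  epsilon (inhabits t0) (fun x => forall eps : posreal, F (ball x eps)).

Lemma limit_ball (F : (T -> Prop) -> Prop) : ProperFilter F -> cauchy F ->
  forall eps : posreal, F (ball (limit F) eps).
Proof.
by move=> HF HC; exact: (epsilon_spec (inhabits t0) _ (cauchy_converges HF HC)).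
Qed.

Lemma limit_close (F G : (T -> Prop) -> Prop) :
  filter_le F G -> filter_le G F -> close (limit F) (limit G).
Proof.
move=> H1 H2; rewrite (filter_le_antisym H1 H2) => eps; exact: ball_center.
Qed.

Definition CompleteSpace_mixin_of_limits :=
  CompleteSpace.Mixin T limit limit_ball limit_close.

End CompleteSpaceOfLimits.

Lemma continuous_norm_minus (K : AbsRing) (V : NormedModule K) (a x : V) :
  filterlim (fun y : V => norm (minus y a)) (locally x)
    (locally (norm (minus x a))).
Proof.
apply: (filterlim_comp _ _ _ (fun y : V => minus y a) norm _ (locally (minus x a))).
  apply: (continuous_minus (fun y : V => y) (fun _ => a)).
    exact: continuous_id.
  exact: continuous_const.
exact: filterlim_norm.
Qed.

Lemma ball_cauchy_filterlim (T : UniformSpace) (K : AbsRing)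
    (V : CompleteNormedModule K) (F : (T -> Prop) -> Prop) (phi : T -> V) (M : R) :
  ProperFilter F -> cauchy F ->
  (forall x y (eps : posreal), ball x eps y ->
     norm (minus (phi y) (phi x)) <= M * eps) ->
  exists l, filterlim phi F (locally l).
Proof.
move=> HF HC Hphi; apply/(filterlim_locally_cauchy (U := V)) => eps.
have HM : 0 < eps / (2 * (Rabs M + 1)).
  by apply: Rdiv_lt_0_compat; [exact: cond_pos|have := Rabs_pos M; lra].
have [x Hx] := HC (mkposreal _ HM).
exists (ball x (mkposreal _ HM)); split=> // u v Hu Hv.
apply: (norm_compat1 (V := V)); rewrite (minus_trans (phi x)).
apply: Rle_lt_trans (norm_triangle _ _) _.
rewrite -(opp_minus (phi u)) norm_opp.
have H1 : M * (eps / (2 * (Rabs M + 1))) < eps / 2.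
  have He := cond_pos eps; have HR := Rle_abs M; have HP := Rabs_pos M.
  have -> : M * (eps / (2 * (Rabs M + 1))) = (M / (Rabs M + 1)) * (eps / 2).
    by field; lra.
  have : M / (Rabs M + 1) < 1 by apply/Rlt_div_l; lra.
  nra.
have -> : pos eps = eps / 2 + eps / 2 by lra.
by apply: Rplus_lt_compat; apply: Rle_lt_trans H1; apply: (Hphi _ _ (mkposreal _ HM)).
Qed.

Lemma l2_norm_opp (I : Type) (x : l2 I) : l2_norm (opp x) = l2_norm x.
Proof. exact: (norm_opp (V := l2_NormedModule I)). Qed.

Lemma BL_norm_opp (E G : NormedModule C_AbsRing) (X : BL E G) :
  BL_norm (opp X) = BL_norm X.
Proof. exact: (norm_opp (V := BL_NormedModule E G)). Qed.

Section L2Complete.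
Variable I : Type.

(** The limit [y] is taken coordinatewise.  A bound on the finite square sums of
    [z - x] for [z] along the filter passes to [y - x]; this shows both that
    [y] is square summable and that the filter converges to it in norm. *)
Lemma l2_cauchy_converges (F : (l2 I -> Prop) -> Prop) :
  ProperFilter F -> cauchy (T := l2_UniformSpace I) F ->
  exists x : l2 I, forall eps : posreal,
    F (ball (M := l2_UniformSpace I) x eps).
Proof.
move=> HF HC.
have Hy i : exists c : C, filterlim (fun x : l2 I => x i) F
    (locally (T := C_NormedModule) c).
  apply: (@ball_cauchy_filterlim (l2_UniformSpace I) C_AbsRing
    C_CompleteNormedModule F (fun x => x i) 1 HF HC) => x z eps Hz.
  rewrite Rmult_1_l; apply: Rle_trans (Rlt_le _ _ Hz).
  have := l2_coord_le (minus z x) i.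
  rewrite /minus /plus /opp /= /norm /=.
  by have -> : (z i + - (1) * x i = z i + - x i)%C by ring.
have [y Hy'] := choice _ Hy.
have key (x : l2 I) (eps : posreal) : F (ball (M := l2_UniformSpace I) x eps) ->
    forall s, NoDup s -> lsum (fun i => Cmod (y i - x i) ^ 2) s <= eps ^ 2.
  move=> Hx s Hs.
  have Hlim : filterlim (fun z : l2 I => lsum (fun i => Cmod (z i - x i) ^ 2) s) F
      (locally (lsum (fun i => Cmod (y i - x i) ^ 2) s)).
    elim: s {Hs} => [|i s IH] /=; first exact: filterlim_const.
    apply: (filterlim_comp_2 (G := locally (Cmod (y i - x i) ^ 2))
      (H := locally (lsum (fun i => Cmod (y i - x i) ^ 2) s))) IH _; last first.
      exact: (filterlim_plus (V := R_NormedModule)).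
    have H1 : filterlim (fun z : l2 I => Cmod (z i - x i)) F
        (locally (Cmod (y i - x i))).
      apply: (filterlim_comp _ _ _ (fun z : l2 I => z i)
        (fun c : C => Cmod (c - x i)) F _ _ (Hy' i)).
      exact: (@continuous_norm_minus C_AbsRing C_NormedModule (x i) (y i)).
    apply: (filterlim_comp _ _ _ _ (fun r : R => r ^ 2) F _ _ H1).
    have Hd : ex_derive (fun r : R => r ^ 2) (Cmod (y i - x i)) by auto_derive.
    exact: (ex_derive_continuous (fun r : R => r ^ 2) _ Hd).
  apply: (@filterlim_le _ F _ _ (fun _ => eps ^ 2) (Finite _) (Finite (eps ^ 2))
    _ Hlim (filterlim_const _)).
  apply: filter_imp Hx => z Hz.
  have Hz' : l2_norm (minus z x) < eps by exact: Hz.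
  have Hp : lsum (fun i => Cmod (z i - x i) ^ 2) s <= l2_norm (minus z x) ^ 2.
    have := l2_partial (minus z x) Hs.
    rewrite (@lsum_eq I _ _ (fun i => Cmod (z i - x i) ^ 2) s) // => i.
    congr (Cmod _ ^ 2); rewrite /minus /plus /opp /=; ring.
  apply: Rle_trans Hp _; apply: pow_incr.
  by split; [exact: l2_norm_ge0|exact: Rlt_le].
have [x0 Hx0] := HC (mkposreal _ Rlt_0_1).
pose z0 : l2 I := L2 (l2_summable_bounded (key x0 _ Hx0)).
have Ey (i : I) : (plus x0 z0 : l2 I) i = y i by rewrite /plus /=; ring.
exists (plus x0 z0) => eps.
have He : 0 < eps / 3 by have := cond_pos eps; lra.
have [x Hx] := HC (mkposreal _ He).
apply: filter_imp (Hx) => z Hz.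
have Hz' : l2_norm (minus z x) < eps / 3 by exact: Hz.
have Hx' : l2_norm (minus (plus x0 z0) x : l2 I) <= eps / 3.
  apply: l2_norm_le => [|s Hs]; first exact: Rlt_le.
  apply: Rle_trans (key x _ Hx s Hs).
  rewrite (@lsum_eq I _ _ (fun i => Cmod (y i - x i) ^ 2) s); first exact: Rle_refl.
  move=> i; congr (Cmod _ ^ 2).
  have -> : (minus (plus x0 z0) x : l2 I) i = ((plus x0 z0 : l2 I) i - x i)%C.
    rewrite /minus /plus /opp /=; ring.
  by rewrite Ey.
suff H : l2_norm (minus z (plus x0 z0)) < eps by exact: H.
rewrite (minus_trans x); apply: Rle_lt_trans (l2_norm_triangle _ _) _.
have H2 : l2_norm (minus x (plus x0 z0)) <= eps / 3.
  by rewrite -(opp_minus (plus x0 z0)) l2_norm_opp.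
have := cond_pos eps; lra.
Qed.

Definition l2_CompleteNormedModule : CompleteNormedModule C_AbsRing :=
  CompleteNormedModule.Pack C_AbsRing (l2 I)
    (CompleteNormedModule.Class C_AbsRing (l2 I)
       (NormedModule.class C_AbsRing (l2_NormedModule I))
       (CompleteSpace_mixin_of_limits (T := l2_UniformSpace I) zero
          l2_cauchy_converges)) (l2 I).

End L2Complete.

Section BLComplete.
Variables (E : NormedModule C_AbsRing) (G : CompleteNormedModule C_AbsRing).
Notation BLEG := (BL_NormedModule E G).

(** The limit is taken pointwise, and the estimate
    [|X x - Y x| <= eps |x|] passes to the limit in [Y]. *)
Lemma BL_cauchy_converges (F : (BL E G -> Prop) -> Prop) :
  ProperFilter F -> cauchy (T := BLEG) F ->
  exists X : BL E G, forall eps : posreal, F (ball (M := BLEG) X eps).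
Proof.
move=> HF HC.
have ball_norm (X Y : BL E G) (eps : posreal) x : ball (M := BLEG) X eps Y ->
    norm (minus (Y x) (X x)) <= eps * norm x.
  move=> HY; have HY' : BL_norm (minus Y X) < eps by exact: HY.
  apply: Rle_trans (BL_norm_apply (minus Y X) x) _.
  by apply: Rmult_le_compat_r; [exact: norm_ge_0|exact: Rlt_le].
have Hy x : exists c : G, filterlim (fun X : BL E G => X x) F (locally c).
  apply: (@ball_cauchy_filterlim BLEG C_AbsRing G F (fun X : BL E G => X x)
    (norm x) HF HC) => X Y eps /(ball_norm X Y eps x).
  by rewrite (Rmult_comm eps).
have [y Hy'] := choice _ Hy.
have uniq (phi : BL E G -> G) (l l' : G) :
    filterlim phi F (locally l) -> filterlim phi F (locally l') -> l = l'.
  exact: (@filterlim_locally_unique _ C_AbsRing G F _ phi l l').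
have y_plus x1 x2 : y (plus x1 x2) = plus (y x1) (y x2).
  apply: uniq (Hy' _) _.
  apply: (filterlim_ext (fun X : BL E G => plus (X x1) (X x2))).
    by move=> X; rewrite (linear_plus _ (BL_linear X)).
  exact: (filterlim_comp_2 _ _ plus (Hy' x1) (Hy' x2) (filterlim_plus _ _)).
have y_scal k x : y (scal k x) = scal k (y x).
  apply: uniq (Hy' _) _.
  apply: (filterlim_ext (fun X : BL E G => scal k (X x))).
    by move=> X; rewrite (linear_scal _ (BL_linear X)).
  exact: (filterlim_comp _ _ _ _ _ F _ _ (Hy' x) (filterlim_scal_r k (y x))).
have key (X : BL E G) (eps : posreal) : F (ball (M := BLEG) X eps) ->
    forall x, norm (minus (y x) (X x)) <= eps * norm x.
  move=> HX x.
  have Hlim : filterlim (fun Y : BL E G => norm (minus (Y x) (X x))) F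
      (locally (norm (minus (y x) (X x)))).
    apply: (filterlim_comp _ _ _ (fun Y : BL E G => Y x)
      (fun c : G => norm (minus c (X x))) F _ _ (Hy' x)).
    exact: continuous_norm_minus.
  apply: (@filterlim_le _ F _ _ (fun _ => eps * norm x) (Finite _)
    (Finite (eps * norm x)) _ Hlim (filterlim_const _)).
  by apply: filter_imp HX => Y HY; apply: ball_norm.
have [X0 HX0] := HC (mkposreal _ Rlt_0_1).
have y_lin : is_linear (y : E -> G).
  constructor; [exact: y_plus|exact: y_scal|].
  exists (BL_norm X0 + 1); split; first by have := BL_norm_ge0 X0; lra.
  move=> x; have := key _ _ HX0 x; have := BL_norm_apply X0 x => H1 /= H2.
  have -> : y x = plus (minus (y x) (X0 x)) (X0 x).
    by rewrite /minus -plus_assoc plus_opp_l plus_zero_r.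
  apply: Rle_trans (norm_triangle _ _) _; lra.
exists (mkBL y_lin) => eps.
have He : 0 < eps / 3 by have := cond_pos eps; lra.
have [X HX] := HC (mkposreal _ He).
apply: filter_imp (HX) => Y HY.
have HY' : BL_norm (minus Y X) < eps / 3 by exact: HY.
have HX' : BL_norm (minus (mkBL y_lin) X) <= eps / 3.
  apply: BL_norm_le => [|x]; first exact: Rlt_le.
  exact: (key X _ HX x).
suff H : BL_norm (minus Y (mkBL y_lin)) < eps by exact: H.
rewrite (minus_trans X); apply: Rle_lt_trans (BL_norm_triangle _ _) _.
have H2 : BL_norm (minus X (mkBL y_lin)) <= eps / 3.
  by rewrite -(opp_minus (mkBL y_lin)) BL_norm_opp.
have := cond_pos eps; lra.
Qed.

Definition BL_CompleteNormedModule : CompleteNormedModule C_AbsRing :=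
  CompleteNormedModule.Pack C_AbsRing (BL E G)
    (CompleteNormedModule.Class C_AbsRing (BL E G)
       (NormedModule.class C_AbsRing BLEG)
       (CompleteSpace_mixin_of_limits (T := BLEG) zero BL_cauchy_converges))
    (BL E G).

(** The same space over [R], where vector valued Riemann integrals live. *)
Definition real_BL_CompleteNormedModule : CompleteNormedModule R_AbsRing :=
  CompleteNormedModule.Pack R_AbsRing (BL E G)
    (CompleteNormedModule.Class R_AbsRing (BL E G)
       (NormedModule.class R_AbsRing (real_NormedModule BLEG))
       (CompleteSpace_mixin_of_limits (T := BLEG) zero BL_cauchy_converges))
    (BL E G).

End BLComplete.

(** * Matrix entries and Schur's bound *)

Section Entries.
Variables I J : Type.
Notation HI := (l2_NormedModule I).
Notation HJ := (l2_NormedModule J).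

Definition entry (X : BL HI HJ) (j : J) (i : I) : C := X (l2_basis i) j.

Lemma l2_basis_norm_le (i : I) : l2_norm (l2_basis i) <= 1.
Proof.
apply: l2_norm_le => [|s Hs]; first lra.
by rewrite pow1; exact: l2_basis_aux.
Qed.

Lemma entry_le (X : BL HI HJ) (j : J) (i : I) : Cmod (entry X j i) <= BL_norm X.
Proof.
apply: Rle_trans (l2_coord_le _ _) _.
apply: Rle_trans (BL_norm_apply X (l2_basis i)) _.
rewrite -{2}(Rmult_1_r (BL_norm X)); apply: Rmult_le_compat_l.
  exact: BL_norm_ge0.
exact: l2_basis_norm_le.
Qed.

Lemma entry_is_linear (j : J) (i : I) :
  is_linear (K := C_AbsRing) (U := BL_NormedModule HI HJ) (V := C_NormedModule)
    (fun X => entry X j i).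
Proof.
constructor=> //; exists 1; split; first lra.
by move=> X; rewrite Rmult_1_l; exact: entry_le.
Qed.

Lemma entry_minus (X Y : BL HI HJ) (j : J) (i : I) :
  entry (minus X Y) j i = (entry X j i - entry Y j i)%C.
Proof. by rewrite /entry /minus /plus /opp /=; ring. Qed.

Lemma lsum_l2_coord (f : I -> l2 J) (s : list I) (j : J) :
  (lsum f s : l2 J) j = lsum (G := C_AbelianMonoid) (fun i => f i j) s.
Proof. by elim: s => [//|i s IH] /=; rewrite IH. Qed.

Lemma weighted_norm_le (g : J -> option I) (w : J -> C)
    (Hg : partial_injective g) (Hw : exists M, forall j, Cmod (w j) <= M) (M : R) :
  0 <= M -> (forall j, Cmod (w j) <= M) -> BL_norm (weighted_op Hg Hw) <= M.
Proof.
move=> HM H; apply: BL_norm_le => // x; apply: l2_norm_le.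
  by apply: Rmult_le_pos => //; exact: l2_norm_ge0.
by move=> s Hs; exact: weighted_aux.
Qed.

End Entries.

(** Enlarging a finite set [s] of indices beyond one that carries all but
    [(eps/2)^2] of the square sum leaves a remainder of norm at most [eps/2]. *)
Lemma l2_expansion (I : Type) (x : l2 I) :
  is_usum (V := l2_NormedModule I) (fun i => scal (x i) (l2_basis i)) x.
Proof.
apply/filterlim_locally => eps.
have He := cond_pos eps.
have He2 : 0 < (eps / 2) ^ 2 by apply: pow_lt; lra.
have [s0 Hs0] := proj1 (filterlim_locally _ _) (@l2_norm_sqr I x) (mkposreal _ He2).
exists s0 => s Hs Hi.
have Hlow : Rabs (lsum (fun i => Cmod (x i) ^ 2) s - l2_norm x ^ 2) < (eps / 2) ^ 2.
  exact: Hs0 s Hs Hi.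
have {}Hlow := Rabs_def2 _ _ Hlow.
set y := lsum _ s.
have Ey j : y j = if excluded_middle_informative (In j s) then x j else 0%C.
  rewrite /y lsum_l2_coord; case: excluded_middle_informative => Hj /=.
    have [s1 [s2 Es]] := in_split _ _ Hj; rewrite Es in Hs *.
    have Hn := NoDup_remove_2 _ _ _ Hs.
    have Hz i : i <> j -> (scal (x i) (l2_basis i) : l2 I) j = 0%C.
      by move=> Hij; rewrite /scal /=; case: excluded_middle_informative => /= E;
        [subst|ring].
    rewrite lsum_cat [lsum _ (j :: s2)]/= !lsum_zero ?plus_zero_l ?plus_zero_r.
    - by case: excluded_middle_informative => //= _; ring.
    - move=> i Hij; apply: Hz => E; subst.
      by apply: Hn; apply: in_or_app; right.
    - move=> i Hij; apply: Hz => E; subst.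
      by apply: Hn; apply: in_or_app; left.
  apply: lsum_zero => i Hij; rewrite /scal /=.
  by case: excluded_middle_informative => /= E; [subst|exact: Cmult_0_r].
suff H : l2_norm (minus y x) < eps by exact: H.
apply: (Rle_lt_trans _ (eps / 2)); last lra.
apply: l2_norm_le => [|t Ht]; first lra.
have [u [Hu [Hui _]]] := NoDup_extend (t ++ s)%list.
have sq_ge0 (h : I -> C) i : 0 <= Cmod (h i) ^ 2 by exact: pow2_ge_0.
have Htu : incl t u by move=> j Hj; apply: Hui; apply: in_or_app; left.
apply: Rle_trans (lsum_incl (sq_ge0 (minus y x : l2 I)) Ht Htu) _.
have [v Hv] : exists v, Permutation u (s ++ v)%list.
  by apply: NoDup_incl_Permutation => // j Hj; apply: Hui; apply: in_or_app; right.
have Hx := l2_partial x Hu; rewrite (lsum_Permutation _ Hv) lsum_cat in Hx.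
rewrite (lsum_Permutation _ Hv) lsum_cat.
have Em j : (minus y x : l2 I) j = (y j - x j)%C by rewrite /minus /plus /opp /=; ring.
rewrite lsum_zero ?plus_zero_l; last first.
  move=> j Hj; rewrite Em Ey; case: excluded_middle_informative => //= _.
  have -> : (x j - x j)%C = 0%C by ring.
  by rewrite Cmod_0 /zero /=; ring.
apply: (Rle_trans _ (lsum (fun i => Cmod (x i) ^ 2) v)); last first.
  pose A : R := lsum (fun i => Cmod (x i) ^ 2) s.
  pose B : R := lsum (fun i => Cmod (x i) ^ 2) v.
  have HAB : A + B <= l2_norm x ^ 2 by exact: Hx.
  have HA : - (eps / 2) ^ 2 < A - l2_norm x ^ 2 by exact: (proj2 Hlow).
  have HB : B <= (eps / 2) ^ 2 by lra.
  exact: HB.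
elim: v {Hv Hx} => [|j v IH] /=; first exact: Rle_refl.
apply: Rplus_le_compat => //.
rewrite -/((y j + - (1) * x j)%C) Ey; case: excluded_middle_informative => /= _.
  have -> : (x j + - (1) * x j)%C = 0%C by ring.
  by rewrite Cmod_0; have := Cmod_ge_0 (x j); nra.
have -> : (0 + - (1) * x j)%C = (- x j)%C by ring.
by rewrite Cmod_opp; lra.
Qed.

(** Both sides are continuous and agree on the terms of the basis expansion. *)
Lemma BL_entry_ext (I J : Type)
    (X Y : BL (l2_NormedModule I) (l2_NormedModule J)) :
  (forall j i, entry X j i = entry Y j i) -> X = Y.
Proof.
move=> H; apply: BL_ext => x.
apply: (is_usum_unique (is_usum_linear (BL_linear X) (@l2_expansion I x))).
have := is_usum_linear (BL_linear Y) (@l2_expansion I x).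
apply: filterlim_ext => s; apply: lsum_eq => i.
rewrite (linear_scal _ (BL_linear X)) (linear_scal _ (BL_linear Y)).
by congr scal; apply: l2_ext => j; rewrite -!/(entry _ j i) H.
Qed.

Lemma BL_norm_comp (K : AbsRing) (E F G : NormedModule K)
    (X : BL F G) (Y : BL E F) :
  BL_norm (BL_comp X Y) <= BL_norm X * BL_norm Y.
Proof.
apply: BL_norm_le => [|x /=].
  by apply: Rmult_le_pos; exact: BL_norm_ge0.
apply: Rle_trans (BL_norm_apply X (Y x)) _; rewrite Rmult_assoc.
by apply: Rmult_le_compat_l; [exact: BL_norm_ge0|exact: BL_norm_apply].
Qed.

Definition diag (I : Type) (w : I -> C) (Hw : exists M, forall i, Cmod (w i) <= M) :
    BL (l2_NormedModule I) (l2_NormedModule I) :=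
  weighted_op (@Some_inj I) Hw.

Lemma diag_basis (I : Type) (w : I -> C) (Hw : exists M, forall i, Cmod (w i) <= M)
    (i : I) : diag Hw (l2_basis i) = scal (w i) (l2_basis i).
Proof. exact: weighted_basis. Qed.

Lemma entry_comp_diag (I J : Type) (w : I -> C)
    (Hw : exists M, forall i, Cmod (w i) <= M)
    (X : BL (l2_NormedModule I) (l2_NormedModule J)) (j : J) (i : I) :
  entry (BL_comp X (diag Hw)) j i = (entry X j i * w i)%C.
Proof.
rewrite /entry -[BL_comp _ _ _]/(X (diag Hw (l2_basis i))) diag_basis.
by rewrite (linear_scal _ (BL_linear X)) /scal /=; ring.
Qed.

Lemma entry_diag_comp (I J : Type) (w : J -> C)
    (Hw : exists M, forall i, Cmod (w i) <= M)
    (X : BL (l2_NormedModule I) (l2_NormedModule J)) (j : J) (i : I) :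
  entry (BL_comp (diag Hw) X) j i = (w j * entry X j i)%C.
Proof. by []. Qed.

Lemma entry_shift_diag (n : Z) (w : Z -> C)
    (Hw : exists M, forall i, Cmod (w i) <= M) (j l : Z) :
  entry (BL_comp (shift n) (diag Hw)) j l = if (j - l =? n)%Z then w l else 0%C.
Proof.
rewrite entry_comp_diag /entry shift_basis.
case: Z.eqb_spec => H.
  have -> : j = (l + n)%Z by lia.
  by rewrite l2_basis_same; ring.
by rewrite l2_basis_diff; [ring|lia].
Qed.

(** Each diagonal receives a contribution from one term only. *)
Lemma entry_laurent (w : Z -> Z -> C)
    (Hw : forall n, exists M, forall l, Cmod (w n l) <= M) (b : BL HZ HZ) :
  is_usum (fun n => BL_comp (shift n) (diag (Hw n))) b ->
  forall j l, entry b j l = w (j - l)%Z l.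
Proof.
move=> Hb j l; have := is_usum_linear (entry_is_linear j l) Hb => H.
apply: (is_usum_unique H).
apply: (filterlim_ext (fun s => lsum (G := C_NormedModule)
   (fun n => if (j - l =? n)%Z then w n l else 0%C) s)).
  by move=> s; apply: lsum_eq => n; rewrite entry_shift_diag.
have := @is_usum_single Z C_AbsRing C_NormedModule
  (fun n => if (j - l =? n)%Z then w n l else 0%C) (j - l)%Z.
rewrite Z.eqb_refl; apply=> n Hn.
by case: Z.eqb_spec => // E; case: Hn.
Qed.

Lemma laurent_exists (w : Z -> Z -> C)
    (Hw : forall n, exists M, forall l, Cmod (w n l) <= M) (K : R) :
  (forall n l, Cmod (w n l) <= K * / (1 + IZR (Z.abs n)) ^ 2) ->
  exists b : BL HZ HZ, is_usum (fun n => BL_comp (shift n) (diag (Hw n))) b /\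
    BL_norm b <= K * 8.
Proof.
move=> HK.
have pos n : 0 < / (1 + IZR (Z.abs n)) ^ 2.
  apply: Rinv_0_lt_compat; apply: pow_lt.
  by have : 0 <= IZR (Z.abs n) by [apply: IZR_le; lia]; lra.
have HK0 : 0 <= K.
  have := HK 0%Z 0%Z; have := Cmod_ge_0 (w 0%Z 0%Z); have := pos 0%Z.
  by move=> H1 H2 H3; apply: Rnot_lt_le => H4; nra.
apply: (@is_usum_dominated Z C_AbsRing (BL_CompleteNormedModule HZ
  (l2_CompleteNormedModule Z)) _ (fun n => K * / (1 + IZR (Z.abs n)) ^ 2)).
  move=> n; apply: Rle_trans (BL_norm_comp _ _) _.
  rewrite -(Rmult_1_l (K * _)); apply: Rmult_le_compat; try exact: BL_norm_ge0.
    by apply: weighted_norm_le => [|_]; rewrite ?Cmod_1; lra.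
  apply: weighted_norm_le => //.
  by apply: Rmult_le_pos => //; exact: Rlt_le.
move=> s Hs.
have -> : lsum (fun n => K * / (1 + IZR (Z.abs n)) ^ 2) s =
    K * lsum (fun n => / (1 + IZR (Z.abs n)) ^ 2) s.
  elim: s {Hs} => [|n s IH] /=; first by rewrite /zero /=; ring.
  by rewrite IH /plus /=; ring.
by apply: Rmult_le_compat_l => //; exact: lsum_inv_sqr_Z.
Qed.

Lemma entry_toeplitz (b : BL HZ HZ) (j k : nat) :
  entry (toeplitz b) j k = entry b (Z.of_nat j) (Z.of_nat k).
Proof.
rewrite /entry -[toeplitz b _]/(compress (b (embed (l2_basis k)))) embed_basis /=.
ring.
Qed.

Definition gap (j k : nat) : R := IZR (Z.abs (Z.of_nat j - Z.of_nat k)).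

Lemma gap_ge0 (j k : nat) : 0 <= gap j k.
Proof. by apply: IZR_le; lia. Qed.

(** Schur's bound, by writing the operator as the sum of its diagonals. *)
Lemma BL_norm_le_offdiag (X : BL HN HN) (K : R) :
  (forall j k, (1 + gap j k) ^ 2 * Cmod (entry X j k) <= K) ->
  BL_norm X <= K * 8.
Proof.
move=> HK.
pose w (n l : Z) := if ((0 <=? l) && (0 <=? n + l))%Z then
  entry X (Z.to_nat (n + l)) (Z.to_nat l) else 0%C.
have HK0 : 0 <= K.
  apply: Rle_trans (HK 0%N 0%N); apply: Rmult_le_pos; last exact: Cmod_ge_0.
  exact: pow2_ge_0.
have Hwn n l : Cmod (w n l) <= K * / (1 + IZR (Z.abs n)) ^ 2.
  have Hp : 0 < (1 + IZR (Z.abs n)) ^ 2.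
    by apply: pow_lt; have : 0 <= IZR (Z.abs n) by [apply: IZR_le; lia]; lra.
  apply: (Rmult_le_reg_l _ _ _ Hp).
  have -> : (1 + IZR (Z.abs n)) ^ 2 * (K * / (1 + IZR (Z.abs n)) ^ 2) = K.
    by field; have : 0 <= IZR (Z.abs n) by [apply: IZR_le; lia]; lra.
  rewrite /w; case: Z.leb_spec => H1 /=; last by rewrite Cmod_0; lra.
  case: Z.leb_spec => H2 /=; last by rewrite Cmod_0; lra.
  have := HK (Z.to_nat (n + l)) (Z.to_nat l); rewrite /gap.
  by have -> : (Z.of_nat (Z.to_nat (n + l)) - Z.of_nat (Z.to_nat l) = n)%Z by lia.
have Hw n : exists M, forall l, Cmod (w n l) <= M by exists (K * / (1 + IZR (Z.abs n)) ^ 2).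
have [b [Hb Hn]] := laurent_exists Hw Hwn.
have -> : X = toeplitz b.
  apply: BL_entry_ext => j k; rewrite entry_toeplitz (entry_laurent Hb) /w.
  have -> : (0 <=? Z.of_nat k)%Z = true by apply/Z.leb_spec0; lia.
  have -> : (0 <=? Z.of_nat j - Z.of_nat k + Z.of_nat k)%Z = true.
    by apply/Z.leb_spec0; lia.
  by rewrite /=; congr (entry X); lia.
apply: Rle_trans (BL_norm_comp _ _) _.
rewrite -(Rmult_1_l (K * 8)); apply: Rmult_le_compat; try exact: BL_norm_ge0.
  by apply: weighted_norm_le => [|_]; rewrite ?Cmod_1; lra.
apply: Rle_trans (BL_norm_comp _ _) _.
rewrite -(Rmult_1_r (K * 8)); apply: Rmult_le_compat => //;
  try exact: BL_norm_ge0.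
by apply: weighted_norm_le => [|_]; rewrite ?Cmod_1; lra.
Qed.

(** * Smooth and smoothing families of operators *)

Section OperatorAlgebra.
Variable I : Type.
Notation H := (l2_NormedModule I).
Implicit Types X Y Z : BL H H.

Lemma BL_compA X Y Z : BL_comp X (BL_comp Y Z) = BL_comp (BL_comp X Y) Z.
Proof. by apply: BL_ext. Qed.

Lemma BL_comp_id_l X : BL_comp BL_id X = X.
Proof. by apply: BL_ext. Qed.

Lemma BL_comp_id_r X : BL_comp X BL_id = X.
Proof. by apply: BL_ext. Qed.

Lemma BL_comp_plus_l X Y Z :
  BL_comp (plus X Y) Z = plus (BL_comp X Z) (BL_comp Y Z).
Proof. by apply: BL_ext. Qed.

Lemma BL_comp_plus_r X Y Z :
  BL_comp Z (plus X Y) = plus (BL_comp Z X) (BL_comp Z Y).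
Proof. by apply: BL_ext => x /=; rewrite (linear_plus _ (BL_linear Z)). Qed.

Lemma BL_comp_scal_l (c : C) X Y : BL_comp (scal c X) Y = scal c (BL_comp X Y).
Proof. by apply: BL_ext. Qed.

Lemma BL_comp_scal_r (c : C) X Y : BL_comp X (scal c Y) = scal c (BL_comp X Y).
Proof. by apply: BL_ext => x /=; rewrite (linear_scal _ (BL_linear X)). Qed.

Lemma BL_comp_opp_l X Y : BL_comp (opp X) Y = opp (BL_comp X Y).
Proof. by apply: BL_ext. Qed.

Lemma BL_comp_opp_r X Y : BL_comp X (opp Y) = opp (BL_comp X Y).
Proof.
by rewrite -(scal_opp_one Y) -(scal_opp_one (BL_comp X Y)) BL_comp_scal_r.
Qed.

Lemma BL_comp_minus_l X Y Z :
  BL_comp (minus X Y) Z = minus (BL_comp X Z) (BL_comp Y Z).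
Proof. by rewrite /minus BL_comp_plus_l BL_comp_opp_l. Qed.

Lemma BL_comp_minus_r X Y Z :
  BL_comp Z (minus X Y) = minus (BL_comp Z X) (BL_comp Z Y).
Proof. by rewrite /minus BL_comp_plus_r BL_comp_opp_r. Qed.

Definition commutator X Y : BL H H := minus (BL_comp X Y) (BL_comp Y X).

Lemma commutator_comp X Y Z :
  commutator X (BL_comp Y Z) =
  plus (BL_comp (commutator X Y) Z) (BL_comp Y (commutator X Z)).
Proof.
rewrite /commutator BL_comp_minus_l BL_comp_minus_r !BL_compA.
by apply: BL_ext => x; apply: l2_ext => i /=; ring.
Qed.

Lemma commutator_plus X Y Z :
  commutator X (plus Y Z) = plus (commutator X Y) (commutator X Z).
Proof.
rewrite /commutator BL_comp_plus_l BL_comp_plus_r.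
by apply: BL_ext => x; apply: l2_ext => i /=; ring.
Qed.

Lemma commutator_opp X Y : commutator X (opp Y) = opp (commutator X Y).
Proof.
rewrite /commutator BL_comp_opp_l BL_comp_opp_r.
by apply: BL_ext => x; apply: l2_ext => i /=; ring.
Qed.

Lemma commutator_scalar X (c : C) : commutator X (scal c BL_id) = zero.
Proof.
rewrite /commutator BL_comp_scal_l BL_comp_scal_r BL_comp_id_l BL_comp_id_r.
exact: minus_eq_zero.
Qed.

Lemma commutator_inverse X A R :
  BL_comp R A = BL_id -> BL_comp A R = BL_id ->
  commutator X R = opp (BL_comp (BL_comp R (commutator X A)) R).
Proof.
move=> HRA HAR; rewrite /commutator BL_comp_minus_r BL_comp_minus_l.
rewrite -!BL_compA HAR BL_comp_id_r (BL_compA R A) HRA BL_comp_id_l.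
by rewrite opp_minus.
Qed.

End OperatorAlgebra.

(** An element of this calculus is a family indexed by [T], standing for one
    operator together with a parameter in which all estimates are uniform.
    The weights [L t] are bounded for each [t], which makes commutators
    meaningful, but no bound uniform in [t] is assumed on them. *)
Section SmoothFamilies.
Variables (I T : Type).
Notation H := (l2_NormedModule I).
Variable L : T -> BL H H.
Implicit Types X Y : T -> BL H H.

Definition ubounded X : Prop := exists M, forall t, BL_norm (X t) <= M.

Fixpoint smooth_upto (n : nat) X : Prop :=
  ubounded X /\
  match n with
  | 0%N => True
  | n'.+1 => smooth_upto n' (fun t => commutator (L t) (X t))
  end.

Definition smooth X : Prop := forall n, smooth_upto n X.

Fixpoint weight (n : nat) (t : T) : BL H H :=
  match n with
  | 0%N => BL_id
  | n'.+1 => BL_comp (L t) (weight n' t)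
  end.

Definition smoothing X : Prop := forall M N : nat,
  ubounded (fun t => BL_comp (BL_comp (weight M t) (X t)) (weight N t)).

Lemma family_ext X Y : (forall t, X t = Y t) -> X = Y.
Proof. by move=> E; apply: functional_extensionality. Qed.

Lemma ubounded_plus X Y :
  ubounded X -> ubounded Y -> ubounded (fun t => plus (X t) (Y t)).
Proof.
move=> [M HM] [N HN]; exists (M + N) => t.
by apply: Rle_trans (BL_norm_triangle _ _) _; apply: Rplus_le_compat.
Qed.

Lemma ubounded_opp X : ubounded X -> ubounded (fun t => opp (X t)).
Proof. by move=> [M HM]; exists M => t; rewrite BL_norm_opp. Qed.

Lemma ubounded_comp X Y :
  ubounded X -> ubounded Y -> ubounded (fun t => BL_comp (X t) (Y t)).
Proof.
move=> [M HM] [N HN]; exists (M * N) => t.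
by apply: Rle_trans (BL_norm_comp _ _) _; apply: Rmult_le_compat => //;
  exact: BL_norm_ge0.
Qed.

Lemma BL_norm_id : BL_norm (BL_id : BL H H) <= 1.
Proof. by apply: BL_norm_le => [|x /=]; lra. Qed.

Lemma ubounded_scalar (z : T -> C) :
  (exists M, forall t, Cmod (z t) <= M) -> ubounded (fun t => scal (z t) BL_id).
Proof.
move=> [M HM]; exists M => t; apply: Rle_trans (BL_norm_scal _ _) _.
apply: Rle_trans (HM t); rewrite -{2}(Rmult_1_r (Cmod _)).
by apply: Rmult_le_compat_l; [exact: Cmod_ge_0|exact: BL_norm_id].
Qed.

Lemma smooth_upto_ubounded n X : smooth_upto n X -> ubounded X.
Proof. by case: n => [|n] []. Qed.

Lemma smooth_uptoS n X : smooth_upto n.+1 X -> smooth_upto n X.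
Proof.
elim: n X => [|n IH] X [H1 H2]; first by split.
by split=> //; apply: IH.
Qed.

Lemma smooth_upto_plus n X Y :
  smooth_upto n X -> smooth_upto n Y -> smooth_upto n (fun t => plus (X t) (Y t)).
Proof.
elim: n X Y => [|n IH] X Y [HX SX] [HY SY]; split=> //; try exact: ubounded_plus.
rewrite (_ : (fun t => _) = fun t =>
  plus (commutator (L t) (X t)) (commutator (L t) (Y t))); first exact: IH.
by apply: family_ext => t; exact: commutator_plus.
Qed.

Lemma smooth_upto_opp n X : smooth_upto n X -> smooth_upto n (fun t => opp (X t)).
Proof.
elim: n X => [|n IH] X [HX SX]; split=> //; try exact: ubounded_opp.
rewrite (_ : (fun t => _) = fun t => opp (commutator (L t) (X t))); first exact: IH.
by apply: family_ext => t; exact: commutator_opp.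
Qed.

(** Leibniz' rule for [[L, X Y]]. *)
Lemma smooth_upto_comp n X Y :
  smooth_upto n X -> smooth_upto n Y ->
  smooth_upto n (fun t => BL_comp (X t) (Y t)).
Proof.
elim: n X Y => [|n IH] X Y SX SY; split=> //;
  try by apply: ubounded_comp; apply: smooth_upto_ubounded; eassumption.
rewrite (_ : (fun t => _) = fun t => plus
  (BL_comp (commutator (L t) (X t)) (Y t))
  (BL_comp (X t) (commutator (L t) (Y t)))).
  apply: smooth_upto_plus; apply: IH.
  - by case: SX.
  - exact: smooth_uptoS.
  - exact: smooth_uptoS.
  - by case: SY.
by apply: family_ext => t; exact: commutator_comp.
Qed.

Lemma smooth_scalar (z : T -> C) :
  (exists M, forall t, Cmod (z t) <= M) -> smooth (fun t => scal (z t) BL_id).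
Proof.
move=> Hz n; elim: n z Hz => [|n IH] z Hz; split=> //; try exact: ubounded_scalar.
rewrite (_ : (fun t => _) = fun t => scal (RtoC 0) BL_id).
  by apply: IH; exists (Cmod 0) => _; exact: Rle_refl.
apply: family_ext => t; rewrite commutator_scalar.
by rewrite -[RtoC 0]/(zero : C_Ring) scal_zero_l.
Qed.

(** Since [[L, R] = - R [L, A] R], control of [n] iterated commutators of [R]
    gives control of [n + 1]. *)
Lemma smooth_inverse (A R : T -> BL H H) :
  (forall t, BL_comp (R t) (A t) = BL_id) ->
  (forall t, BL_comp (A t) (R t) = BL_id) ->
  ubounded R -> smooth A -> smooth R.
Proof.
move=> HRA HAR HR SA; elim=> [|n IH]; split=> //.
rewrite (_ : (fun t => _) = fun t =>
  opp (BL_comp (BL_comp (R t) (commutator (L t) (A t))) (R t))).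
  apply: smooth_upto_opp; apply: smooth_upto_comp => //.
  by apply: smooth_upto_comp => //; case: (SA n.+1).
by apply: family_ext => t; apply: commutator_inverse.
Qed.

Lemma weight_comp M N t : BL_comp (weight M t) (weight N t) = weight (M + N) t.
Proof.
elim: M => [|M IH]; first exact: BL_comp_id_l.
by rewrite /= -BL_compA IH.
Qed.

Lemma weightSr N t : weight N.+1 t = BL_comp (weight N t) (L t).
Proof. by rewrite -addn1 -weight_comp /= BL_comp_id_r. Qed.

(** Commuting a weight from the right of [R] to its left costs commutators
    [[L, R]], which are again smooth. *)
Lemma ubounded_comp_weight (X R : T -> BL H H) :
  (forall N, ubounded (fun t => BL_comp (X t) (weight N t))) -> smooth R ->
  forall N, ubounded (fun t => BL_comp (BL_comp (X t) (R t)) (weight N t)).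
Proof.
move=> HX SR N; elim: N X R HX SR => [|N IH] X R HX SR.
  rewrite (_ : (fun t => _) = fun t => BL_comp (BL_comp (X t) (weight 0 t)) (R t)).
    by apply: ubounded_comp => //; exact: (smooth_upto_ubounded (SR 0%N)).
  by apply: family_ext => t; rewrite /= !BL_comp_id_r.
rewrite (_ : (fun t => _) = fun t => plus
  (BL_comp (BL_comp (BL_comp (X t) (L t)) (R t)) (weight N t))
  (opp (BL_comp (BL_comp (X t) (commutator (L t) (R t))) (weight N t)))).
  apply: ubounded_plus; last first.
    by apply: ubounded_opp; apply: IH => // n; case: (SR n.+1).
  apply: IH => // n; rewrite (_ : (fun t => _) = fun t => BL_comp (X t) (weight n.+1 t)).
    exact: HX.
  by apply: family_ext => t; rewrite -BL_compA.
apply: family_ext => t; rewrite /= /commutator BL_comp_minus_r BL_comp_minus_l !BL_compA.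
by apply: BL_ext => x; apply: l2_ext => i /=; ring.
Qed.

Lemma ubounded_weight_comp (X R : T -> BL H H) :
  (forall M, ubounded (fun t => BL_comp (weight M t) (X t))) -> smooth R ->
  forall M, ubounded (fun t => BL_comp (weight M t) (BL_comp (R t) (X t))).
Proof.
move=> HX SR M; elim: M X R HX SR => [|M IH] X R HX SR.
  rewrite (_ : (fun t => _) = fun t => BL_comp (R t) (BL_comp (weight 0 t) (X t))).
    by apply: ubounded_comp => //; exact: (smooth_upto_ubounded (SR 0%N)).
  by apply: family_ext => t; rewrite /= !BL_comp_id_l.
rewrite (_ : (fun t => _) = fun t => plus
  (BL_comp (weight M t) (BL_comp (R t) (BL_comp (L t) (X t))))
  (BL_comp (weight M t) (BL_comp (commutator (L t) (R t)) (X t)))).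
  apply: ubounded_plus; last by apply: IH => // n; case: (SR n.+1).
  apply: IH => // n; rewrite (_ : (fun t => _) = fun t => BL_comp (weight n.+1 t) (X t)).
    exact: HX.
  by apply: family_ext => t; rewrite weightSr -BL_compA.
apply: family_ext => t.
rewrite weightSr /commutator BL_comp_minus_l BL_comp_minus_r !BL_compA.
by apply: BL_ext => x; apply: l2_ext => i /=; ring.
Qed.

Lemma smoothing_comp_smooth (X R : T -> BL H H) :
  smoothing X -> smooth R -> smoothing (fun t => BL_comp (X t) (R t)).
Proof.
move=> HX SR M N.
rewrite (_ : (fun t => _) = fun t =>
   BL_comp (BL_comp (BL_comp (weight M t) (X t)) (R t)) (weight N t)).
  by apply: ubounded_comp_weight.
by apply: family_ext => t; rewrite !BL_compA.
Qed.

Lemma smooth_comp_smoothing (X R : T -> BL H H) :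
  smoothing X -> smooth R -> smoothing (fun t => BL_comp (R t) (X t)).
Proof.
move=> HX SR M N.
rewrite (_ : (fun t => _) = fun t =>
   BL_comp (weight M t) (BL_comp (R t) (BL_comp (X t) (weight N t)))).
  apply: (ubounded_weight_comp (X := fun t => BL_comp (X t) (weight N t))) => // n.
  rewrite (_ : (fun t => _) = fun t =>
    BL_comp (BL_comp (weight n t) (X t)) (weight N t)); first exact: HX.
  by apply: family_ext => t; rewrite !BL_compA.
by apply: family_ext => t; rewrite !BL_compA.
Qed.

Lemma smoothing_plus X Y :
  smoothing X -> smoothing Y -> smoothing (fun t => plus (X t) (Y t)).
Proof.
move=> HX HY M N; have := ubounded_plus (HX M N) (HY M N).
rewrite (_ : (fun t => _) = fun t =>
  BL_comp (BL_comp (weight M t) (plus (X t) (Y t))) (weight N t)) //.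
by apply: family_ext => t; rewrite BL_comp_plus_r BL_comp_plus_l.
Qed.

Lemma smoothing_opp X : smoothing X -> smoothing (fun t => opp (X t)).
Proof.
move=> HX M N; have := ubounded_opp (HX M N).
rewrite (_ : (fun t => _) = fun t =>
  BL_comp (BL_comp (weight M t) (opp (X t))) (weight N t)) //.
by apply: family_ext => t; rewrite BL_comp_opp_r BL_comp_opp_l.
Qed.

(** The shift invariance of [A] modulo smoothing operators passes to its
    inverse [R].  Here [V U = 1] and [V A U = A + D]; compressing [R A = 1] gives
    [(V R U) (V A U) = 1 - V R (1 - U V) A U], because [U V] is not the
    identity, and multiplying by [R] on the right yields [V R U - R]. *)
Lemma smoothing_inverse_shift (A R D U V : T -> BL H H) :
  (forall t, BL_comp (R t) (A t) = BL_id) ->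
  (forall t, BL_comp (A t) (R t) = BL_id) ->
  (forall t, BL_comp (V t) (U t) = BL_id) ->
  (forall t, BL_comp (BL_comp (V t) (A t)) (U t) = plus (A t) (D t)) ->
  smooth A -> smooth R -> smooth U -> smooth V -> smoothing D ->
  smoothing (fun t => minus BL_id (BL_comp (U t) (V t))) ->
  smoothing (fun t => minus (BL_comp (BL_comp (V t) (R t)) (U t)) (R t)).
Proof.
move=> HRA HAR HVU HA SA SR SU SV SD SP.
pose P t := minus BL_id (BL_comp (U t) (V t)).
rewrite (_ : (fun t => _) = fun t => opp (plus
  (BL_comp (BL_comp (BL_comp (BL_comp (V t) (R t)) (U t)) (D t)) (R t))
  (BL_comp (BL_comp (BL_comp (BL_comp (V t) (R t)) (P t))
     (BL_comp (A t) (U t))) (R t)))).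
  have SVR : smooth (fun t => BL_comp (V t) (R t)).
    by move=> n; apply: smooth_upto_comp.
  apply: smoothing_opp; apply: smoothing_plus.
    apply: (smoothing_comp_smooth (R := R)) => //.
    apply: (smooth_comp_smoothing (X := D)) => //.
    by move=> n; apply: smooth_upto_comp.
  apply: (smoothing_comp_smooth (R := R)) => //.
  apply: (smoothing_comp_smooth (R := fun t => BL_comp (A t) (U t))).
    exact: (smooth_comp_smoothing (X := P)).
  by move=> n; apply: smooth_upto_comp.
apply: family_ext => t; rewrite /P.
have E1 : D t = minus (BL_comp (BL_comp (V t) (A t)) (U t)) (A t).
  by rewrite HA; apply: BL_ext => x; apply: l2_ext => i /=; ring.
have E2 : BL_comp (BL_comp (BL_comp (BL_comp (V t) (R t)) (U t)) (A t)) (R t) =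
    BL_comp (BL_comp (V t) (R t)) (U t).
  by rewrite -(BL_compA _ (A t)) HAR BL_comp_id_r.
have E3 : BL_comp (BL_comp (BL_comp (BL_comp (V t) (R t)) (A t)) (U t)) (R t) = R t.
  by rewrite -(BL_compA (V t)) HRA BL_comp_id_r HVU BL_comp_id_l.
rewrite E1 !BL_comp_minus_r !BL_comp_minus_l BL_comp_id_r !BL_compA E2 E3.
by apply: BL_ext => x; apply: l2_ext => i /=; ring.
Qed.

End SmoothFamilies.

(** * Decay of matrix entries *)

Section Decay.
Variable T : Type.
Implicit Types X : T -> BL HN HN.

Definition offdiag_decay X : Prop := forall N : nat, exists B : R,
  forall t j k, (1 + gap j k) ^ N * Cmod (entry (X t) j k) <= B.

Definition joint_decay X : Prop := forall M N : nat, exists B : R,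
  forall t j k,
    (1 + INR j) ^ M * (1 + INR k) ^ N * Cmod (entry (X t) j k) <= B.

Lemma gap_le (j k : nat) : 1 + gap j k <= (1 + INR j) * (1 + INR k).
Proof.
have Hj := pos_INR j; have Hk := pos_INR k.
have : gap j k <= INR j + INR k.
  by rewrite /gap !INR_IZR_INZ -plus_IZR; apply: IZR_le; lia.
nra.
Qed.

Lemma joint_decay_offdiag X : joint_decay X -> offdiag_decay X.
Proof.
move=> HX N; have [B HB] := HX N N; exists B => t j k.
apply: Rle_trans (HB t j k); rewrite -Rpow_mult_distr.
apply: Rmult_le_compat_r; first exact: Cmod_ge_0.
by apply: pow_incr; split; [have := gap_ge0 j k; lra|exact: gap_le].
Qed.

Lemma offdiag_decay_ubounded X : offdiag_decay X -> ubounded X.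
Proof.
move=> HX; have [B HB] := HX 2%N; exists (B * 8) => t.
exact: BL_norm_le_offdiag.
Qed.

Lemma offdiag_decay_plus X Y :
  offdiag_decay X -> offdiag_decay Y -> offdiag_decay (fun t => plus (X t) (Y t)).
Proof.
move=> HX HY N; have [B HB] := HX N; have [B' HB'] := HY N.
exists (B + B') => t j k; apply: Rle_trans (Rplus_le_compat _ _ _ _ (HB t j k) (HB' t j k)).
rewrite -Rmult_plus_distr_l; apply: Rmult_le_compat_l.
  by apply: pow_le; have := gap_ge0 j k; lra.
exact: Cmod_triangle.
Qed.

End Decay.

Lemma truncated_weight_bounded (m : nat) :
  exists M, forall j : nat, Cmod (RtoC (1 + INR (minn j m))) <= M.
Proof.
exists (1 + INR m) => j; have H := pos_INR (minn j m).
rewrite Cmod_R Rabs_pos_eq; last lra.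
by apply: Rplus_le_compat_l; apply: le_INR; apply/leP; rewrite geq_minr.
Qed.

(** The position weight [1 + j], cut off at [m] so that it is bounded; all
    estimates below are uniform in [m]. *)
Definition truncated_weight (m : nat) : BL HN HN :=
  diag (truncated_weight_bounded m).

Section DecayIsSmoothness.
Variables (T : Type) (mu : T -> nat).
Notation L := (fun t : T => truncated_weight (mu t)).
Implicit Types X : T -> BL HN HN.

Lemma entry_commutator X t j k :
  entry (commutator (L t) (X t)) j k =
  (RtoC (INR (minn j (mu t)) - INR (minn k (mu t))) * entry (X t) j k)%C.
Proof.
rewrite /commutator entry_minus entry_comp_diag entry_diag_comp !RtoC_plus RtoC_opp; ring.
Qed.

Lemma minn_gap j k m : Rabs (INR (minn j m) - INR (minn k m)) <= gap j k.
Proof.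
rewrite !INR_IZR_INZ -minus_IZR -abs_IZR; apply: IZR_le.
by rewrite /minn; case: ltnP => H1; case: ltnP => H2; lia.
Qed.

Lemma offdiag_decay_commutator X :
  offdiag_decay X -> offdiag_decay (fun t => commutator (L t) (X t)).
Proof.
move=> HX N; have [B HB] := HX N.+1; exists B => t j k.
apply: Rle_trans (HB t j k); rewrite entry_commutator Cmod_mult Cmod_R /=.
have Hg := gap_ge0 j k; have Hm := minn_gap j k (mu t).
have H1 : 0 <= (1 + gap j k) ^ N by apply: pow_le; lra.
have H2 := Cmod_ge_0 (entry (X t) j k).
have -> : (1 + gap j k) ^ N * (Rabs (INR (minn j (mu t)) - INR (minn k (mu t))) *
   Cmod (entry (X t) j k)) = Rabs (INR (minn j (mu t)) - INR (minn k (mu t))) *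
   ((1 + gap j k) ^ N * Cmod (entry (X t) j k)) by ring.
rewrite Rmult_assoc; apply: Rmult_le_compat_r; last lra.
exact: Rmult_le_pos.
Qed.

Lemma offdiag_decay_smooth X : offdiag_decay X -> smooth L X.
Proof.
move=> HX n; elim: n X HX => [|n IH] X HX; split=> //;
  try exact: offdiag_decay_ubounded.
by apply: IH; exact: offdiag_decay_commutator.
Qed.

(** The entries of [[L, X]] are those of [X] multiplied by the difference of two
    weights, so [n] commutators produce its [n]-th power. *)
Lemma smooth_upto_entry n X : smooth_upto L n X -> exists B : R, forall t j k,
  Rabs (INR (minn j (mu t)) - INR (minn k (mu t))) ^ n *
    Cmod (entry (X t) j k) <= B.
Proof.
elim: n X => [|n IH] X [[M HM] HX].
  exists M => t j k; rewrite Rmult_1_l.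
  exact: Rle_trans (entry_le _ _ _) (HM t).
have [B HB] := IH _ HX; exists B => t j k.
by have := HB t j k; rewrite entry_commutator Cmod_mult Cmod_R /=; lra.
Qed.

Lemma entry_weight X M N t j k :
  entry (BL_comp (BL_comp (weight L M t) (X t)) (weight L N t)) j k =
  (RtoC ((1 + INR (minn j (mu t))) ^ M * (1 + INR (minn k (mu t))) ^ N) *
   entry (X t) j k)%C.
Proof.
have H1 (Y : BL HN HN) : entry (BL_comp (weight L M t) Y) j k =
    (RtoC ((1 + INR (minn j (mu t))) ^ M) * entry Y j k)%C.
  elim: M => [|M IH] /=; first by rewrite BL_comp_id_l; ring.
  by rewrite -BL_compA entry_diag_comp IH RtoC_mult; ring.
have H2 (Y : BL HN HN) : entry (BL_comp Y (weight L N t)) j k =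
    (RtoC ((1 + INR (minn k (mu t))) ^ N) * entry Y j k)%C.
  elim: N Y => [|N IH] Y /=; first by rewrite BL_comp_id_r; ring.
  by rewrite BL_compA IH entry_comp_diag RtoC_mult; ring.
by rewrite -BL_compA H1 H2 RtoC_mult; ring.
Qed.

Lemma joint_decay_smoothing X : joint_decay X -> smoothing L X.
Proof.
move=> HX M N; apply: offdiag_decay_ubounded; apply: joint_decay_offdiag => M' N'.
have [B HB] := HX (M' + M)%N (N' + N)%N; exists B => t j k.
have Hp n : 1 <= 1 + INR n by have := pos_INR n; lra.
have Hm n : 1 + INR (minn n (mu t)) <= 1 + INR n.
  by apply: Rplus_le_compat_l; apply: le_INR; apply/leP; rewrite geq_minl.
apply: Rle_trans (HB t j k); rewrite entry_weight Cmod_mult Cmod_R !Rdef_pow_add.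
rewrite Rabs_pos_eq; last first.
  by apply: Rmult_le_pos; apply: pow_le; have := Hp (minn j (mu t));
    have := Hp (minn k (mu t)); lra.
rewrite -Rmult_assoc; apply: Rmult_le_compat_r; first exact: Cmod_ge_0.
have pw n : 0 <= (1 + INR j) ^ n * (1 + INR k) ^ n by
  apply: Rmult_le_pos; apply: pow_le; have := Hp j; have := Hp k; lra.
have -> : (1 + INR j) ^ M' * (1 + INR k) ^ N' *
   ((1 + INR (minn j (mu t))) ^ M * (1 + INR (minn k (mu t))) ^ N) =
   ((1 + INR j) ^ M' * (1 + INR (minn j (mu t))) ^ M) *
   ((1 + INR k) ^ N' * (1 + INR (minn k (mu t))) ^ N) by ring.
have pos n r : 0 <= (1 + INR n) ^ r by apply: pow_le; have := Hp n; lra.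
apply: Rmult_le_compat; try (by apply: Rmult_le_pos; exact: pos).
  apply: Rmult_le_compat_l => //; apply: pow_incr; split; last exact: Hm.
  by have := Hp (minn j (mu t)); lra.
apply: Rmult_le_compat_l => //; apply: pow_incr; split; last exact: Hm.
by have := Hp (minn k (mu t)); lra.
Qed.

End DecayIsSmoothness.

Section UniformInTheCutoff.
Variables (T : Type) (X : T -> BL HN HN).
Notation L := (fun mt : nat * T => truncated_weight mt.1).

(** A cutoff at [j + k] does not affect the weights of [j] and [k]; as the bounds
    are uniform in the cutoff, it may depend on the entry. *)
Lemma smooth_offdiag_decay : smooth L (fun mt => X mt.2) -> offdiag_decay X.
Proof.
move=> SX N; have [B HB] := smooth_upto_entry (mu := fun mt : nat * T => mt.1) (SX N).
have [B0 HB0] := smooth_upto_entry (mu := fun mt : nat * T => mt.1) (SX 0%N).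
exists (2 ^ N * (B0 + B)) => t j k.
have H := HB ((j + k)%N, t) j k; have H0 := HB0 (0%N, t) j k.
rewrite /= Rmult_1_l in H0; rewrite /= in H.
have E : Rabs (INR (minn j (j + k)) - INR (minn k (j + k))) = gap j k.
  rewrite (_ : minn j (j + k) = j); last by lia.
  rewrite (_ : minn k (j + k) = k); last by lia.
  by rewrite !INR_IZR_INZ -minus_IZR -abs_IZR.
rewrite E in H; have Hg := gap_ge0 j k; have Hc := Cmod_ge_0 (entry (X t) j k).
have H2 : (1 + gap j k) ^ N <= 2 ^ N * (1 + gap j k ^ N).
  have Hgn : 0 <= gap j k ^ N by exact: pow_le.
  have H2N : 0 < 2 ^ N by apply: pow_lt; lra.
  case: (Rle_lt_dec (gap j k) 1) => H1.
    apply: (Rle_trans _ (2 ^ N)); first by apply: pow_incr; lra.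
    nra.
  apply: (Rle_trans _ ((2 * gap j k) ^ N)); first by apply: pow_incr; lra.
  rewrite Rpow_mult_distr; nra.
apply: Rle_trans (Rmult_le_compat_r _ _ _ Hc H2) _.
rewrite Rmult_assoc; apply: Rmult_le_compat_l; first by apply: pow_le; lra.
rewrite Rmult_plus_distr_r Rmult_1_l; lra.
Qed.

Lemma smoothing_joint_decay : smoothing L (fun mt => X mt.2) -> joint_decay X.
Proof.
move=> SX M N; have [B HB] := SX M N; exists B => t j k.
apply: Rle_trans (HB ((j + k)%N, t)).
apply: Rle_trans (entry_le _ j k).
rewrite (@entry_weight (nat * T) (fun mt => mt.1) (fun mt => X mt.2)) /=.
rewrite (_ : minn j (j + k) = j); last by lia.
rewrite (_ : minn k (j + k) = k); last by lia.
rewrite Cmod_mult Cmod_R; apply: Rmult_le_compat_r; first exact: Cmod_ge_0.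
exact: Rle_abs.
Qed.

End UniformInTheCutoff.

Lemma shift_up_inj (l : nat) : partial_injective
  (fun j : nat => if (l <= j)%N then Some (j - l)%N else None).
Proof. by move=> j j' i; case: leqP => // H [<-]; case: leqP => // H' [E]; lia. Qed.

Lemma shift_down_inj (l : nat) : partial_injective (fun j : nat => Some (j + l)%N).
Proof. by move=> j j' i [<-] [E]; lia. Qed.

(** [shift_up l] is [U ^ l] for the unilateral shift [U], and [shift_down l]
    is its adjoint. *)
Definition shift_up (l : nat) : BL HN HN :=
  weighted_op (@shift_up_inj l) (const_bounded nat 1%C).

Definition shift_down (l : nat) : BL HN HN :=
  weighted_op (@shift_down_inj l) (const_bounded nat 1%C).

Lemma shift_up_basis (l k : nat) : shift_up l (l2_basis k) = l2_basis (k + l)%N.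
Proof.
rewrite /shift_up (@weighted_basis _ _ _ _ _ _ k (k + l)%N).
  by apply: l2_ext => j /=; ring.
by rewrite leq_addl addnK.
Qed.

Lemma entry_shifted (l : nat) (X : BL HN HN) (j k : nat) :
  entry (BL_comp (BL_comp (shift_down l) X) (shift_up l)) j k =
  entry X (j + l)%N (k + l)%N.
Proof.
rewrite /entry -[BL_comp _ _ _]/(shift_down l (X (shift_up l (l2_basis k)))).
by rewrite shift_up_basis /=; ring.
Qed.

Lemma shift_down_up (l : nat) : BL_comp (shift_down l) (shift_up l) = BL_id.
Proof.
apply: BL_ext => x; apply: l2_ext => j /=.
by rewrite leq_addl addnK; ring.
Qed.

Lemma entry_id (I : Type) (j k : I) :
  entry (BL_id : BL (l2_NormedModule I) (l2_NormedModule I)) j k = l2_basis k j.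
Proof. by []. Qed.

Lemma shift_up_offdiag_decay (T : Type) (l : nat) :
  offdiag_decay (fun _ : T => shift_up l).
Proof.
move=> N; exists ((1 + INR l) ^ N) => _ j k.
have Hg := gap_ge0 j k; have Hl := pos_INR l.
have Hp : 0 <= (1 + INR l) ^ N by apply: pow_le; lra.
rewrite /entry shift_up_basis; case: (classic (j = (k + l)%N)) => [->|H].
  rewrite l2_basis_same Cmod_1 Rmult_1_r; apply: pow_incr; split.
    by have := gap_ge0 (k + l)%N k; lra.
  by rewrite /gap INR_IZR_INZ; apply: Rplus_le_compat_l; apply: IZR_le; lia.
by rewrite l2_basis_diff // Cmod_0; lra.
Qed.

Lemma shift_down_offdiag_decay (T : Type) (l : nat) :
  offdiag_decay (fun _ : T => shift_down l).
Proof.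
move=> N; exists ((1 + INR l) ^ N) => _ j k.
have Hg := gap_ge0 j k; have Hl := pos_INR l.
have Hp : 0 <= (1 + INR l) ^ N by apply: pow_le; lra.
have -> : entry (shift_down l) j k = l2_basis k (j + l)%N.
  by rewrite /entry /=; case: excluded_middle_informative => /= _; ring.
case: (classic ((j + l)%N = k)) => [<-|H].
  rewrite l2_basis_same Cmod_1 Rmult_1_r; apply: pow_incr; split.
    by have := gap_ge0 j (j + l)%N; lra.
  by rewrite /gap INR_IZR_INZ; apply: Rplus_le_compat_l; apply: IZR_le; lia.
by rewrite l2_basis_diff // Cmod_0; lra.
Qed.

(** The operator is the projection onto the first [l] coordinates. *)
Lemma shift_defect_joint_decay (T : Type) (l : nat) :
  joint_decay (fun _ : T => minus BL_id (BL_comp (shift_up l) (shift_down l))).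
Proof.
move=> M N; exists ((1 + INR l) ^ M * (1 + INR l) ^ N) => _ j k.
have Hl := pos_INR l; have pos n : 0 <= 1 + INR n by have := pos_INR n; lra.
have Hp n : 0 <= (1 + INR l) ^ n by apply: pow_le; lra.
have -> : entry (minus BL_id (BL_comp (shift_up l) (shift_down l))) j k =
    if (j < l)%N then l2_basis k j else 0%C.
  rewrite entry_minus entry_id {1}/entry.
  rewrite -[BL_comp _ _ _]/(shift_up l (shift_down l (l2_basis k))).
  case: (ltnP j l) => H; rewrite [shift_up l _ j]/=.
    by rewrite leqNgt H /=; case: excluded_middle_informative => /= _; ring.
  rewrite H /= subnK //=.
  by case: excluded_middle_informative => /= _; ring.
case: (ltnP j l) => H; last by rewrite Cmod_0 Rmult_0_r; exact: Rmult_le_pos.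
case: (classic (j = k)) => [E|E]; last first.
  by rewrite l2_basis_diff // Cmod_0 Rmult_0_r; exact: Rmult_le_pos.
have Hj : 1 + INR j <= 1 + INR l.
  by apply: Rplus_le_compat_l; apply: le_INR; lia.
rewrite -E l2_basis_same Cmod_1 Rmult_1_r.
by apply: Rmult_le_compat; try (by apply: pow_le); apply: pow_incr; split.
Qed.

(** * Decay of resolvents *)

Definition shift_difference (l : nat) (X : BL HN HN) : BL HN HN :=
  minus (BL_comp (BL_comp (shift_down l) X) (shift_up l)) X.

Lemma entry_shift_difference (l : nat) (X : BL HN HN) (j k : nat) :
  entry (shift_difference l X) j k =
  (entry X (j + l)%N (k + l)%N - entry X j k)%C.
Proof. by rewrite /shift_difference entry_minus entry_shifted. Qed.

Lemma offdiag_decay_pullback (T T' : Type) (h : T' -> T) (X : T -> BL HN HN) :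
  offdiag_decay X -> offdiag_decay (fun t => X (h t)).
Proof. by move=> HX N; have [B HB] := HX N; exists B => t. Qed.

Lemma joint_decay_pullback (T T' : Type) (h : T' -> T) (X : T -> BL HN HN) :
  joint_decay X -> joint_decay (fun t => X (h t)).
Proof. by move=> HX M N; have [B HB] := HX M N; exists B => t. Qed.

Section Resolvents.
Variables (T : Type) (l : nat) (a : BL HN HN) (z : T -> C) (R : T -> BL HN HN).
Hypothesis a_offdiag : offdiag_decay (fun _ : unit => a).
Hypothesis a_shift : joint_decay (fun _ : unit => shift_difference l a).
Hypothesis z_bounded : exists M, forall t, Cmod (z t) <= M.
Hypothesis R_left : forall t, BL_comp (R t) (minus (scal (z t) BL_id) a) = BL_id.
Hypothesis R_right : forall t, BL_comp (minus (scal (z t) BL_id) a) (R t) = BL_id.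
Hypothesis R_bounded : ubounded R.

Let L := fun mt : nat * T => truncated_weight mt.1.
Let A (mt : nat * T) : BL HN HN := minus (scal (z mt.2) BL_id) a.

(* Only the scalar part of [z - a] varies along the family, and scalars commute
   with the weights. *)
Let A_smooth : smooth L A.
Proof.
move=> n; apply: smooth_upto_plus.
  apply: (smooth_scalar L (z := fun mt : nat * T => z mt.2)).
  by have [M HM] := z_bounded; exists M => t.
apply: smooth_upto_opp; apply: (@offdiag_decay_smooth _ (fun mt : nat * T => mt.1) (fun _ => a)).
exact: (offdiag_decay_pullback (fun _ => tt) a_offdiag).
Qed.

Let R_smooth : smooth L (fun mt => R mt.2).
Proof.
apply: (smooth_inverse (A := A)) => [t|t||]; last exact: A_smooth.
- exact: R_left.
- exact: R_right.
- by have [M HM] := R_bounded; exists M => t.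
Qed.

Lemma resolvent_offdiag_decay : offdiag_decay R.
Proof. exact: smooth_offdiag_decay R_smooth. Qed.

Lemma resolvent_shift_decay : joint_decay (fun t => shift_difference l (R t)).
Proof.
apply: smoothing_joint_decay.
apply: (@smoothing_inverse_shift nat _ L A (fun mt => R mt.2)
  (fun _ => opp (shift_difference l a)) (fun _ => shift_up l)
  (fun _ => shift_down l)) => [t|t|t|t||||||].
- exact: R_left.
- exact: R_right.
- exact: shift_down_up.
- rewrite /A BL_comp_minus_r BL_comp_minus_l BL_comp_scal_r BL_comp_id_r.
  rewrite BL_comp_scal_l shift_down_up.
  by apply: BL_ext => x; apply: l2_ext => i /=; ring.
- exact: A_smooth.
- exact: R_smooth.
- apply: (@offdiag_decay_smooth _ (fun mt : nat * T => mt.1) (fun _ => shift_up l)).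
  exact: shift_up_offdiag_decay.
- apply: (@offdiag_decay_smooth _ (fun mt : nat * T => mt.1) (fun _ => shift_down l)).
  exact: shift_down_offdiag_decay.
- apply: smoothing_opp.
  apply: (@joint_decay_smoothing _ (fun mt : nat * T => mt.1) (fun _ => shift_difference l a)).
  exact: (joint_decay_pullback (fun _ => tt) a_shift).
- apply: (@joint_decay_smoothing _ (fun mt : nat * T => mt.1)
    (fun _ => minus BL_id (BL_comp (shift_up l) (shift_down l)))).
  exact: shift_defect_joint_decay.
Qed.

End Resolvents.

(** * Matrix characterization of the smooth algebra *)

Section SupNorm.
Variable S : supernatural.

Lemma sup_norm_lub (f : CZS S) :
  is_lub_Rbar (fun r => exists x, r = Cmod (f x)) (Finite (sup_norm f)).
Proof.
rewrite /sup_norm; set P := (fun r => _).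
have [Hub Hle] := Lub_Rbar_correct P.
have [M HM] := CZS_bounded f.
have H1 : Rbar_le (Lub_Rbar P) (Finite M) by apply: Hle => r [x ->]; exact: HM.
have H2 : Rbar_le (Finite (Cmod (f (Zmod_sn_of_Z S 0)))) (Lub_Rbar P).
  by apply: Hub; exists (Zmod_sn_of_Z S 0).
by case: (Lub_Rbar P) Hub Hle H1 H2.
Qed.

Lemma sup_norm_ge (f : CZS S) (x : Zmod_sn S) : Cmod (f x) <= sup_norm f.
Proof. by apply: (proj1 (sup_norm_lub f)); exists x. Qed.

Lemma sup_norm_le (f : CZS S) (M : R) :
  (forall x, Cmod (f x) <= M) -> sup_norm f <= M.
Proof. by move=> H; apply: (proj2 (sup_norm_lub f) (Finite M)) => r [x ->]; exact: H. Qed.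

Lemma sup_norm_ge0 (f : CZS S) : 0 <= sup_norm f.
Proof.
by apply: Rle_trans (sup_norm_ge f (Zmod_sn_of_Z S 0)); exact: Cmod_ge_0.
Qed.

End SupNorm.

Lemma entry_shift_conj (l : Z) (b : BL HZ HZ) (j k : Z) :
  entry (BL_comp (BL_comp (shift l) b) (shift (- l))) j k =
  entry b (j - l)%Z (k - l)%Z.
Proof.
rewrite /entry -[BL_comp _ _ _]/(shift l (b (shift (- l) (l2_basis k)))).
rewrite shift_basis -[(k + - l)%Z]/(k - l)%Z.
exact: Cmult_1_l.
Qed.

Lemma entry_matrix_unit_sum (u : nat -> nat -> C) (c : BL HN HN) :
  is_usum (fun ks : nat * nat => scal (u ks.1 ks.2) (matrix_unit ks.1 ks.2)) c ->
  forall j k, entry c j k = u j k.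
Proof.
move=> Hc j k; have H := is_usum_linear (entry_is_linear j k) Hc.
apply: (is_usum_unique H).
pose g (ks : nat * nat) : C := if ks == (j, k) then u j k else 0%C.
have Hg : is_usum (V := C_NormedModule) g (u j k).
  have := @is_usum_single _ C_AbsRing C_NormedModule g (j, k).
  rewrite /g eqxx; apply=> ks Hks.
  by case: eqP => // E; case: Hks.
apply: (filterlim_ext (fun s => lsum (G := C_NormedModule) g s)) Hg => s.
apply: lsum_eq => -[j' k']; rewrite /g.
rewrite -[RHS]/(u j' k' * (matrix_unit j' k' (l2_basis k) j))%C matrix_unit_basis.
case: (@eqP _ k' k) => [->|Hk] /=.
  case: (@eqP _ j' j) => [->|Hj].
    by rewrite eqxx; case: excluded_middle_informative => //= _; ring.
  case: eqP => [[E]|_] //; case: excluded_middle_informative => E //=.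
    by case: Hj.
  by ring.
by case: eqP => [[_ E]|_]; [case: Hk|ring].
Qed.

Lemma rapidly_decaying_bound (S : supernatural) (f : Z -> CZS S) :
  rapidly_decaying (fun n => sup_norm (f n)) -> forall N, exists B, forall n x,
  (1 + IZR (Z.abs n)) ^ N * Cmod (f n x) <= B.
Proof.
move=> Hf N; have [B HB] := Hf N; exists B => n x.
apply: Rle_trans (HB n); apply: Rmult_le_compat_l.
  by apply: pow_le; have : 0 <= IZR (Z.abs n) by [apply: IZR_le; lia]; lra.
by rewrite Rabs_pos_eq; [exact: sup_norm_ge|exact: sup_norm_ge0].
Qed.

(** The Toeplitz part is [l]-periodic along the diagonals, so only the smooth
    compact part is left in the shift difference. *)
Lemma BDT_smooth_decay (S : supernatural) (a : BL HN HN) : BDT_smooth S a ->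
  exists l : nat, sn_divides l S /\ offdiag_decay (fun _ : unit => a) /\
    joint_decay (fun _ : unit => shift_difference l a).
Proof.
move=> [b [c [[f [Hf [Hb [l [Hl Hinv]]]]] [[u [Hu Hc]] ->]]]].
have Eb := entry_laurent (w := fun n k => f n (Zmod_sn_of_Z S k))
  (Hw := fun n => mulZ_bounded (f n)) Hb.
have Ec := entry_matrix_unit_sum Hc.
have Dc : joint_decay (fun _ : unit => c).
  by move=> M N; have [B HB] := Hu M N; exists B => _ j k; rewrite Ec.
have Db : offdiag_decay (fun _ : unit => toeplitz b).
  move=> N; have [B HB] := rapidly_decaying_bound Hf N; exists B => _ j k.
  by rewrite entry_toeplitz Eb; exact: HB.
exists l; split=> //; split.
  apply: (offdiag_decay_plus Db); exact: joint_decay_offdiag.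
move=> M N; have [B HB] := Dc M N; exists (B + B) => _ j k.
rewrite entry_shift_difference.
have Ep j' k' : entry (plus (toeplitz b) c) j' k' =
    (entry (toeplitz b) j' k' + entry c j' k')%C by [].
have Et : entry (toeplitz b) (j + l)%N (k + l)%N = entry (toeplitz b) j k.
  rewrite !entry_toeplitz -{1}Hinv entry_shift_conj.
  by congr (entry b); lia.
rewrite !Ep Et.
have -> : (entry (toeplitz b) j k + entry c (j + l)%N (k + l)%N -
   (entry (toeplitz b) j k + entry c j k))%C =
   (entry c (j + l)%N (k + l)%N + - entry c j k)%C by ring.
have pos n : 0 <= 1 + INR n by have := pos_INR n; lra.
have mono n r : (1 + INR n) ^ r <= (1 + INR (n + l)) ^ r.
  by apply: pow_incr; split=> //; apply: Rplus_le_compat_l; apply: le_INR; lia.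
have pw n r : 0 <= (1 + INR n) ^ r by exact: pow_le.
apply: Rle_trans (Rplus_le_compat _ _ _ _ (HB tt (j + l)%N (k + l)%N) (HB tt j k)).
apply: Rle_trans (Rmult_le_compat_l _ _ _ _ (Cmod_triangle _ _)) _.
  exact: Rmult_le_pos.
rewrite Rmult_plus_distr_l Cmod_opp; apply: Rplus_le_compat_r.
apply: Rmult_le_compat_r; first exact: Cmod_ge_0.
exact: Rmult_le_compat.
Qed.

Section PeriodicFunctions.
Variables (S : supernatural) (l : nat).
Hypothesis l_divides : sn_divides l S.

(** At primes that do not divide [l] the congruence is modulo [1], so the
    condition involves finitely many components of [x]. *)
Definition represents (x : Zmod_sn S) (k : nat) : Prop := forall p : prime_number,
  Zp_pow_residue (logn (prime_nat p) l) (x p) = k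
    %[mod prime_nat p ^ logn (prime_nat p) l].

Lemma residue_of_Z (p : prime_number) (z : Z) (v : nat) :
  exponent_le v (S p) ->
  exists q : Z, Z.of_nat (Zp_pow_residue v (Zmod_sn_of_Z S z p)) =
    (z + q * Z.of_nat (prime_nat p ^ v))%Z.
Proof.
have Hp k : (0 < prime_nat p ^ k)%N by rewrite expn_gt0 prime_number_gt0.
have Hmod n : (0 < n)%N ->
    Z.of_nat (Z.to_nat (z mod Z.of_nat n)) = (z + - (z / Z.of_nat n) * Z.of_nat n)%Z.
  move=> Hn; rewrite Z2Nat.id; first by rewrite Z.mod_eq; lia.
  by case: (Z.mod_pos_bound z (Z.of_nat n)); lia.
rewrite /Zmod_sn_of_Z; case: (S p) => [m|] /= Hv; last first.
  by eexists; rewrite Hmod.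
rewrite Hmod //; exists (- (z / Z.of_nat (prime_nat p ^ m)) *
  Z.of_nat (prime_nat p ^ (m - v)))%Z.
have {2}-> : m = ((m - v) + v)%N by lia.
rewrite expnD Nat2Z.inj_mul; ring.
Qed.

Lemma modn_of_Z (m n d : nat) (q : Z) :
  Z.of_nat m = (Z.of_nat n + q * Z.of_nat d)%Z -> m = n %[mod d].
Proof.
move=> E; case: (Z.le_ge_cases 0 q) => Hq.
  have -> : m = (Z.to_nat q * d + n)%N by lia.
  by rewrite modnMDl.
have -> : n = (Z.to_nat (- q) * d + m)%N by lia.
by rewrite modnMDl.
Qed.

Lemma represents_of_Z (z : Z) :
  represents (Zmod_sn_of_Z S z) (Z.to_nat (z mod Z.of_nat l)).
Proof.
have [Hl0 Hl] := l_divides.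
move=> p; have [q Hq] := residue_of_Z z (Hl p).
have Hd : (prime_nat p ^ logn (prime_nat p) l %| l)%N by exact: pfactor_dvdnn.
have [c Hc] := dvdnP Hd.
apply: (@modn_of_Z _ _ _ (q + (z / Z.of_nat l) * Z.of_nat c)%Z).
rewrite Hq Z2Nat.id; last by case: (Z.mod_pos_bound z (Z.of_nat l)); lia.
rewrite Z.mod_eq; last by lia.
rewrite {2}Hc Nat2Z.inj_mul; ring.
Qed.

Lemma represents_eqmod (x : Zmod_sn S) (k k' : nat) :
  represents x k -> represents x k' -> k = k' %[mod l].
Proof.
have [Hl0 _] := l_divides.
move=> H H'; wlog Hk : k k' H H' / (k' <= k)%N.
  move=> W; case: (leqP k' k) => Hk; first exact: W.
  by symmetry; apply: W => //; exact: ltnW.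
apply/eqP; rewrite eqn_mod_dvd //; apply/dvdn_partP => // p.
rewrite mem_primes => /andP [Hp _]; rewrite p_part.
rewrite -eqn_mod_dvd //; apply/eqP.
by rewrite -(H (exist _ p Hp)) -(H' (exist _ p Hp)).
Qed.

Lemma finitely_many_primes (n : nat) : exists s : list prime_number,
  forall p : prime_number, (prime_nat p < n)%N -> In p s.
Proof.
elim: n => [|n [s Hs]]; first by exists nil.
case E : (prime n).
  exists (exist _ n E :: s) => p; rewrite ltnS leq_eqVlt => /orP [/eqP Hp|Hp].
    by left; apply: val_inj; rewrite /= -Hp.
  by right; apply: Hs.
exists s => p; rewrite ltnS leq_eqVlt => /orP [/eqP Hp|Hp]; last exact: Hs.
by case: p Hp => p Hpp /= Hp; rewrite -Hp Hpp in E.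
Qed.

Variable phi : Z -> C.
Hypothesis phi_periodic : forall k, phi (k + Z.of_nat l)%Z = phi k.

(** When no integer represents [x], which the Chinese remainder theorem excludes,
    [epsilon] returns an arbitrary one.  The value depends on [x] only through
    the predicate [represents x], hence through finitely many residues; this
    gives continuity.  Every value is one of [phi], so bounds carry over. *)
Definition periodic_extension (x : Zmod_sn S) : C :=
  phi (Z.of_nat (epsilon (inhabits 0%N) (represents x))).

Lemma phi_eqmod (k k' : Z) (q : Z) : k = (k' + q * Z.of_nat l)%Z -> phi k = phi k'.
Proof.
have H n j : phi (j + Z.of_nat n * Z.of_nat l)%Z = phi j.
  elim: n => [|n IH]; first by congr phi; lia.
  by rewrite -IH -(phi_periodic (j + Z.of_nat n * Z.of_nat l)); congr phi; lia.
move=> ->; case: (Z.le_ge_cases 0 q) => Hq.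
  by rewrite -(H (Z.to_nat q) k'); congr phi; lia.
by rewrite -(H (Z.to_nat (- q)) (k' + q * _)%Z); congr phi; nia.
Qed.

Lemma periodic_extension_of_Z (z : Z) :
  periodic_extension (Zmod_sn_of_Z S z) = phi z.
Proof.
rewrite /periodic_extension; set k := epsilon _ _.
have Hr := represents_of_Z z.
have Hk : represents (Zmod_sn_of_Z S z) k by apply: epsilon_spec; eexists; exact: Hr.
have [Hl0 _] := l_divides.
have E := represents_eqmod Hk Hr; move: E; set r := Z.to_nat _ => E.
have Er : Z.of_nat r = (z - (z / Z.of_nat l) * Z.of_nat l)%Z.
  rewrite /r Z2Nat.id; first by rewrite Z.mod_eq; lia.
  by case: (Z.mod_pos_bound z (Z.of_nat l)); lia.
apply: (@phi_eqmod _ _ (Z.of_nat (k %/ l) - Z.of_nat (r %/ l) - z / Z.of_nat l)%Z).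
have Ek := divn_eq k l; have Er' := divn_eq r l; rewrite E in Ek.
move: (k %/ l)%N (r %/ l)%N (r %% l)%N Ek Er' Er => qk qr rr Ek Er' Er.
nia.
Qed.

Lemma periodic_extension_continuous (x : Zmod_sn S) :
  filterlim periodic_extension (Zmod_sn_nbhs x) (locally (periodic_extension x)).
Proof.
have [Hl0 _] := l_divides.
move=> P HP; have HPx := locally_singleton _ _ HP.
have [s Hs] := finitely_many_primes l.+1.
exists s, (fun p y => Zp_pow_residue (logn (prime_nat p) l) y =
  Zp_pow_residue (logn (prime_nat p) l) (x p)); split.
  move=> p _; move: (x p); rewrite /Zp_pow_nbhs; case: (S p) => [m|] y //.
  by exists (logn (prime_nat p) l) => y' /= ->.
move=> y Hy; rewrite /filtermap.
suff -> : periodic_extension y = periodic_extension x by [].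
rewrite /periodic_extension; congr (phi (Z.of_nat (epsilon _ _))).
apply: functional_extensionality => k; apply: propositional_extensionality.
suff E p : Zp_pow_residue (logn (prime_nat p) l) (y p) =
    Zp_pow_residue (logn (prime_nat p) l) (x p)
    %[mod prime_nat p ^ logn (prime_nat p) l].
  by split=> H p; [rewrite -E|rewrite E]; exact: H.
case: (posnP (logn (prime_nat p) l)) => [->|Hp]; first by rewrite expn0 !modn1.
rewrite (Hy p) //; apply: Hs; rewrite ltnS; apply: dvdn_leq => //.
by move: Hp; rewrite logn_gt0 mem_primes => /and3P [].
Qed.

Definition periodic_CZS : CZS S := mkCZS periodic_extension_continuous.

End PeriodicFunctions.

(** The limit is [u 0] plus the unordered sum of the increments. *)
Lemma summable_increments_limit (u : nat -> C) (B : R) :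
  (forall n, Cmod (u n.+1 - u n) <= B * / (1 + INR n) ^ 2) ->
  exists v : C, filterlim u eventually (locally (T := C_NormedModule) v) /\
    Cmod (v - u 0%N) <= 2 * B.
Proof.
move=> HB; pose d n := (u n.+1 - u n)%C.
have Hpos n : 0 < / (1 + INR n) ^ 2.
  by apply: Rinv_0_lt_compat; apply: pow_lt; have := pos_INR n; lra.
have HB0 : 0 <= B.
  have := HB 0%N; have := Cmod_ge_0 (u 1%N - u 0%N)%C; have := Hpos 0%N.
  by move=> H1 H2 H3; apply: Rnot_lt_le => H4; nra.
have Hs s : NoDup s -> lsum (fun n => B * / (1 + INR n) ^ 2) s <= 2 * B.
  move=> Hs; have := lsum_inv_sqr_nat Hs.
  have -> : lsum (fun n => B * / (1 + INR n) ^ 2) s =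
      B * lsum (fun n => / (1 + INR n) ^ 2) s.
    elim: s {Hs} => [|n s IH] /=; first by rewrite /zero /=; ring.
    by rewrite IH /plus /=; ring.
  by nra.
have [v [Hv Hn]] := @is_usum_dominated nat C_AbsRing C_CompleteNormedModule d
  (fun n => B * / (1 + INR n) ^ 2) (2 * B) HB Hs.
have Eu n : u n = (u 0%N + lsum (G := C_NormedModule) d (List.seq 0 n))%C.
  elim: n => [|n IH]; first by rewrite /= /zero /=; ring.
  rewrite seq_S lsum_cat -[plus _ _]/(lsum (G := C_NormedModule) d (List.seq 0 n) + (d n + 0))%C.
  have -> : u n.+1 = (u n + d n)%C by rewrite /d; ring.
  by rewrite {1}IH; ring.
exists (u 0%N + v)%C; split; last first.
  by have -> : (u 0%N + v - u 0%N)%C = v by ring.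
apply: (filterlim_ext (fun n => plus (u 0%N) (lsum (G := C_NormedModule) d (List.seq 0 n)))).
  by move=> n; rewrite [RHS]Eu.
apply: (filterlim_comp _ _ _ (fun n => lsum (G := C_NormedModule) d (List.seq 0 n))
  (fun c => plus (u 0%N) c) eventually (locally (T := C_NormedModule) v)).
  move=> P HP; have [s0 H0] := Hv P HP.
  exists (list_max s0).+1 => n Hn'; apply: H0; first exact: seq_NoDup.
  move=> k Hk; apply/in_seq; split; first exact: Nat.le_0_l.
  have := proj1 (list_max_le s0 (list_max s0)) (le_n _).
  by move/Forall_forall => /(_ k Hk); lia.
apply: (continuous_plus (V := C_NormedModule) (fun _ => u 0%N) (fun c => c)).
  exact: continuous_const.
exact: continuous_id.
Qed.

Lemma filterlim_shift (U : UniformSpace) (u : nat -> U) (m : nat)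
    (G : (U -> Prop) -> Prop) :
  filterlim (fun n => u (n + m)%N) eventually G <-> filterlim u eventually G.
Proof.
split=> H P HP; have [N HN] := H P HP.
  exists (N + m)%N => n Hn; have := HN (n - m)%N.
  by rewrite subnK; [apply; lia|lia].
by exists N => n Hn; apply: HN; lia.
Qed.

Section DiagonalLimits.
Variables (a : BL HN HN) (l : nat).
Hypothesis l_gt0 : (0 < l)%N.
Hypothesis a_offdiag : offdiag_decay (fun _ : unit => a).
Hypothesis a_shift : joint_decay (fun _ : unit => shift_difference l a).

(** Negative indices are sent to [0]; this affects finitely many [n] only, since
    [l > 0]. *)
Definition diagonal_translate (j k : Z) (n : nat) : C :=
  entry a (Z.to_nat (j + Z.of_nat n * Z.of_nat l))
          (Z.to_nat (k + Z.of_nat n * Z.of_nat l)).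

Definition is_diagonal_limit (j k : Z) (v : C) : Prop :=
  filterlim (diagonal_translate j k) eventually (locally (T := C_NormedModule) v).

(** The increments are entries of the shift difference at
    [(j + n l, k + n l)]; two of the powers of [1 + j + n l] that they can
    absorb make them summable in [n], the others give the decay in [j]. *)
Lemma diagonal_limit_nat (M N : nat) : exists B : R, forall j k : nat,
  exists v, is_diagonal_limit (Z.of_nat j) (Z.of_nat k) v /\
    (1 + INR j) ^ M * (1 + INR k) ^ N * Cmod (v - entry a j k) <= B.
Proof.
have [B HB] := a_shift M.+2 N; exists (2 * B) => j k.
have pos n : 0 < 1 + INR n by have := pos_INR n; lra.
set W := (1 + INR j) ^ M * (1 + INR k) ^ N.
have HW : 0 < W by apply: Rmult_lt_0_compat; apply: pow_lt.
have [|v [Hv Hv0]] := @summable_increments_limit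
    (diagonal_translate (Z.of_nat j) (Z.of_nat k)) (B * / W).
  move=> n; set j' := (j + n * l)%N; set k' := (k + n * l)%N.
  have E0 : diagonal_translate (Z.of_nat j) (Z.of_nat k) n = entry a j' k'.
    by rewrite /diagonal_translate; congr (entry a); lia.
  have E1 : diagonal_translate (Z.of_nat j) (Z.of_nat k) n.+1 =
      entry a (j' + l)%N (k' + l)%N.
    by rewrite /diagonal_translate; congr (entry a); lia.
  rewrite E0 E1 -entry_shift_difference.
  have H := HB tt j' k'.
  have Hj : 1 + INR j <= 1 + INR j' by apply: Rplus_le_compat_l; apply: le_INR; lia.
  have Hk : 1 + INR k <= 1 + INR k' by apply: Rplus_le_compat_l; apply: le_INR; lia.
  have Hn : 1 + INR n <= 1 + INR j' by apply: Rplus_le_compat_l; apply: le_INR; nia.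
  have Hn2 : 0 < (1 + INR n) ^ 2 by exact: pow_lt.
  apply: (Rmult_le_reg_l (W * (1 + INR n) ^ 2)); first exact: Rmult_lt_0_compat.
  have -> : W * (1 + INR n) ^ 2 * (B * / W * / (1 + INR n) ^ 2) = B.
    by field; split; [have := pos n; lra|lra].
  apply: Rle_trans H; apply: Rmult_le_compat_r; first exact: Cmod_ge_0.
  have -> : W * (1 + INR n) ^ 2 =
    ((1 + INR n) ^ 2 * (1 + INR j) ^ M) * (1 + INR k) ^ N by rewrite /W; ring.
  have pw m r : 0 <= (1 + INR m) ^ r by apply: pow_le; apply: Rlt_le.
  have mono (x y : R) r : 0 < x -> x <= y -> x ^ r <= y ^ r.
    by move=> Hx Hxy; apply: pow_incr; lra.
  apply: Rmult_le_compat => //; first exact: Rmult_le_pos.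
    rewrite -[M.+2]/(2 + M)%N Rdef_pow_add.
    by apply: Rmult_le_compat => //; exact: mono.
  exact: mono.
exists v; split=> //.
have E : diagonal_translate (Z.of_nat j) (Z.of_nat k) 0 = entry a j k.
  by rewrite /diagonal_translate; congr (entry a); lia.
rewrite E in Hv0; apply: Rle_trans (Rmult_le_compat_l _ _ _ (Rlt_le _ _ HW) Hv0) _.
by apply: Req_le; field; lra.
Qed.

Lemma diagonal_limit_unique (j k : Z) (v v' : C) :
  is_diagonal_limit j k v -> is_diagonal_limit j k v' -> v = v'.
Proof.
exact: (@filterlim_locally_unique _ C_AbsRing C_NormedModule eventually _).
Qed.

Lemma diagonal_limit_shift (j k : Z) (v : C) (m : nat) :
  is_diagonal_limit (j + Z.of_nat m * Z.of_nat l) (k + Z.of_nat m * Z.of_nat l) v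
  <-> is_diagonal_limit j k v.
Proof.
rewrite /is_diagonal_limit -(filterlim_shift (diagonal_translate j k) m).
suff -> : diagonal_translate (j + Z.of_nat m * Z.of_nat l)
    (k + Z.of_nat m * Z.of_nat l) = fun n => diagonal_translate j k (n + m)%N by [].
apply: functional_extensionality => n.
by rewrite /diagonal_translate; congr (entry a); lia.
Qed.

Lemma diagonal_limit_exists (j k : Z) : exists v, is_diagonal_limit j k v.
Proof.
have [B HB] := diagonal_limit_nat 0 0.
pose m := (Z.to_nat (- j) + Z.to_nat (- k))%N.
have [v [Hv _]] := HB (Z.to_nat (j + Z.of_nat m * Z.of_nat l))
  (Z.to_nat (k + Z.of_nat m * Z.of_nat l)).
exists v; apply/(diagonal_limit_shift j k v m).
by move: Hv; rewrite !Z2Nat.id //; rewrite /m; nia.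
Qed.

Lemma diagonal_limit_offdiag (N : nat) : exists B : R, forall j k v,
  is_diagonal_limit j k v -> (1 + IZR (Z.abs (j - k))) ^ N * Cmod v <= B.
Proof.
have [B HB] := a_offdiag N; exists B => j k v Hv.
have Hp : 0 < (1 + IZR (Z.abs (j - k))) ^ N.
  by apply: pow_lt; have : 0 <= IZR (Z.abs (j - k)) by [apply: IZR_le; lia]; lra.
suff H : Cmod v <= B / (1 + IZR (Z.abs (j - k))) ^ N.
  by move/Rle_div_r: H => /(_ Hp); lra.
apply: (@filterlim_le nat eventually _ (fun n => Cmod (diagonal_translate j k n))
  (fun _ => B / (1 + IZR (Z.abs (j - k))) ^ N) (Finite (Cmod v)) (Finite _)).
- exists (Z.to_nat (- j) + Z.to_nat (- k))%N => n Hn.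
  apply/Rle_div_r => //; rewrite Rmult_comm.
  have := HB tt (Z.to_nat (j + Z.of_nat n * Z.of_nat l))
    (Z.to_nat (k + Z.of_nat n * Z.of_nat l)).
  rewrite /gap !Z2Nat.id; [|nia|nia].
  by have -> : (j + Z.of_nat n * Z.of_nat l - (k + Z.of_nat n * Z.of_nat l) = j - k)%Z
    by ring.
- apply: (filterlim_comp _ _ _ _ _ _ _ _ Hv).
  exact: (@filterlim_norm C_AbsRing C_NormedModule v).
- exact: filterlim_const.
Qed.

End DiagonalLimits.

(** The expansion in matrix units converges absolutely, and its sum has the same
    entries as [c]. *)
Lemma joint_decay_compact_smooth (c : BL HN HN) :
  joint_decay (fun _ : unit => c) -> compact_smooth c.
Proof.
move=> Hc; exists (entry c); split.
  by move=> M N; have [B HB] := Hc M N; exists B => j k; exact: (HB tt).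
have [B HB] := Hc 2%N 2%N.
pose w (ks : nat * nat) := / (1 + INR ks.1) ^ 2 * / (1 + INR ks.2) ^ 2.
have pos n : 0 < (1 + INR n) ^ 2 by apply: pow_lt; have := pos_INR n; lra.
have HB0 : 0 <= B.
  apply: Rle_trans (HB tt 0%N 0%N); apply: Rmult_le_pos; last exact: Cmod_ge_0.
  by apply: Rmult_le_pos; exact: Rlt_le.
have Hs s : NoDup s -> lsum (fun ks => B * w ks) s <= B * 4.
  move=> Hs; have -> : lsum (fun ks => B * w ks) s = B * lsum w s.
    elim: s {Hs} => [|n s IH] /=; first by rewrite /zero /=; ring.
    by rewrite IH /plus /=; ring.
  by apply: Rmult_le_compat_l => //; exact: lsum_inv_sqr_nat2.
have [|c' [Hc' _]] := @is_usum_dominated (nat * nat) C_AbsRing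
  (BL_CompleteNormedModule HN (l2_CompleteNormedModule nat))
  (fun ks => scal (entry c ks.1 ks.2) (matrix_unit ks.1 ks.2)) _ _ _ Hs.
  move=> [j k] /=; apply: Rle_trans (BL_norm_scal _ _) _.
  apply: (Rle_trans _ (Cmod (entry c j k) * 1)).
    apply: Rmult_le_compat_l; first exact: Cmod_ge_0.
    by apply: weighted_norm_le => [|_]; rewrite ?Cmod_1; lra.
  rewrite Rmult_1_r; apply: (Rmult_le_reg_l ((1 + INR j) ^ 2 * (1 + INR k) ^ 2)).
    exact: Rmult_lt_0_compat.
  apply: Rle_trans (HB tt j k) _; apply: Req_le; rewrite /w /=.
  by field; split; [have := pos_INR k|have := pos_INR j]; lra.
have E : c = c'.
  by apply: BL_entry_ext => j k; rewrite (entry_matrix_unit_sum Hc').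
by rewrite {2}E; exact: Hc'.
Qed.

(** The Toeplitz part of [a] is recovered from the limits of its entries along
    the diagonals. *)
Lemma decay_BDT_smooth (S : supernatural) (l : nat) (a : BL HN HN) :
  sn_divides l S -> offdiag_decay (fun _ : unit => a) ->
  joint_decay (fun _ : unit => shift_difference l a) -> BDT_smooth S a.
Proof.
move=> Hl Hoff Hshift; have Hl0 := proj1 Hl.
have [beta' Hbeta'] := choice (fun jk v => is_diagonal_limit a l jk.1 jk.2 v)
  (fun jk => diagonal_limit_exists Hl0 Hshift jk.1 jk.2).
pose beta j k := beta' (j, k).
have Hbeta j k : is_diagonal_limit a l j k (beta j k) by exact: (Hbeta' (j, k)).
have beta_shift j k : beta (j + Z.of_nat l)%Z (k + Z.of_nat l)%Z = beta j k.
  apply: diagonal_limit_unique (Hbeta _ _) _.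
  by have := proj2 (diagonal_limit_shift a Hl0 j k (beta j k) 1) (Hbeta j k);
    rewrite !Z.mul_1_l.
pose phi n k := beta (n + k)%Z k.
have phi_periodic n k : phi n (k + Z.of_nat l)%Z = phi n k.
  by rewrite /phi Z.add_assoc.
pose f n := periodic_CZS Hl (phi n).
have Ef n k : f n (Zmod_sn_of_Z S k) = phi n k by exact: periodic_extension_of_Z.
have phi_decay N : exists B, forall n k, (1 + IZR (Z.abs n)) ^ N * Cmod (phi n k) <= B.
  have [B HB] := diagonal_limit_offdiag Hl0 Hoff N; exists B => n k.
  have := HB _ _ _ (Hbeta (n + k)%Z k).
  by have -> : (n + k - k = n)%Z by ring.
have pos n N : 0 < (1 + IZR (Z.abs n)) ^ N.
  by apply: pow_lt; have : 0 <= IZR (Z.abs n) by [apply: IZR_le; lia]; lra.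
have [K HK] := phi_decay 2%N.
have [|b [Hb _]] := @laurent_exists (fun n k => f n (Zmod_sn_of_Z S k))
    (fun n => mulZ_bounded (f n)) K.
  move=> n k; rewrite Ef; apply/Rle_div_r; first exact: pos.
  by rewrite Rmult_comm; exact: HK.
have Eb j k : entry b j k = beta j k.
  rewrite (entry_laurent Hb) Ef /phi; congr beta; ring.
exists b, (minus a (toeplitz b)); split; [|split].
- exists f; split; last split=> //.
    move=> N; have [B HB] := phi_decay N; exists B => n.
    rewrite Rabs_pos_eq; last exact: sup_norm_ge0.
    rewrite Rmult_comm; apply/Rle_div_r; first exact: pos.
    apply: sup_norm_le => x; apply/Rle_div_r; first exact: pos.
    by rewrite Rmult_comm; exact: HB.
  exists l; split=> //; apply: BL_entry_ext => j k.
  rewrite entry_shift_conj !Eb -beta_shift; congr beta; ring.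
- apply: joint_decay_compact_smooth => M N.
  have [B HB] := diagonal_limit_nat Hl0 Hshift M N; exists B => _ j k.
  have [v [Hv Hle]] := HB j k.
  rewrite entry_minus entry_toeplitz Eb.
  rewrite (diagonal_limit_unique (Hbeta _ _) Hv).
  have -> : (entry a j k - v)%C = (- (v - entry a j k))%C by ring.
  by rewrite Cmod_opp.
- by apply: BL_ext => x; apply: l2_ext => i; rewrite /minus /plus /opp /=; ring.
Qed.

(** * Contour integrals of resolvents *)

Lemma is_RInt_linear (V W : NormedModule R_AbsRing) (phi : V -> W)
    (F : R -> V) (x y : R) (J : V) :
  is_linear phi -> is_RInt F x y J -> is_RInt (fun t => phi (F t)) x y (phi J).
Proof.
move=> Hphi HJ.
apply: (filterlim_ext (fun ptd => phi (scal (sign (y - x)) (Riemann_sum F ptd)))).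
  move=> ptd; rewrite (linear_scal _ Hphi); congr scal.
  have phi0 : phi zero = zero.
    by rewrite -(scal_zero_l (V := V) zero) (linear_scal _ Hphi) scal_zero_l.
  rewrite /Riemann_sum; move: (SF_h ptd, zero) (SF_t ptd) => p s.
  elim: s p => [//|q s IH] p /=.
  by rewrite (linear_plus _ Hphi) (linear_scal _ Hphi) IH.
exact: filterlim_comp HJ (linear_cont phi J Hphi).
Qed.

Lemma is_linear_real (V W : NormedModule C_AbsRing) (phi : V -> W) :
  is_linear phi ->
  is_linear (K := R_AbsRing) (U := real_NormedModule V) (V := real_NormedModule W) phi.
Proof.
move=> [H1 H2 H3]; constructor => //.
by move=> k x; exact: (H2 (RtoC k) x).
Qed.

(** Suprema of moduli of linear functionals are the only seminorms needed, and
    they do not increase under averaging. *)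
Section FunctionalBounds.
Variables (Q : Type) (psi : Q -> BL HN HN -> C).
Hypothesis psi_linear : forall q, is_linear (K := C_AbsRing)
  (U := BL_NormedModule HN HN) (V := C_NormedModule) (psi q).

Definition functionals_bounded (T : Type) (X : T -> BL HN HN) : Prop :=
  exists B : R, forall t q, Cmod (psi q (X t)) <= B.

Lemma functionals_bounded_plus (T : Type) (X Y : T -> BL HN HN) :
  functionals_bounded X -> functionals_bounded Y ->
  functionals_bounded (fun t => plus (X t) (Y t)).
Proof.
move=> [B HB] [B' HB']; exists (B + B') => t q.
rewrite (linear_plus _ (psi_linear q)).
by apply: Rle_trans (Cmod_triangle _ _) _; apply: Rplus_le_compat.
Qed.

Lemma functionals_bounded_scal (T : Type) (c : T -> C) (X : T -> BL HN HN) :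
  (exists M, forall t, Cmod (c t) <= M) -> functionals_bounded X ->
  functionals_bounded (fun t => scal (c t) (X t)).
Proof.
move=> [M HM] [B HB]; exists (M * B) => t q.
rewrite (linear_scal _ (psi_linear q)) -[scal _ _]/(c t * psi q (X t))%C Cmod_mult.
by apply: Rmult_le_compat; try exact: Cmod_ge_0.
Qed.

Lemma functionals_bounded_integral (F : R -> BL HN HN) (J : BL HN HN) :
  functionals_bounded F ->
  is_RInt (V := real_NormedModule (BL_NormedModule HN HN)) F 0 1 J ->
  functionals_bounded (fun _ : unit => J).
Proof.
move=> [B HB] HJ; exists B => _ q.
have H := is_RInt_linear (is_linear_real (psi_linear q)) HJ.
have := @norm_RInt_le_const (real_NormedModule C_NormedModule)
  (fun t => psi q (F t)) 0 1 (psi q J) B Rle_0_1 (fun t _ => HB t q) H.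
rewrite Rminus_0_r Rmult_1_l; exact.
Qed.

Lemma functionals_bounded_lsum (I : Type) (X : I -> BL HN HN) (s : list I) :
  (forall i, In i s -> functionals_bounded (fun _ : unit => X i)) ->
  functionals_bounded (fun _ : unit => lsum X s).
Proof.
elim: s => [|i s IH] H.
  exists 0 => _ q; rewrite -[lsum _ _]/(zero : BL HN HN).
  rewrite -(scal_zero_l (V := BL_NormedModule HN HN) zero).
  rewrite (linear_scal _ (psi_linear q)) -[scal _ _]/(0 * psi q zero)%C.
  by rewrite Cmult_0_l Cmod_0; exact: Rle_refl.
apply: (functionals_bounded_plus (H i (or_introl erefl))).
by apply: IH => j Hj; apply: H; right.
Qed.

End FunctionalBounds.

Definition offdiag_functional (N : nat) (jk : nat * nat) (X : BL HN HN) : C :=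
  (RtoC ((1 + gap jk.1 jk.2) ^ N) * entry X jk.1 jk.2)%C.

Definition shift_functional (l M N : nat) (jk : nat * nat) (X : BL HN HN) : C :=
  (RtoC ((1 + INR jk.1) ^ M * (1 + INR jk.2) ^ N) *
   entry (shift_difference l X) jk.1 jk.2)%C.

Lemma is_linear_Cmult (V : NormedModule C_AbsRing) (c : C) (phi : V -> C) :
  is_linear (K := C_AbsRing) (V := C_NormedModule) phi ->
  is_linear (K := C_AbsRing) (V := C_NormedModule) (fun x => c * phi x)%C.
Proof. exact: (is_linear_scal_fun (F := C_NormedModule) c Cmult_comm). Qed.

Lemma offdiag_functional_linear (N : nat) (jk : nat * nat) :
  is_linear (K := C_AbsRing) (U := BL_NormedModule HN HN) (V := C_NormedModule)
    (offdiag_functional N jk).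
Proof. apply: is_linear_Cmult; exact: entry_is_linear. Qed.

Lemma shift_functional_linear (l M N : nat) (jk : nat * nat) :
  is_linear (K := C_AbsRing) (U := BL_NormedModule HN HN) (V := C_NormedModule)
    (shift_functional l M N jk).
Proof.
apply: is_linear_Cmult.
have -> : (fun X : BL HN HN => entry (shift_difference l X) jk.1 jk.2) =
    fun X => (entry X (jk.1 + l)%N (jk.2 + l)%N + - (1) * entry X jk.1 jk.2)%C.
  apply: functional_extensionality => X.
  by rewrite entry_shift_difference; ring.
apply: (is_linear_plus_fun (F := C_NormedModule)); first exact: entry_is_linear.
apply: is_linear_Cmult; exact: entry_is_linear.
Qed.

Lemma offdiag_decay_functional (T : Type) (X : T -> BL HN HN) :
  offdiag_decay X <-> forall N, functionals_bounded (offdiag_functional N) X.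
Proof.
have E N t j k : Cmod (offdiag_functional N (j, k) (X t)) =
    (1 + gap j k) ^ N * Cmod (entry (X t) j k).
  rewrite Cmod_mult Cmod_R Rabs_pos_eq //; apply: pow_le.
  by have := gap_ge0 j k; rewrite /=; lra.
split=> H N; have [B HB] := H N; exists B.
  by move=> t [j k]; rewrite E.
by move=> t j k; rewrite -E.
Qed.

Lemma shift_decay_functional (T : Type) (l : nat) (X : T -> BL HN HN) :
  joint_decay (fun t => shift_difference l (X t)) <->
  forall M N, functionals_bounded (shift_functional l M N) X.
Proof.
have E M N t j k : Cmod (shift_functional l M N (j, k) (X t)) =
    (1 + INR j) ^ M * (1 + INR k) ^ N * Cmod (entry (shift_difference l (X t)) j k).
  rewrite Cmod_mult Cmod_R Rabs_pos_eq //.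
  by apply: Rmult_le_pos; apply: pow_le; have := pos_INR j; have := pos_INR k;
    rewrite /=; lra.
split=> H M N; have [B HB] := H M N; exists B.
  by move=> t [j k]; rewrite E.
by move=> t j k; rewrite -E.
Qed.

(** An arc is only controlled on [[0, 1]]; precomposing with [clamp] gives
    functions that are continuous on all of [R], with the same integral. *)
Definition clamp (t : R) : R := Rmax 0 (Rmin t 1).

Lemma clamp_range (t : R) : 0 <= clamp t <= 1.
Proof.
rewrite /clamp; split; first exact: Rmax_l.
by apply: Rmax_lub; [lra|exact: Rmin_r].
Qed.

Lemma clamp_id (t : R) : 0 <= t <= 1 -> clamp t = t.
Proof. by move=> H; rewrite /clamp Rmin_left ?Rmax_right; lra. Qed.

Lemma clamp_continuous (t : R) : continuous clamp t.
Proof.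
have Hl s u : Rabs (clamp s - clamp u) <= Rabs (s - u).
  rewrite /clamp /Rmax /Rmin; case: (Rle_dec s 1) => ?; case: (Rle_dec u 1) => ?;
    repeat (case: (Rle_dec 0 _) => ?); split_Rabs; lra.
apply/filterlim_locally => eps; exists eps => s Hs.
exact: Rle_lt_trans (Hl s t) Hs.
Qed.

(** [C] carries two uniform structures, by the modulus and by the coordinates,
    with the same neighbourhoods. *)
Lemma continuous_C_AbsRing (U : UniformSpace) (u : U -> C) (x : U) :
  continuous (U := C_UniformSpace) u x <->
  continuous (U := AbsRing_UniformSpace C_AbsRing) u x.
Proof.
by split=> H P HP; apply: H; apply/locally_C.
Qed.

Lemma bounded_of_clamp (V : NormedModule C_AbsRing) (u : R -> V) :
  (forall t, continuous (fun t => u (clamp t)) t) ->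
  exists M, forall t, norm (u (clamp t)) <= M.
Proof.
move=> H.
have [M HM] := bounded_continuity (fun t => u (clamp t)) 0 1 (fun t _ => H t).
exists M => t; have := HM (clamp t) (clamp_range t).
by rewrite (clamp_id (clamp_range t)); exact: Rlt_le.
Qed.

Section ResolventContinuity.
Variables (A : BL HN HN -> Prop) (a : BL HN HN).

Lemma resolvent_identity (z w : C) (r r' : BL HN HN) :
  is_resolvent A a z r -> is_resolvent A a w r' ->
  minus r r' = scal (w - z)%C (BL_comp r r').
Proof.
move=> [_ [H1 H2]] [_ [H3 H4]].
have E1 : r = BL_comp (BL_comp r (minus (scal w BL_id) a)) r'.
  by rewrite -BL_compA H4 BL_comp_id_r.
have E2 : r' = BL_comp (BL_comp r (minus (scal z BL_id) a)) r'.
  by rewrite H1 BL_comp_id_l.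
rewrite {1}E1 {2}E2 -BL_comp_minus_l -BL_comp_minus_r.
have -> : minus (minus (scal w BL_id) a) (minus (scal z BL_id) a) =
    scal (w - z)%C (BL_id : BL HN HN).
  apply: BL_ext => x; apply: l2_ext => i; rewrite /minus /plus /opp /scal /=; ring.
by rewrite BL_comp_scal_r BL_comp_id_r BL_comp_scal_l.
Qed.

(** For [|z - w| <= 1 / (2 |r'|)] the resolvent identity first bounds [r] by
    [2 |r'|], and then gives a Lipschitz estimate. *)
Lemma resolvent_lipschitz (w : C) (r' : BL HN HN) : is_resolvent A a w r' ->
  exists delta K : R, 0 < delta /\ 0 <= K /\ forall z r, is_resolvent A a z r ->
    Cmod (z - w) < delta -> BL_norm (minus r r') <= K * Cmod (z - w).
Proof.
move=> Hr'; set k := BL_norm r'; have Hk : 0 <= k by exact: BL_norm_ge0.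
exists (/ (2 * (k + 1))), (2 * k * k); split; first by apply: Rinv_0_lt_compat; lra.
split; first by nra.
move=> z r Hr Hz; have Hc := Cmod_ge_0 (z - w)%C; have Hn := BL_norm_ge0 r.
have Hle : BL_norm (minus r r') <= Cmod (z - w) * (BL_norm r * k).
  rewrite (resolvent_identity Hr Hr'); apply: Rle_trans (BL_norm_scal _ _) _.
  have -> : (w - z)%C = (- (z - w))%C by ring.
  rewrite Cmod_opp; apply: Rmult_le_compat_l => //; exact: BL_norm_comp.
have Hsum : BL_norm r <= BL_norm (minus r r') + k.
  have E : r = plus (minus r r') r'.
    by rewrite /minus -plus_assoc plus_opp_l plus_zero_r.
  by rewrite {1}E; exact: BL_norm_triangle.
have Hhalf : Cmod (z - w) * (k + 1) < / 2.
  have -> : / 2 = / (2 * (k + 1)) * (k + 1) by field; lra.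
  by apply: Rmult_lt_compat_r; lra.
have H2 : BL_norm r <= 2 * k by nra.
apply: Rle_trans Hle _.
have -> : 2 * k * k * Cmod (z - w) = Cmod (z - w) * (2 * k * k) by ring.
by apply: Rmult_le_compat_l => //; nra.
Qed.

Lemma resolvent_continuous (U : UniformSpace) (u : U -> C) (r : U -> BL HN HN)
    (x : U) :
  (forall y, is_resolvent A a (u y) (r y)) ->
  continuous (U := AbsRing_UniformSpace C_AbsRing) u x ->
  continuous (U := BL_NormedModule HN HN) r x.
Proof.
move=> Hr Hu; have [delta [K [Hd [HK H]]]] := resolvent_lipschitz (Hr x).
apply/filterlim_locally => eps; have He := cond_pos eps.
have Hm : 0 < Rmin delta (eps / (K + 1)).
  by apply: Rmin_glb_lt => //; apply: Rdiv_lt_0_compat; lra.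
have Hloc : locally x (fun y => ball (M := AbsRing_UniformSpace C_AbsRing) (u x)
    (mkposreal _ Hm) (u y)).
  exact: (proj1 (filterlim_locally (U := AbsRing_UniformSpace C_AbsRing) u (u x)) Hu).
apply: filter_imp Hloc => y Hy.
have Hy' : Cmod (u y - u x) < Rmin delta (eps / (K + 1)) by exact: Hy.
suff HB : BL_norm (minus (r y) (r x)) < eps by exact: HB.
apply: Rle_lt_trans (H _ _ (Hr y) _) _.
  exact: Rlt_le_trans Hy' (Rmin_l _ _).
have H2 := Rlt_le_trans _ _ _ Hy' (Rmin_r _ _).
have Hc := Cmod_ge_0 (u y - u x)%C.
move/Rlt_div_r: H2 => H2; have {}H2 := H2 ltac:(lra); nra.
Qed.

End ResolventContinuity.

(** On each arc the integrand is continuous in norm, so the integral exists, and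
    its entries inherit the estimates that hold uniformly for the integrand. *)
Lemma functional_calculus_smooth (S : supernatural)
    (a : BL HN HN) (a_smooth : BDT_smooth S a) (f : C -> C) (Gamma : list arc)
    (res : C -> BL HN HN) :
  (forall z, on_chain Gamma z -> is_resolvent (BDT S) a z (res z)) ->
  (forall z, on_chain Gamma z -> continuous (T := AbsRing_UniformSpace C_AbsRing)
     (U := AbsRing_UniformSpace C_AbsRing) f z) ->
  exists J : BL HN HN,
    is_contour_integral Gamma (fun zeta => scal (f zeta) (res zeta)) J /\
    BDT_smooth S (scal (/ (2 * PI * Ci))%C J).
Proof.
move=> Hres Hf.
have [l [Hl [Ha_off Ha_shift]]] := BDT_smooth_decay a_smooth.
have Harc (g : arc) : exists J : BL HN HN, In g Gamma ->
    is_RInt (V := real_NormedModule (BL_NormedModule HN HN))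
      (fun t => scal (arc_speed g t) (scal (f (g t)) (res (g t)))) 0 1 J /\
    offdiag_decay (fun _ : unit => J) /\
    joint_decay (fun _ : unit => shift_difference l J).
  case: (classic (In g Gamma)) => Hg; last by exists zero.
  have Hon t : on_chain Gamma (g (clamp t)).
    by exists g, (clamp t); split=> //; split=> //; exact: clamp_range.
  have Cg t : continuous (U := AbsRing_UniformSpace C_AbsRing)
      (fun t => g (clamp t)) t.
    apply: (@continuous_comp _ _ (AbsRing_UniformSpace C_AbsRing) clamp g t); first exact: clamp_continuous.
    apply/continuous_C_AbsRing.
    apply: (ex_derive_continuous (K := R_AbsRing) (V := C_R_NormedModule)).
    by exists (arc_speed g (clamp t)); apply: arc_derive; exact: clamp_range.
  have Cf t : continuous (U := AbsRing_UniformSpace C_AbsRing)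
      (fun t => f (g (clamp t))) t.
    by apply: (@continuous_comp _ (AbsRing_UniformSpace C_AbsRing)
      (AbsRing_UniformSpace C_AbsRing) (fun t => g (clamp t)) f t); [exact: Cg|exact: Hf].
  have Cs t : continuous (U := AbsRing_UniformSpace C_AbsRing)
      (fun t => arc_speed g (clamp t)) t.
    apply: (@continuous_comp _ _ (AbsRing_UniformSpace C_AbsRing) clamp
      (arc_speed g) t); first exact: clamp_continuous.
    by apply/continuous_C_AbsRing; apply: arc_speed_continuous; exact: clamp_range.
  have Cr t : continuous (U := BL_NormedModule HN HN)
      (fun t => res (g (clamp t))) t.
    exact: (resolvent_continuous (fun t => Hres _ (Hon t)) (Cg t)).
  pose h t : BL HN HN := scal (arc_speed g (clamp t))
    (scal (f (g (clamp t))) (res (g (clamp t)))).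
  have Ch t : continuous (U := BL_NormedModule HN HN) h t.
    apply: (continuous_scal (V := BL_NormedModule HN HN)); first exact: Cs.
    by apply: (continuous_scal (V := BL_NormedModule HN HN)); [exact: Cf|exact: Cr].
  have [J HJ] := @ex_RInt_continuous
    (real_BL_CompleteNormedModule HN (l2_CompleteNormedModule nat)) h 0 1
    (fun t _ => Ch t).
  have bnd (u : R -> C) : (forall t, continuous (U := AbsRing_UniformSpace C_AbsRing)
      (fun t => u (clamp t)) t) -> exists M, forall t, Cmod (u (clamp t)) <= M.
    move=> Hu; apply: (@bounded_of_clamp C_NormedModule u) => t.
    by apply/continuous_C_AbsRing; exact: Hu.
  have Bg := bnd _ Cg; have Bf := bnd (fun t => f (g t)) Cf; have Bs := bnd _ Cs.
  have Br : ubounded (fun t => res (g (clamp t))).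
    exact: (@bounded_of_clamp (BL_NormedModule HN HN) (fun t => res (g t)) Cr).
  have Rl t := proj1 (proj2 (Hres _ (Hon t))).
  have Rr t := proj2 (proj2 (Hres _ (Hon t))).
  have Doff := resolvent_offdiag_decay Ha_off Bg Rl Rr Br.
  have Dshift := resolvent_shift_decay Ha_off Ha_shift Bg Rl Rr Br.
  exists J => _; split; [|split].
  - apply: is_RInt_ext HJ => t; rewrite Rmin_left ?Rmax_right; try lra; move=> Ht.
    by rewrite /h clamp_id //; lra.
  - apply/offdiag_decay_functional => N.
    have lin := offdiag_functional_linear N.
    apply: (functionals_bounded_integral lin _ HJ).
    apply: functionals_bounded_scal => //; apply: functionals_bounded_scal => //.
    by move: N {lin}; apply/offdiag_decay_functional.
  - apply/shift_decay_functional => M N.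
    have lin := shift_functional_linear l M N.
    apply: (functionals_bounded_integral lin _ HJ).
    apply: functionals_bounded_scal => //; apply: functionals_bounded_scal => //.
    by move: M N {lin}; apply/shift_decay_functional.
have [Jg HJg] := choice _ Harc.
exists (lsum Jg Gamma); split.
  by exists Jg; split=> // g Hg; case: (HJg g Hg).
set c := (/ (2 * PI * Ci))%C.
have Bc : exists M, forall _ : unit, Cmod c <= M by exists (Cmod c) => _; exact: Rle_refl.
apply: (decay_BDT_smooth Hl).
- apply/offdiag_decay_functional => N.
  have lin := offdiag_functional_linear N.
  apply: (functionals_bounded_scal lin (c := fun _ => c)) => //.
  apply: functionals_bounded_lsum => // g Hg; move: N {lin}.
  by apply/offdiag_decay_functional; case: (HJg g Hg) => _ [].
- apply/(shift_decay_functional l (fun _ : unit => scal c (lsum Jg Gamma))) => M N.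
  have lin := shift_functional_linear l M N.
  apply: (functionals_bounded_scal lin (c := fun _ => c)) => //.
  apply: functionals_bounded_lsum => // g Hg; move: M N {lin}.
  by apply/(shift_decay_functional l (fun _ : unit => Jg g)); case: (HJg g Hg) => _ [].
Qed.

Theorem proposition4p1 (S : supernatural) (S_infinite : sn_infinite S)
    (a : BL HN HN) (a_smooth : BDT_smooth S a)
    (Omega : C -> Prop) (Omega_open : open Omega)
    (Omega_spectrum : forall z : C, spectrum (BDT S) a z -> Omega z)
    (f : C -> C) (f_holomorphic : forall z : C, Omega z -> ex_derive f z)
    (Gamma : list arc)
    (Gamma_surrounds : surrounds Gamma (spectrum (BDT S) a) Omega) :
  exists fa : BL HN HN,
    is_functional_calculus (BDT S) a f Gamma fa /\ BDT_smooth S fa.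
Proof.
have [_ [Hchain _]] := Gamma_surrounds.
have [res Hres] := choice (fun z r => on_chain Gamma z -> is_resolvent (BDT S) a z r)
  (fun z => match excluded_middle_informative (on_chain Gamma z) with
   | left Hz => match NNPP _ (proj2 (Hchain z Hz)) with
                | ex_intro r Hr => ex_intro _ r (fun _ => Hr)
                end
   | right Hz => ex_intro _ zero (fun H => False_ind _ (Hz H))
   end).
have Hf z : on_chain Gamma z -> continuous (T := AbsRing_UniformSpace C_AbsRing)
    (U := AbsRing_UniformSpace C_AbsRing) f z.
  move=> Hz; have := ex_derive_continuous _ _ (f_holomorphic z (proj1 (Hchain z Hz))).
  by move/continuous_C_AbsRing.
have [J [HJ Hsmooth]] := functional_calculus_smooth a_smooth Hres Hf.
exists (scal (/ (2 * PI * Ci))%C J); split=> //.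
by exists res, J.
Qed.
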